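(* With the action $\widehat\otimes$ of $K_0(\mathcal H_\bullet(0))$ on $K_0(\mathcal H^D_\bullet(0))$ and the coaction $\Delta$ of $G_0(\mathcal H_\bullet(0))$ on $G_0(\mathcal H^D_\bullet(0))$ defined in the context: (i) $K_0(\mathcal H^D_\bullet(0))$ is a right graded $K_0(\mathcal H_\bullet(0))$-module, isomorphic to the right graded $\mathbf{NSym}$-module $\mathbf{NSym}^D$ via the noncommutative characteristic maps $\mathbf{ch}^D$ and $\mathbf{ch}$. (ii) $G_0(\mathcal H^D_\bullet(0))$ is a right graded $G_0(\mathcal H_\bullet(0))$-comodule, isomorphic to the right graded $\mathrm{QSym}$-comodule $\mathrm{QSym}^D$ via the quasisymmetric characteristic maps $\mathrm{Ch}^D$ and $\mathrm{Ch}$. (iii) The graded module and comodule structures in (i) and (ii) are dual to each other.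
   Context: $\mathbb F$ is an arbitrary field. $\mathcal H_n(0)$ is the $\mathbb F$-algebra generated by $\pi_1,\ldots,\pi_{n-1}$ with $\pi_i^2=\pi_i$ and the braid relations of $\mathfrak S_n$; $\mathcal H_0(0)=\mathbb F$. For $n\ge2$, $\mathcal H^D_n(0)$ is the $\mathbb F$-algebra generated by $\pi_0,\ldots,\pi_{n-1}$ with $\pi_i^2=\pi_i$ and the braid relations of the Coxeter group of type $D_n$ (generators $s_0,\ldots,s_{n-1}$; $s_1,\ldots,s_{n-1}$ satisfy the relations of $\mathfrak S_n$, and $s_0$ commutes with all $s_i$ except $s_2$, for which $s_0s_2s_0=s_2s_0s_2$). $\overline\pi_i:=\pi_i-1$. For a reduced expression $w=s_{i_1}\cdots s_{i_r}$ put $\pi_w=\pi_{i_1}\cdots\pi_{i_r}$, $\overline\pi_w=\overline\pi_{i_1}\cdots\overline\pi_{i_r}$. For a set $I$ of Coxeter generators, $w_0(I)$ is the longest element of the subgroup generated by $I$, and $I^c$ the complement of $I$. A composition of $n$ is a sequence of positive integers with sum $n$; a pseudo-composition of $n$ is a sequence $\alpha=(\alpha_1,\ldots,\alpha_\ell)$, $\ell\ge1$, with $\alpha_1\ge0$, $\alpha_2,\ldots,\alpha_\ell>0$ and sum $n$. $D(\alpha)=\{\alpha_1,\alpha_1+\alpha_2,\ldots,\alpha_1+\cdots+\alpha_{\ell-1}\}$; this gives bijections from compositions (pseudo-compositions) of $n$ to subsets of $\{1,\ldots,n-1\}$ ($\{0,\ldots,n-1\}$). With $I=\{s_i:i\in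 D(\alpha)\}$, the projective indecomposable module indexed by $\alpha$ is $\mathbf P_\alpha\cong\mathcal H_n(0)\overline\pi_{w_0(I)}\pi_{w_0(I^c)}$ in type A ($\alpha$ a composition) and $\mathbf P^D_\alpha\cong\mathcal H^D_n(0)\overline\pi_{w_0(I)}\pi_{w_0(I^c)}$ in type D ($\alpha$ a pseudo-composition of $n\ge2$). Their tops $\mathbf C_\alpha$ and $\mathbf C^D_\alpha$ are the one-dimensional modules on which $\overline\pi_i$ acts by $-1$ if $i\in D(\alpha)$ and by $0$ otherwise. These are all the projective indecomposables and all the simples. $G_0(A)$ (resp. $K_0(A)$) is the Grothendieck group of finitely generated (resp. finitely generated projective) left $A$-modules; $G_0(\mathcal H_\bullet(0))=\bigoplus_{n\ge0}G_0(\mathcal H_n(0))$, $G_0(\mathcal H^D_\bullet(0))=\bigoplus_{n\ge2}G_0(\mathcal H^D_n(0))$, and similarly for $K_0$. $G_0(\mathcal H_\bullet(0))$ and $K_0(\mathcal H_\bullet(0))$ are graded Hopf algebras with product $M\widehat\otimes N=(M\otimes N)\uparrow_{\mathcal H_m(0)\otimes\mathcal H_n(0)}^{\mathcal H_{m+n}(0)}$ and coproduct $\Delta M=\sum_{0\le i\le m}M\downarrow_{\mathcal H_i(0)\otimes\mathcal H_{m-i}(0)}^{\mathcal H_m(0)}$, where $\mathcal H_m(0)\otimes\mathcal H_n(0)$ is the subalgebra of $\mathcal H_{m+n}(0)$ generated by $\pi_i$, $i\ne m$. Here $N\uparrow_B^A=A\otimes_BN$ and $\downarrow$ is restriction. For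 $m\ge2$ let $\mathcal H^D_{m,n}(0)\cong\mathcal H^D_m(0)\otimes\mathcal H_n(0)$ be the subalgebra of $\mathcal H^D_{m+n}(0)$ generated by $\pi_i$, $0\le i\le m+n-1$, $i\ne m$. The right action and right coaction are $$M\widehat\otimes N:=(M\otimes N)\uparrow_{\mathcal H^D_{m,n}(0)}^{\mathcal H^D_{m+n}(0)},\qquad\Delta Q:=\sum_{2\le i\le n}Q\downarrow_{\mathcal H^D_{i,n-i}(0)}^{\mathcal H^D_n(0)}$$ for $M\in K_0(\mathcal H^D_m(0))$ ($m\ge2$), $N\in K_0(\mathcal H_n(0))$, $Q\in G_0(\mathcal H^D_n(0))$, with $G_0(\mathcal H^D_{i,n-i}(0))$ identified with $G_0(\mathcal H^D_i(0))\otimes G_0(\mathcal H_{n-i}(0))$. Commutative side: for $\alpha\models n$, $F_\alpha=\sum x_{i_1}\cdots x_{i_n}$ over $1\le i_1\le\cdots\le i_n$ with $i_j<i_{j+1}$ whenever $j\in D(\alpha)$; $\mathrm{QSym}$ is the Hopf algebra with $\mathbb Z$-basis $\{F_\alpha\}$ and coproduct $\Delta f(x_1,x_2,\ldots)=f(x_1,x_2,\ldots,y_1,y_2,\ldots)$. For a pseudo-composition $\alpha$ of $n\ge2$, $F^D_\alpha=\sum x_{i_1}\cdots x_{i_n}$ over integers $i_0\le i_1\le\cdots\le i_n$ with $i_0:=-i_2$ and $i_j<i_{j+1}$ whenever $j\in D(\alpha)$ (commuting variables $x_i$, $i\in\mathbb Z$); $\mathrm{QSym}^D$ has $\mathbb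 Z$-basis $\{F^D_\alpha\}$. It is a right $\mathrm{QSym}$-comodule by replacing the ordered variables $\ldots,x_{-1},x_0,x_1,\ldots$ with $\ldots,x_{-1},x_0,x_1,\ldots,y_1,y_2,\ldots$ and keeping only terms of degree at least $2$ in the $x$'s; explicitly $F^D_\alpha\mapsto\sum_{2\le i\le n}F^D_{\alpha_{\le i}}\otimes F_{\alpha_{>i}}$, where $\alpha_{\le i}$ is the pseudo-composition of $i$ with $D(\alpha_{\le i})=D(\alpha)\cap\{0,\ldots,i-1\}$ and $\alpha_{>i}$ the composition of $n-i$ with $D(\alpha_{>i})=\{d-i:d\in D(\alpha),d>i\}$. Noncommutative side: let $\mathbf x_i$ ($i\in\mathbb Z$) be noncommuting variables. For $\alpha\models n$, $\mathbf s_\alpha=\sum\mathbf x_{w_1}\cdots\mathbf x_{w_n}$ over words $w\in\mathbb Z^n$ with $w_j>w_{j+1}$ if $j\in D(\alpha)$ and $w_j\le w_{j+1}$ if $j\in\{1,\ldots,n-1\}\setminus D(\alpha)$; $\mathbf{NSym}$ is the ring with $\mathbb Z$-basis $\{\mathbf s_\alpha\}$ (freely generated by $\mathbf h_k=\mathbf s_{(k)}$, $k\ge1$). For a pseudo-composition $\alpha$ of $n\ge2$, $\mathbf s^D_\alpha$ is the analogous sum over $w\in\mathbb Z^n$ with $w_0:=-w_2$, requiring $w_j>w_{j+1}$ for $j\in D(\alpha)$ and $w_j\le w_{j+1}$ for $j\in\{0,\ldots,n-1\}\setminus D(\alpha)$; $\mathbf{NSym}^D$ is the $\mathbb Z$-span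 of all $\mathbf s^D_\alpha$ (which form a basis), a right $\mathbf{NSym}$-module by multiplication of formal power series. Characteristic maps (linear isomorphisms): $\mathbf{ch}(\mathbf P_\alpha)=\mathbf s_\alpha$ and $\mathrm{Ch}(\mathbf C_\alpha)=F_\alpha$ over all compositions $\alpha$ ($\mathbf{ch}:K_0(\mathcal H_\bullet(0))\to\mathbf{NSym}$ and $\mathrm{Ch}:G_0(\mathcal H_\bullet(0))\to\mathrm{QSym}$ are Hopf algebra isomorphisms); $\mathbf{ch}^D:K_0(\mathcal H^D_\bullet(0))\to\mathbf{NSym}^D$, $\mathbf P^D_\alpha\mapsto\mathbf s^D_\alpha$, and $\mathrm{Ch}^D:G_0(\mathcal H^D_\bullet(0))\to\mathrm{QSym}^D$, $\mathbf C^D_\alpha\mapsto F^D_\alpha$, over all pseudo-compositions $\alpha$ of $n\ge2$. Duality in (iii) is with respect to the pairings $\langle P,M\rangle=\dim_{\mathbb F}\mathrm{Hom}(P,M)$ for $P$ in $K_0$ and $M$ in $G_0$ of the same algebra, and $0$ for different degrees (both in type A and in type D): it means $\langle P\widehat\otimes N,Q\rangle=\langle P\otimes N,\Delta Q\rangle$. Under the characteristic maps this corresponds to the pairings in which $\{\mathbf s_\alpha\}$, $\{F_\alpha\}$ and $\{\mathbf s^D_\alpha\}$, $\{F^D_\alpha\}$ are dual bases. *)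

(* Defs.v *)
From HB Require Import structures.
From mathcomp Require Import all_boot all_order all_algebra.
From mathcomp Require Import generic_quotient ring_quotient.
From mathcomp Require Import finmap multiset freeg.
From mathcomp Require Import boolp classical_sets functions.
From mathcomp Require Import character.

Set Implicit Arguments.
Unset Strict Implicit.
Unset Printing Implicit Defensive.

Import Order.TTheory GRing.Theory Num.Theory.

Local Open Scope ring_scope.
Local Open Scope quotient_scope.
Local Open Scope classical_set_scope.

(** * Abelian groups: spans, presentations, tensor products, direct sums *)

Section Span.
Variable V : zmodType.

Inductive zspan_ind (S : set V) : V -> Prop :=
| zspan_ind0 : zspan_ind S 0
| zspan_ind_gen x of S x : zspan_ind S x
| zspan_indB x y of zspan_ind S x & zspan_ind S y : zspan_ind S (x - y).

Definition zspan (S : set V) : {pred V} := fun x => `[< zspan_ind S x >].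

Fact zspan_zmod_closed S : zmod_closed (zspan S).
Proof.
split=> [|x y /asboolP Sx /asboolP Sy]; apply/asboolP.
  exact: zspan_ind0.
exact: zspan_indB.
Qed.

HB.instance Definition _ S :=
  GRing.isZmodClosed.Build V (zspan S) (zspan_zmod_closed S).

Lemma zspan_gen (S : set V) x : S x -> x \in zspan S.
Proof. by move=> Sx; apply/asboolP/zspan_ind_gen. Qed.

Record spanZ (S : set V) := SpanZ {span_val : V; _ : span_val \in zspan S}.
HB.instance Definition _ S := [isSub for @span_val S].
HB.instance Definition _ S := [Choice of spanZ S by <:].
HB.instance Definition _ S := [SubChoice_isSubZmodule of spanZ S by <:].

End Span.

(* The abelian group with generators [K] and relations [r = 0] for [r] in [S]. *)
Section Presentation.
Variables (K : choiceType) (S : set {freeg K}).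

Definition presZ : Type := Quotient.quot (zspan S).
HB.instance Definition _ := GRing.Zmodule.on presZ.

Definition presZ_gen (k : K) : presZ := \pi_(Quotient.quot (zspan S)) << k >>.

Definition presZ_lift (W : zmodType) (f : K -> W) (x : presZ) : W :=
  fglift (f : K -> zmodule W) (repr (x : Quotient.quot (zspan S))).

Section Lift.
Variables (W : zmodType) (f : K -> W).
Hypothesis f_rel : forall r, S r -> fglift (f : K -> zmodule W) r = 0.

Let fgliftB : {morph fglift (f : K -> zmodule W) : x y / x - y}.
Proof. exact: lift_is_additive. Qed.

Let f_span r : r \in zspan S -> fglift (f : K -> zmodule W) r = 0.
Proof.
move/asboolP; elim=> [|x /f_rel //|x y _ hx _ hy].
  by rewrite -(subrr 0) fgliftB subrr.
by rewrite fgliftB hx hy subr0.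
Qed.

Let lift_pi r :
  presZ_lift f (\pi_(Quotient.quot (zspan S)) r) = fglift (f : K -> zmodule W) r.
Proof.
apply/eqP; rewrite -subr_eq0 /presZ_lift -fgliftB; apply/eqP/f_span.
by rewrite Quotient.idealrBE reprK.
Qed.

Lemma presZ_lift_gen k : presZ_lift f (presZ_gen k) = f k.
Proof. by rewrite lift_pi liftU scale1r. Qed.

Lemma presZ_lift_additive : {morph presZ_lift f : x y / x - y}.
Proof.
move=> x y; rewrite -[x](@reprK _ (Quotient.quot (zspan S))).
rewrite -[y](@reprK _ (Quotient.quot (zspan S))).
have -> (a b : {freeg K}) : (\pi_(Quotient.quot (zspan S)) a : presZ)
   - (\pi_(Quotient.quot (zspan S)) b : presZ) = \pi_(Quotient.quot (zspan S)) (a - b).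
  by rewrite raddfB.
by rewrite !lift_pi fgliftB.
Qed.

End Lift.
End Presentation.

(* U (x)_R V, for a right action [ra] of R on U and a left action [la] on V. *)
Section Tensor.
Variables (U V : zmodType) (R : Type) (ra : U -> R -> U) (la : R -> V -> V).

Inductive btensor_rel : set {freeg (U * V)%type} :=
| btensor_relDl u u' v :
    btensor_rel (<< (u + u', v) >> - << (u, v) >> - << (u', v) >>)
| btensor_relDr u v v' :
    btensor_rel (<< (u, v + v') >> - << (u, v) >> - << (u, v') >>)
| btensor_relM u r v : btensor_rel (<< (ra u r, v) >> - << (u, la r v) >>).

Definition btensor : Type := presZ btensor_rel.
HB.instance Definition _ := GRing.Zmodule.on btensor.
Definition bpure (u : U) (v : V) : btensor := presZ_gen btensor_rel (u, v).
End Tensor.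

Definition biadditive (U V W : zmodType) (f : U -> V -> W) :=
  (forall u, {morph f u : v v' / v + v'}) /\
  (forall v, {morph f^~ v : u u' / u + u'}).

Section TensorZ.

Definition tensor (U V : zmodType) : Type :=
  btensor (fun (u : U) (n : int) => u *~ n) (fun (n : int) (v : V) => v *~ n).
HB.instance Definition _ U V := GRing.Zmodule.on (tensor U V).

Definition pure (U V : zmodType) (u : U) (v : V) : tensor U V := bpure _ _ u v.

(* The map induced on [tensor U V] by a biadditive map. *)
Definition tlift (U V W : zmodType) (f : U -> V -> W) (t : tensor U V) : W :=
  presZ_lift (fun p : U * V => f p.1 p.2) t.

Definition tmap (U U' V V' : zmodType) (f : U -> U') (g : V -> V') :
    tensor U V -> tensor U' V' :=
  tlift (fun u v => pure (f u) (g v)).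

Definition tassoc (U V W : zmodType) :
    tensor (tensor U V) W -> tensor U (tensor V W) :=
  tlift (fun t w => tlift (fun u v => pure u (pure v w)) t).

End TensorZ.

Section TensorZTheory.
Variables (U V W : zmodType) (f : U -> V -> W).
Hypothesis f_bi : biadditive f.

Let f_rel r :
  btensor_rel (fun (u : U) (n : int) => u *~ n)
              (fun (n : int) (v : V) => v *~ n) r ->
  fglift ((fun p : U * V => f p.1 p.2) : _ -> zmodule W) r = 0.
Proof.
have [fr fl] := f_bi.
have fl0 v : f 0 v = 0 by apply: (@addrI _ (f 0 v)); rewrite -fl !addr0.
have fr0 u : f u 0 = 0 by apply: (@addrI _ (f u 0)); rewrite -fr !addr0.
have flN u v : f (- u) v = - f u v.
  by apply: (@addrI _ (f u v)); rewrite -fl !subrr fl0.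
have frN u v : f u (- v) = - f u v.
  by apply: (@addrI _ (f u v)); rewrite -fr !subrr fr0.
have flM u v (n : nat) : f (u *+ n) v = f u v *+ n.
  by elim: n => [|n IH]; rewrite ?mulr0n ?fl0 // !mulrS fl IH.
have frM u v (n : nat) : f u (v *+ n) = f u v *+ n.
  by elim: n => [|n IH]; rewrite ?mulr0n ?fr0 // !mulrS fr IH.
case=> [u u' v|u v v'|u n v]; rewrite !lift_is_additive !liftU !scale1r /=.
- by rewrite fl -addrA -opprD subrr.
- by rewrite fr -addrA -opprD subrr.
- by case: n => n; rewrite -?pmulrn ?NegzE ?mulrNz -?pmulrn ?flN ?frN ?flM ?frM subrr.
Qed.

Lemma tlift_pure u v : tlift f (pure u v) = f u v.
Proof. by rewrite /tlift presZ_lift_gen. Qed.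

Lemma tlift_additive : {morph tlift f : x y / x - y}.
Proof. exact: presZ_lift_additive. Qed.

End TensorZTheory.

Section DirectSum.
Variable V : nat -> zmodType.

Inductive dsum_rel : set {freeg {n : nat & V n}} :=
| dsum_relD n (x y : V n) :
    dsum_rel (<< Tagged V (x + y) >> - << Tagged V x >> - << Tagged V y >>).

Definition dsum : Type := presZ dsum_rel.
HB.instance Definition _ := GRing.Zmodule.on dsum.
Definition dsum_in n (x : V n) : dsum := presZ_gen dsum_rel (Tagged V x).
End DirectSum.

(** * Graded modules and comodules *)

Section Graded.

Definition graded_algebra (R : zmodType) (deg : nat -> set R)
    (mul : R -> R -> R) (one : R) :=
  [/\ biadditive mul, associative mul, left_id one mul /\ right_id one mul,
      deg 0 one &
      forall m n x y, deg m x -> deg n y -> deg (m + n)%N (mul x y)].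

Definition graded_right_module (R : zmodType) (degR : nat -> set R)
    (mul : R -> R -> R) (one : R)
    (M : zmodType) (degM : nat -> set M) (act : M -> R -> M) :=
  [/\ biadditive act, forall x a b, act (act x a) b = act x (mul a b),
      forall x, act x one = x &
      forall m n x a, degM m x -> degR n a -> degM (m + n)%N (act x a)].

(* The degree [n] part of a tensor product. *)
Definition tensor_deg (U V : zmodType) (degU : nat -> set U)
    (degV : nat -> set V) (n : nat) : set (tensor U V) :=
  [set t | t \in zspan [set w | exists i j u v,
     [/\ (i + j)%N = n, degU i u, degV j v & w = pure u v]]].

Definition graded_coalgebra (C : zmodType) (deg : nat -> set C)
    (delta : C -> tensor C C) (eps : C -> int) :=
  [/\ {morph delta : x y / x + y} /\ {morph eps : x y / x + y},
      forall x, tassoc (tmap delta id (delta x)) = tmap id delta (delta x),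
      (forall x, tlift (fun u v => v *~ eps u) (delta x) = x) /\
      (forall x, tlift (fun u v => u *~ eps v) (delta x) = x),
      forall n x, n != 0%N -> deg n x -> eps x = 0 &
      forall n x, deg n x -> tensor_deg deg deg n (delta x)].

Definition graded_right_comodule (C : zmodType) (degC : nat -> set C)
    (delta : C -> tensor C C) (eps : C -> int)
    (M : zmodType) (degM : nat -> set M) (coact : M -> tensor M C) :=
  [/\ {morph coact : x y / x + y},
      forall x, tassoc (tmap coact id (coact x)) = tmap id delta (coact x),
      forall x, tlift (fun u c => u *~ eps c) (coact x) = x &
      forall n x, degM n x -> tensor_deg degM degC n (coact x)].

Definition graded_iso (U V : zmodType) (degU : nat -> set U)
    (degV : nat -> set V) (f : U -> V) :=
  [/\ {morph f : x y / x + y}, bijective f &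
      forall n x, degU n x <-> degV n (f x)].

End Graded.

(** * Subalgebras *)

Section Subalgebra.
Variables (F : fieldType) (A : algType F).

Inductive subalg_ind (S : set A) : A -> Prop :=
| subalg_ind_gen x of S x : subalg_ind S x
| subalg_ind1 : subalg_ind S 1
| subalg_ind_lin (k : F) x y of subalg_ind S x & subalg_ind S y :
    subalg_ind S (k *: x + y)
| subalg_indM x y of subalg_ind S x & subalg_ind S y : subalg_ind S (x * y).

Definition subalg_pred (S : set A) : {pred A} := fun x => `[< subalg_ind S x >].

Fact subalg_pred_closed S : subalg_closed (subalg_pred S).
Proof.
split=> [|k x y /asboolP Sx /asboolP Sy|x y /asboolP Sx /asboolP Sy];
  apply/asboolP; by constructor.
Qed.

HB.instance Definition _ S :=
  GRing.isSubalgClosed.Build F A (subalg_pred S)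
    (GRing.subalg_closed_semi (subalg_pred_closed S)).

(* The subalgebra generated by [S]. *)
Record subalg (S : set A) :=
  SubAlg {subalg_val : A; _ : subalg_val \in subalg_pred S}.
HB.instance Definition _ S := [isSub for @subalg_val S].
HB.instance Definition _ S := [Choice of subalg S by <:].
HB.instance Definition _ S := [SubChoice_isSubAlgebra of subalg S by <:].

End Subalgebra.

(** * Finite-dimensional modules and Grothendieck groups *)

Section Modules.
Variables (F : fieldType) (A : algType F).

(* Left modules, on column vectors.  All algebras used below are
   finite-dimensional, so these are the finitely generated modules. *)
Record rep := Rep {rdim : nat; ract : {lrmorphism A -> 'M[F]_rdim}}.
HB.instance Definition _ := gen_eqMixin rep.
HB.instance Definition _ := gen_choiceMixin rep.

Definition repmod (M : rep) : Type := 'cV[F]_(rdim M).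
HB.instance Definition _ M := GRing.Zmodule.on (repmod M).

Section RepMod.
Variable M : rep.
Let scale (a : A) (v : repmod M) : repmod M := ract M a *m v.

Fact repmod_scaleA a b v : scale a (scale b v) = scale (a * b) v.
Proof. by rewrite /scale mulmxA rmorphM. Qed.
Fact repmod_scale1 : left_id 1 scale.
Proof. by move=> v; rewrite /scale rmorph1 mul1mx. Qed.
Fact repmod_scaleDr : right_distributive scale +%R.
Proof. by move=> a u v; rewrite /scale mulmxDr. Qed.
Fact repmod_scaleDl v : {morph scale^~ v : a b / a + b}.
Proof. by move=> a b; rewrite /scale raddfD mulmxDl. Qed.

HB.instance Definition _ := GRing.Zmodule_isLmodule.Build A (repmod M)
  repmod_scaleA repmod_scale1 repmod_scaleDr repmod_scaleDl.
End RepMod.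

Definition projective (P : rep) :=
  forall (U V : lmodType A) (g : {linear U -> V}) (f : {linear repmod P -> V}),
    (forall v, exists u, g u = v) ->
    exists h : {linear repmod P -> U}, forall x, g (h x) = f x.

Record prep := PRep {prep_rep :> rep; _ : projective prep_rep}.
HB.instance Definition _ := gen_eqMixin prep.
HB.instance Definition _ := gen_choiceMixin prep.

Definition short_exact (M' M M'' : rep) :=
  exists (f : {linear repmod M' -> repmod M})
         (g : {linear repmod M -> repmod M''}),
  [/\ injective f, forall z, exists y, g y = z &
      forall y, g y = 0 <-> exists x, f x = y].

Section Grothendieck.
Variables (T : choiceType) (r : T -> rep).
Inductive groth_rel : set {freeg T} :=
| groth_rel_exact M' M M'' of short_exact (r M') (r M) (r M'') :
    groth_rel (<< M >> - << M' >> - << M'' >>).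
Definition groth : Type := presZ groth_rel.
HB.instance Definition _ := GRing.Zmodule.on groth.
End Grothendieck.

Definition G0 : Type := groth (id : rep -> rep).
HB.instance Definition _ := GRing.Zmodule.on G0.
Definition G0_class (M : rep) : G0 := presZ_gen _ M.

Definition K0 : Type := groth prep_rep.
HB.instance Definition _ := GRing.Zmodule.on K0.
Definition K0_class (P : prep) : K0 := presZ_gen _ P.

(* [d] is the dimension over F of Hom_A(P, M), the space of matrices
   intertwining the two actions. *)
Definition hom_dim (P M : rep) (d : nat) :=
  exists2 H : {vspace 'M[F]_(rdim M, rdim P)},
    (forall X, X \in H <-> forall a, ract M a *m X = X *m ract P a) &
    \dim H = d.

End Modules.

Section InductionRestriction.
Variables (F : fieldType) (A : algType F) (S : set A).
Local Notation B := (subalg S).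

(* [M] is isomorphic to A (x)_B N. *)
Definition induced (N : rep B) (M : rep A) :=
  exists phi : btensor (fun (a : A) (b : B) => a * val b)
                       (fun (b : B) (x : repmod N) => b *: x) -> repmod M,
  [/\ {morph phi : x y / x + y}, bijective phi &
      forall a a' x, phi (bpure _ _ (a' * a) x) = a' *: phi (bpure _ _ a x)].

Section Restrict.
Variable M : rep A.
Definition restrict_act : B -> 'M[F]_(rdim M) := ract M \o val.
HB.instance Definition _ := GRing.RMorphism.copy restrict_act (ract M \o val).
HB.instance Definition _ := GRing.Linear.copy restrict_act (ract M \o val).
Definition restrict : rep B := @Rep F B (rdim M) restrict_act.
End Restrict.

End InductionRestriction.

(** * 0-Hecke algebras *)

(* A simply-laced Coxeter diagram whose vertices are natural numbers. *)
Record diagram := Diagram {vertex : pred nat; edge : rel nat}.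

Definition gen (G : diagram) : Type := {i : nat | vertex G i}.

Section Hecke.
Variables (F : fieldType) (G : diagram).

Inductive hterm :=
| HScal of F
| HGen of gen G
| HAdd of hterm & hterm
| HMul of hterm & hterm.
HB.instance Definition _ := gen_eqMixin hterm.
HB.instance Definition _ := gen_choiceMixin hterm.

(* The congruence generated by the axioms of F-algebras together with the
   defining relations of the 0-Hecke algebra (last three constructors). *)
Inductive heq : hterm -> hterm -> Prop :=
| heq_refl x : heq x x
| heq_sym x y of heq x y : heq y x
| heq_trans x y z of heq x y & heq y z : heq x z
| heq_add x x' y y' of heq x x' & heq y y' : heq (HAdd x y) (HAdd x' y')
| heq_mul x x' y y' of heq x x' & heq y y' : heq (HMul x y) (HMul x' y')
| heq_addA x y z : heq (HAdd x (HAdd y z)) (HAdd (HAdd x y) z)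
| heq_addC x y : heq (HAdd x y) (HAdd y x)
| heq_add0 x : heq (HAdd (HScal 0) x) x
| heq_addN x : heq (HAdd (HMul (HScal (-1)) x) x) (HScal 0)
| heq_mulA x y z : heq (HMul x (HMul y z)) (HMul (HMul x y) z)
| heq_mul1 x : heq (HMul (HScal 1) x) x
| heq_mulDl x y z : heq (HMul (HAdd x y) z) (HAdd (HMul x z) (HMul y z))
| heq_mulDr x y z : heq (HMul x (HAdd y z)) (HAdd (HMul x y) (HMul x z))
| heq_scalD a b : heq (HScal (a + b)) (HAdd (HScal a) (HScal b))
| heq_scalM a b : heq (HScal (a * b)) (HMul (HScal a) (HScal b))
| heq_scalC a x : heq (HMul (HScal a) x) (HMul x (HScal a))
| heq_idem i : heq (HMul (HGen i) (HGen i)) (HGen i)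
| heq_braid i j of edge G (val i) (val j) :
    heq (HMul (HGen i) (HMul (HGen j) (HGen i)))
        (HMul (HGen j) (HMul (HGen i) (HGen j)))
| heq_comm i j of ~~ edge G (val i) (val j) :
    heq (HMul (HGen i) (HGen j)) (HMul (HGen j) (HGen i)).

Definition heqb (x y : hterm) := `[< heq x y >].

Fact heqb_equiv : equiv_class_of heqb.
Proof.
split=> [x|x y|y x z]; first exact/asboolP/heq_refl.
  by apply/asboolP/asboolP; exact: heq_sym.
move=> /asboolP xy /asboolP yz; apply/asboolP; exact: heq_trans xy yz.
Qed.
Canonical heqb_equiv_rel := EquivRelPack heqb_equiv.

Definition hecke : Type := {eq_quot heqb}.
HB.instance Definition _ := Choice.on hecke.

Definition hpi (t : hterm) : hecke := \pi_{eq_quot heqb} t.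
Definition hrepr (x : hecke) : hterm := repr (x : {eq_quot heqb}).

Lemma hpiP x y : hpi x = hpi y <-> heq x y.
Proof.
rewrite /hpi; split=> [/eqP|xy]; first by rewrite eqmodE => /asboolP.
by apply/eqP; rewrite eqmodE; apply/asboolP.
Qed.
Lemma hreprK x : hpi (hrepr x) = x. Proof. exact: reprK. Qed.
Lemma hrepr_pi t : heq (hrepr (hpi t)) t. Proof. by apply/hpiP; rewrite hreprK. Qed.

Definition hadd x y := hpi (HAdd (hrepr x) (hrepr y)).
Definition hmul x y := hpi (HMul (hrepr x) (hrepr y)).
Definition hopp x := hpi (HMul (HScal (-1)) (hrepr x)).
Definition hscale a x := hpi (HMul (HScal a) (hrepr x)).

Let hind (P : hecke -> Prop) : (forall t, P (hpi t)) -> forall x, P x.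
Proof. by move=> Pt x; rewrite -(hreprK x). Qed.
Let haddE x y : hadd (hpi x) (hpi y) = hpi (HAdd x y).
Proof. by apply/hpiP; apply: heq_add; exact: hrepr_pi. Qed.
Let hmulE x y : hmul (hpi x) (hpi y) = hpi (HMul x y).
Proof. by apply/hpiP; apply: heq_mul; exact: hrepr_pi. Qed.
Let hoppE x : hopp (hpi x) = hpi (HMul (HScal (-1)) x).
Proof. by apply/hpiP; apply: heq_mul; [exact: heq_refl|exact: hrepr_pi]. Qed.
Let hscaleE a x : hscale a (hpi x) = hpi (HMul (HScal a) x).
Proof. by apply/hpiP; apply: heq_mul; [exact: heq_refl|exact: hrepr_pi]. Qed.
Let hE := (haddE, hmulE, hoppE, hscaleE).

Fact haddA : associative hadd.
Proof. by do 3!elim/hind=> ?; rewrite !hE; apply/hpiP/heq_addA. Qed.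
Fact haddC : commutative hadd.
Proof. by do 2!elim/hind=> ?; rewrite !hE; apply/hpiP/heq_addC. Qed.
Fact hadd0 : left_id (hpi (HScal 0)) hadd.
Proof. by elim/hind=> ?; rewrite !hE; apply/hpiP/heq_add0. Qed.
Fact haddN : left_inverse (hpi (HScal 0)) hopp hadd.
Proof. by elim/hind=> ?; rewrite !hE; apply/hpiP/heq_addN. Qed.
HB.instance Definition _ := GRing.isZmodule.Build hecke haddA haddC hadd0 haddN.

Fact hmulA : associative hmul.
Proof. by do 3!elim/hind=> ?; rewrite !hE; apply/hpiP/heq_mulA. Qed.
Fact hmul1l : left_id (hpi (HScal 1)) hmul.
Proof. by elim/hind=> ?; rewrite !hE; apply/hpiP/heq_mul1. Qed.
Fact hmul1r : right_id (hpi (HScal 1)) hmul.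
Proof.
elim/hind=> ?; rewrite !hE; apply/hpiP.
exact: heq_trans (heq_sym (heq_scalC _ _)) (heq_mul1 _).
Qed.
Fact hmulDl : left_distributive hmul hadd.
Proof. by do 3!elim/hind=> ?; rewrite !hE; apply/hpiP/heq_mulDl. Qed.
Fact hmulDr : right_distributive hmul hadd.
Proof. by do 3!elim/hind=> ?; rewrite !hE; apply/hpiP/heq_mulDr. Qed.

(* 1 != 0 is witnessed by the character mapping every generator to 1. *)
Let aug := fix aug (t : hterm) : F :=
  match t with
  | HScal a => a
  | HGen _ => 1
  | HAdd x y => aug x + aug y
  | HMul x y => aug x * aug y
  end.
Let aug_heq x y : heq x y -> aug x = aug y.
Proof.
elim=> {x y} //=; try by move=> *; congruence.
- by move=> *; rewrite addrA.
- by move=> *; rewrite addrC.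
- by move=> *; rewrite add0r.
- by move=> x; rewrite mulN1r addNr.
- by move=> *; rewrite mulrA.
- by move=> *; rewrite mul1r.
- by move=> *; rewrite mulrDl.
- by move=> *; rewrite mulrDr.
- by move=> *; rewrite mulrC.
- by move=> *; rewrite mul1r.
Qed.
Fact hone_neq0 : hpi (HScal 1) != hpi (HScal 0).
Proof. by apply/eqP => /hpiP/aug_heq/eqP/=; rewrite oner_eq0. Qed.

HB.instance Definition _ := GRing.Zmodule_isNzRing.Build hecke
  hmulA hmul1l hmul1r hmulDl hmulDr hone_neq0.

Let hrE := (fun x y => haddE x y : hpi x + hpi y = _,
            fun x y => hmulE x y : hpi x * hpi y = _).

Fact hscaleA a b x : hscale a (hscale b x) = hscale (a * b) x.
Proof.
elim/hind: x => x; rewrite !hE; apply/hpiP.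
apply: heq_trans (heq_mulA _ _ _) _.
exact: heq_mul (heq_sym (heq_scalM _ _)) (heq_refl _).
Qed.
Fact hscale1 : left_id 1 hscale.
Proof. by elim/hind=> ?; rewrite !hE; apply/hpiP/heq_mul1. Qed.
Fact hscaleDr : right_distributive hscale +%R.
Proof. by move=> a; do 2!elim/hind=> ?; rewrite ?(hE, hrE); apply/hpiP/heq_mulDr. Qed.
Fact hscaleDl x : {morph hscale^~ x : a b / a + b}.
Proof.
move=> a b; elim/hind: x => x; rewrite ?(hE, hrE); apply/hpiP.
exact: heq_trans (heq_mul (heq_scalD _ _) (heq_refl _)) (heq_mulDl _ _ _).
Qed.
HB.instance Definition _ := GRing.Zmodule_isLmodule.Build F hecke
  hscaleA hscale1 hscaleDr hscaleDl.

Let hzE a x : a *: hpi x = hpi (HMul (HScal a) x).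
Proof. exact: hscaleE. Qed.

Fact hscaleAl (a : F) (x y : hecke) : a *: (x * y) = (a *: x) * y.
Proof.
elim/hind: x => x; elim/hind: y => y.
rewrite [hpi x * hpi y](hmulE x y) [a *: hpi x]hzE [LHS]hzE.
by rewrite [RHS](hmulE _ y); apply/hpiP/heq_mulA.
Qed.
HB.instance Definition _ := GRing.Lmodule_isLalgebra.Build F hecke hscaleAl.

Fact hscaleAr (a : F) (x y : hecke) : a *: (x * y) = x * (a *: y).
Proof.
elim/hind: x => x; elim/hind: y => y.
rewrite [hpi x * hpi y](hmulE x y) [a *: hpi y]hzE [LHS]hzE.
rewrite [RHS](hmulE x); apply/hpiP.
apply: heq_trans (heq_mulA _ _ _) _; apply: heq_sym.
apply: heq_trans (heq_mulA _ _ _) _.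
exact: heq_mul (heq_sym (heq_scalC _ _)) (heq_refl _).
Qed.
HB.instance Definition _ := GRing.Lalgebra_isAlgebra.Build F hecke hscaleAr.

Definition hgen (i : gen G) : hecke := hpi (HGen i).

Lemma hgen_idem i : hgen i * hgen i = hgen i.
Proof. by rewrite /hgen [LHS](hmulE _ _); apply/hpiP/heq_idem. Qed.

Lemma hgen_braid i j : edge G (val i) (val j) ->
  hgen i * (hgen j * hgen i) = hgen j * (hgen i * hgen j).
Proof.
move=> eij; rewrite /hgen [hpi _ * hpi (HGen i)](hmulE _ _).
rewrite [in RHS](hmulE (HGen i) (HGen j) : hpi _ * hpi _ = _).
by rewrite [LHS](hmulE _ _) [RHS](hmulE _ _); apply/hpiP/heq_braid.
Qed.

Lemma hgen_comm i j : ~~ edge G (val i) (val j) ->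
  hgen i * hgen j = hgen j * hgen i.
Proof.
move=> eij; rewrite /hgen [LHS](hmulE _ _) [RHS](hmulE _ _).
exact/hpiP/heq_comm.
Qed.
End Hecke.
Arguments hgen F {G} i.

(** * Longest elements, projective indecomposables and simples *)

Section Coxeter.
Variable G : diagram.

(* Equality, in the Coxeter group of [G], of the elements given by two words. *)
Inductive coxeq : seq (gen G) -> seq (gen G) -> Prop :=
| coxeq_refl u : coxeq u u
| coxeq_sym u v of coxeq u v : coxeq v u
| coxeq_trans u v w of coxeq u v & coxeq v w : coxeq u w
| coxeq_invol u i v : coxeq (u ++ [:: i; i] ++ v) (u ++ v)
| coxeq_braid u i j v of edge G (val i) (val j) :
    coxeq (u ++ [:: i; j; i] ++ v) (u ++ [:: j; i; j] ++ v)
| coxeq_comm u i j v of ~~ edge G (val i) (val j) :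
    coxeq (u ++ [:: i; j] ++ v) (u ++ [:: j; i] ++ v).

Definition reduced_word (w : seq (gen G)) :=
  forall v, coxeq w v -> (size w <= size v)%N.

Definition in_parabolic (I : pred nat) (w : seq (gen G)) :=
  exists2 u, all (fun i => I (val i)) u & coxeq w u.

(* [w] is a reduced expression of the longest element of the subgroup generated
   by the s_i with i in [I]. *)
Definition longest_word (I : pred nat) (w : seq (gen G)) :=
  [/\ in_parabolic I w, reduced_word w &
      forall v, in_parabolic I v -> reduced_word v -> (size v <= size w)%N].

End Coxeter.

(* The descent set D(alpha): all partial sums except the total. *)
Definition descents (alpha : seq nat) : seq nat :=
  take (size alpha).-1 (scanl addn 0 alpha).

Section PIM.
Variables (F : fieldType) (G : diagram).
Local Notation H := (hecke F G).

Definition is_PIM (alpha : seq nat) (P : rep H) :=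
  exists u v : seq (gen G),
  [/\ longest_word (fun i => i \in descents alpha) u,
      longest_word (fun i => i \notin descents alpha) v &
      let e : H := (\prod_(i <- u) (hgen F i - 1)) * \prod_(i <- v) hgen F i in
      exists f : {linear repmod P -> H^o},
        injective f /\ forall h : H, (exists x, f x = h) <-> (exists a, h = a * e)].

Definition is_top (alpha : seq nat) (C : rep H) :=
  rdim C = 1%N /\
  forall i : gen G, ract C (hgen F i - 1) =
    (if val i \in descents alpha then -1 else 0)%:M.

End PIM.

(** * Types A and D *)

Variant family := TypeA | TypeD.

(* The least degree occurring in a family. *)
Definition lo (c : family) : nat := if c is TypeD then 2 else 0.

Definition edgeA : rel nat := fun i j => (i.+1 == j) || (j.+1 == i).

(* The generators of type A in degree [n] are 1, ..., n-1, those of type D are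
   0, ..., n-1; vertex 0 is joined to 2 only. *)
Definition cdiagram (c : family) (n : nat) : diagram :=
  match c with
  | TypeA => Diagram (fun i => 0 < i < n)%N edgeA
  | TypeD => Diagram (fun i => i < n)%N
           (fun i j => match i, j with
                       | 0, _ => j == 2
                       | _, 0 => i == 2
                       | _, _ => edgeA i j
                       end)
  end.

(* Compositions (type A) and pseudo-compositions (type D, n >= 2) of [n]. *)
Definition is_label (c : family) (n : nat) (alpha : seq nat) : bool :=
  [&& (lo c <= n)%N, sumn alpha == n &
      match c, alpha with
      | TypeA, _ => all (fun a => 0 < a)%N alpha
      | TypeD, [::] => false
      | TypeD, _ :: beta => all (fun a => 0 < a)%N beta
      end].

Section Families.
Variable F : fieldType.

Definition H0 (c : family) (n : nat) : algType F := hecke F (cdiagram c n).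

(* The direct sums are indexed by [k], the degree being [lo c + k]. *)
Definition G0sum (c : family) : Type := dsum (fun k => G0 (H0 c (lo c + k))).
HB.instance Definition _ c := GRing.Zmodule.on (G0sum c).
Definition G0cl (c : family) (k : nat) (M : rep (H0 c (lo c + k))) : G0sum c :=
  dsum_in (V := fun k => G0 (H0 c (lo c + k))) (G0_class M).

Definition K0sum (c : family) : Type := dsum (fun k => K0 (H0 c (lo c + k))).
HB.instance Definition _ c := GRing.Zmodule.on (K0sum c).
Definition K0cl (c : family) (k : nat) (P : prep (H0 c (lo c + k))) : K0sum c :=
  dsum_in (V := fun k => K0 (H0 c (lo c + k))) (K0_class P).

Definition G0deg (c : family) (n : nat) : set (G0sum c) :=
  [set x | x \in zspan [set y | exists k (M : rep (H0 c (lo c + k))),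
                         (lo c + k)%N = n /\ y = G0cl M]].
Definition K0deg (c : family) (n : nat) : set (K0sum c) :=
  [set x | x \in zspan [set y | exists k (P : prep (H0 c (lo c + k))),
                         (lo c + k)%N = n /\ y = K0cl P]].

(* The subalgebra of H_p generated by the pi_i with i <> m. *)
Definition par_gens (c : family) (m p : nat) : set (H0 c p) :=
  [set hgen F i | i in [set i : gen (cdiagram c p) | val i != m]].
Arguments par_gens : clear implicits.
Local Notation par c m p := (subalg (par_gens c m p)).

(* [R] is the outer tensor product of [M] and [N]: for p = m + n, the generator
   pi_k of the subalgebra acts on the first factor as pi_k if k < m, and on the
   second factor as pi_{k - m} if k > m. *)
Definition outer (c : family) (m n p : nat)
    (M : rep (H0 c m)) (N : rep (H0 TypeA n)) (R : rep (par c m p)) :=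
  exists rho : {lrmorphism par c m p -> 'M[F]_(rdim M * rdim N)},
    R = Rep rho /\
    forall (b : par c m p) (k : gen (cdiagram c p)), val b = hgen F k ->
      (forall i : gen (cdiagram c m), val i = val k ->
         rho b = tprod (ract M (hgen F i)) 1%:M) /\
      (forall j : gen (cdiagram TypeA n), (m + val j)%N = val k ->
         rho b = tprod 1%:M (ract N (hgen F j))).

(* The product (type A) or action (type D) given by induction. *)
Definition is_induction (c : family) (act : K0sum c -> K0sum TypeA -> K0sum c) :=
  biadditive act /\
  forall k n (M : prep (H0 c (lo c + k))) (N : prep (H0 TypeA (lo TypeA + n))),
    exists (R : rep (par c (lo c + k) (lo c + (k + n))))
           (P : prep (H0 c (lo c + (k + n)))),
      [/\ outer M N R, induced R P & act (K0cl M) (K0cl N) = K0cl P].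

(* The identification of G_0(H_m) (x) G_0(H_n) with the Grothendieck group of
   the parabolic subalgebra. *)
Definition is_identification (c : family) (m n p : nat)
    (kappa : tensor (G0 (H0 c m)) (G0 (H0 TypeA n)) -> G0 (par c m p)) :=
  [/\ {morph kappa : x y / x + y}, bijective kappa &
      forall M N, exists2 R, outer M N R &
        kappa (pure (G0_class M) (G0_class N)) = G0_class R].

(* The coproduct (type A) or coaction (type D) given by restriction. *)
Definition is_restriction (c : family)
    (coact : G0sum c -> tensor (G0sum c) (G0sum TypeA)) :=
  {morph coact : x y / x + y} /\
  forall k (Q : rep (H0 c (lo c + k))),
    exists z : forall i : 'I_k.+1,
        tensor (G0 (H0 c (lo c + i))) (G0 (H0 TypeA (lo TypeA + (k - i)))),
      (forall i : 'I_k.+1, exists2 kappa, is_identification kappa &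
         kappa (z i) = G0_class (restrict (par_gens c (lo c + i) (lo c + k)) Q)) /\
      coact (G0cl Q) =
        \sum_(i < k.+1)
          tmap (dsum_in (V := fun k => G0 (H0 c (lo c + k))) (n := i))
               (dsum_in (V := fun k => G0 (H0 TypeA (lo TypeA + k)))
                        (n := (k - i)%N))
               (z i).

(* The class of the algebra H_0(0) = F. *)
Definition is_unit (one : K0sum TypeA) :=
  exists2 P : prep (H0 TypeA (lo TypeA + 0)), rdim P = 1%N & one = K0cl P.

Definition is_counit (eps : G0sum TypeA -> int) :=
  {morph eps : x y / x + y} /\
  forall k (M : rep (H0 TypeA (lo TypeA + k))),
    eps (G0cl M) = if k == 0%N then (rdim M)%:Z else 0.

(* The pairing dim Hom(P, M), zero for different degrees. *)
Definition is_pairing (c : family) (pr : K0sum c -> G0sum c -> int) :=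
  [/\ biadditive pr,
      forall k (P : prep (H0 c (lo c + k))) (M : rep (H0 c (lo c + k))),
        exists2 d : nat, hom_dim P M d & pr (K0cl P) (G0cl M) = d%:Z &
      forall k l (P : prep (H0 c (lo c + k))) (M : rep (H0 c (lo c + l))),
        k != l -> pr (K0cl P) (G0cl M) = 0].

End Families.

(** * Noncommutative symmetric functions *)

(* Formal power series in noncommuting variables x_i, i in Z, as coefficient
   functions on words. *)
Definition ncseries : Type := seq int -> int.
HB.instance Definition _ := GRing.Zmodule.on ncseries.

Definition ncmul (f g : ncseries) : ncseries :=
  fun w => \sum_(i < (size w).+1) f (take i w) * g (drop i w).

Definition ncone : ncseries := fun w => (nilp w)%:Z.

(* The letter w_j of a word w = w_1 ... w_n, with w_0 = - w_2. *)
Definition letter (w : seq int) (j : nat) : int :=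
  if j is j'.+1 then nth 0 w j' else - nth 0 w 1.

(* The range of j in the defining conditions: 1, ..., n-1 in type A and
   0, ..., n-1 in type D. *)
Definition positions (c : family) (n : nat) : seq nat :=
  [seq j <- iota 0 n | vertex (cdiagram c n) j].

Definition ribbon (c : family) (n : nat) (alpha : seq nat) : ncseries :=
  fun w => ((size w == n) &&
    all (fun j => (letter w j.+1 < letter w j) == (j \in descents alpha))
        (positions c n))%:Z.

Definition NSym (c : family) : zmodType :=
  spanZ [set f : ncseries |
    exists n alpha, is_label c n alpha /\ f = ribbon c n alpha].

Definition NSym_deg (c : family) (n : nat) : set (NSym c) :=
  [set f | forall w, span_val f w != 0 -> size w = n].

(** * Quasisymmetric functions *)

(* Formal power series in commuting variables x_i, i in Z, as coefficient
   functions on monomials. *)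
Definition series : Type := {mset int}%mset -> int.
HB.instance Definition _ := GRing.Zmodule.on series.

(* Formal power series in two sets of commuting variables. *)
Definition series2 : Type := {mset int}%mset * {mset int}%mset -> int.
HB.instance Definition _ := GRing.Zmodule.on series2.

(* The index sequences i_1 <= ... <= i_n of the sum defining F_alpha; in type A
   only the variables x_1, x_2, ... occur. *)
Definition F_index (c : family) (n : nat) (alpha : seq nat) (w : seq int) :=
  [&& size w == n,
      (if c is TypeA then all (fun i => 1 <= i) w else true) &
      all (fun j => if j \in descents alpha then letter w j < letter w j.+1
                    else letter w j <= letter w j.+1)
          (positions c n)].

(* The coefficient of a monomial is the number of index sequences giving it. *)
Definition fundamental (c : family) (n : nat) (alpha : seq nat) : series :=
  fun mu => (count (F_index c n alpha) (permutations (enum_mset mu)))%:Z.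

Definition QSym (c : family) : zmodType :=
  spanZ [set f : series |
    exists n alpha, is_label c n alpha /\ f = fundamental c n alpha].

Definition QSym_deg (c : family) (n : nat) : set (QSym c) :=
  [set f | forall mu, span_val f mu != 0 -> size (enum_mset mu) = n].

(* The coefficient of x^mu y^nu in the series obtained from f by replacing the
   ordered variables by the x's followed by y_1, y_2, ..., where only the terms
   of degree at least [lo c] in the x's are kept.  For f in QSym c it is the
   coefficient of f at the monomial obtained from x^mu y^nu by renaming each
   y_j to x_{N + j}, for any N such that all x_{N + j} come after the variables
   of x^mu. *)
Definition two_alphabets (c : family) (f : series) : series2 :=
  fun p => let: (mu, nu) := p in
    let N := \max_(i <- enum_mset mu) `|i|%N in
    if (lo c <= size (enum_mset mu))%N && all (fun j => 1 <= j) (enum_mset nu)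
    then f (mu `+` seq_mset [seq N%:Z + j | j <- enum_mset nu])%mset
    else 0.

(* The series f(x) g(y). *)
Definition outer_series (f g : series) : series2 :=
  fun p => f p.1 * g p.2.

(* The coproduct of QSym (type A) or the coaction on QSym^D (type D). *)
Definition is_alphabet_coaction (c : family)
    (delta : QSym c -> tensor (QSym c) (QSym TypeA)) :=
  {morph delta : x y / x + y} /\
  forall f, tlift (fun g h => outer_series (span_val g) (span_val h)) (delta f)
            = two_alphabets c (span_val f).

(** * Characteristic maps *)

Section Characteristics.
Variables (F : fieldType) (c : family).

Definition is_ch (ch : K0sum F c -> NSym c) :=
  graded_iso (@K0deg F c) (@NSym_deg c) ch /\
  forall k alpha, is_label c (lo c + k) alpha ->
    exists2 P : prep (H0 F c (lo c + k)), is_PIM alpha P &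
      span_val (ch (K0cl P)) = ribbon c (lo c + k) alpha.

Definition is_Ch (Ch : G0sum F c -> QSym c) :=
  graded_iso (@G0deg F c) (@QSym_deg c) Ch /\
  forall k alpha, is_label c (lo c + k) alpha ->
    exists2 C : rep (H0 F c (lo c + k)), is_top alpha C &
      span_val (Ch (G0cl C)) = fundamental c (lo c + k) alpha.

End Characteristics.

(* Main.v *)
(* Both families of algebras embed in one setting: type A is the parabolic part
   of type D avoiding the letter 0, and type D acts on signed permutations, whose
   inversion numbers give the exchange property, Matsumoto's theorem and a basis
   of each algebra.  Translating a vector by a basis element of maximal length
   that does not kill it yields a common eigenvector; hence every nonzero module
   has a quotient C_I of dimension one, and every projective one has P_I as a
   direct summand.  With dim Hom(P_I, C_J) = delta_IJ, the classes of the C_I and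
   of the P_I are dual bases of G_0 and K_0.

   Since Hom(Ind(M (x) N), C_L) = Hom(M, C_L') (x) Hom(N, C_L''), where L' and L''
   are the parts of L below and above m, the product of P_I and P_K is the sum of
   the P_L with L = I u (m + K) or L = I u {m} u (m + K), which is the rule for
   products of ribbons; associativity is inherited from that of power series.
   Dually, restriction sends C_L to C_L' (x) C_L'', which is the way fundamental
   quasisymmetric functions split over two alphabets. *)
From HB Require Import structures.
From mathcomp Require Import all_boot all_order all_algebra all_fingroup.
From mathcomp Require Import generic_quotient ring_quotient.
From mathcomp Require Import finmap multiset freeg.
From mathcomp Require Import boolp classical_sets functions.
From mathcomp Require Import character zify.
Require Import Defs.

Set Implicit Arguments.
Unset Strict Implicit.
Unset Printing Implicit Defensive.

Import Order.TTheory GRing.Theory Num.Theory.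

Local Open Scope ring_scope.
Local Open Scope quotient_scope.

(** Both families and all parabolic subalgebras are treated as one notion, [hecke_algebra J p]:
    elements indexed by all naturals, equal to 1 outside a bounded set [J] of letters. [J] is read
    inside signed permutations of rank [N > 1], and [N] is the degree plus 2, so that degrees 0 and
    1 are no exception. The main obstacle is to split the algebra into the left ideals of the
    [pim_elt I]. That they add up to everything is a statement on functionals vanishing on all of
    them, to which the eigenvector argument applies once more; since their spanning vectors are as
    many as the group elements, the sum is direct, and the components of 1 are the idempotents
    behind projectivity and Hom(P_I, C_J). For induction, a finite dual basis of the inducing module
    embeds the induced module into a free module; finite dimension, projectivity and Frobenius
    reciprocity all come from this embedding. Identities in K_0 are then checked by dimensions of
    Hom into the simples, those in G_0 on the simples themselves. *)

Definition edgeD (i j : nat) : bool :=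
  match i, j with
  | 0, _ => j == 2%N
  | _, 0 => i == 2%N
  | _, _ => (i.+1 == j) || (j.+1 == i)
  end.

Lemma edgeD_sym i j : edgeD i j = edgeD j i.
Proof. by case: i j => [|i] [|j] //=; lia. Qed.

(** * Signed permutations *)

Section SignedPermutations.
Variable N : nat.
Hypothesis N_gt1 : (1 < N)%N.
Local Notation T := 'I_N.*2.+1.

(* The letter [a] in [-N, N] is encoded as [N + a]. *)
Definition low (i : nat) : nat := if i == 0 then (N - 2)%N else (N + i)%N.
Definition high (i : nat) : nat := (N + i).+1.
(** The reflection s_i exchanges the positions [low i] and [high i] and, symmetrically, their
    negatives. These positions are i and i+1 for i > 0, and -2 and 1 for i = 0, in accordance with
    the convention w_0 = -w_2. *)
Definition swap (i t : nat) : nat :=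
  if t == low i then high i else if t == high i then low i else
  if t == (N.*2 - low i)%N then (N.*2 - high i)%N else
  if t == (N.*2 - high i)%N then (N.*2 - low i)%N else t.

Definition sperm (i : nat) : {perm T} := locked
  (tperm (inord (low i)) (inord (high i)) *
   tperm (inord (N.*2 - low i)) (inord (N.*2 - high i)))%g.

Lemma spermE i (t : T) : (i < N)%N -> sperm i t = swap i t :> nat.
Proof.
move=> iN; rewrite /sperm -lock permM /swap.
have ltT (a : nat) : (a <= N.*2)%N -> val (inord a : T) = a by move=> aN; exact: inordK.
have eqT (a : nat) (x : T) : (a <= N.*2)%N -> (x == inord a) = (val x == a).
  by move=> aN; rewrite -(inj_eq val_inj) ltT.
have lN : (low i <= N.*2)%N by rewrite /low; case: ifP; lia.
have hN : (high i <= N.*2)%N by rewrite /high; lia.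
rewrite ![tperm _ _ _]permE /= !eqT ?leq_subr //.
have := ltn_ord t; rewrite /low /high in lN hN *; move=> tN.
by (repeat case: ifP); rewrite ?ltT ?leq_subr //; lia.
Qed.

Lemma swap_le i t : (i < N)%N -> (t <= N.*2)%N -> (swap i t <= N.*2)%N.
Proof. by rewrite /swap /low /high => iN tN; repeat case: ifP; lia. Qed.

Lemma swapK i t : (i < N)%N -> (t <= N.*2)%N -> swap i (swap i t) = t.
Proof.
move=> iN tN; rewrite {2}/swap.
case: eqP => [->|/eqP/negPf t1]; first by rewrite /swap /low /high; repeat case: ifP; lia.
case: eqP => [->|/eqP/negPf t2]; first by rewrite /swap /low /high; repeat case: ifP; lia.
case: eqP => [->|/eqP/negPf t3]; first by rewrite /swap /low /high; repeat case: ifP; lia.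
case: eqP => [->|/eqP/negPf t4]; first by rewrite /swap /low /high; repeat case: ifP; lia.
by rewrite /swap t1 t2 t3 t4.
Qed.

Lemma spermK i : (i < N)%N -> (sperm i * sperm i = 1)%g.
Proof.
move=> iN; apply/permP => t; apply: val_inj; rewrite permM perm1 /= !spermE //.
by rewrite swapK // -ltnS.
Qed.

Lemma sperm_rev i t : (i < N)%N -> sperm i (rev_ord t) = rev_ord (sperm i t).
Proof.
move=> iN; apply: val_inj; rewrite /= !spermE //= !subSS.
have tN : (t <= N.*2)%N by rewrite -ltnS.
have lN : (low i <= N.*2)%N by rewrite /low; case: ifP; lia.
have hN : (high i <= N.*2)%N by rewrite /high; lia.
have E (a b : nat) : (a <= N.*2)%N -> (b <= N.*2)%N ->
    (N.*2 - a == b)%N = (a == N.*2 - b)%N by lia.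
rewrite /swap !E ?leq_subr // !subKn //.
have ne : [&& low i != high i, N.*2 - low i != high i, low i != N.*2 - low i
           & high i != N.*2 - high i]%N by rewrite /low /high; case: ifP; lia.
by case: eqP => [->|?]; [|case: eqP => [->|?]; [|do 2?case: eqP => ?]];
  repeat case: ifP; lia.
Qed.

(** Conjugating a transposition moves its two points, so the braid and commutation relations become
    comparisons of the images of four positions under [swap]. *)
Lemma spermJ i j : (i < N)%N -> (j < N)%N ->
  (sperm i * sperm j * sperm i =
   tperm (inord (swap i (low j))) (inord (swap i (high j))) *
   tperm (inord (swap i (N.*2 - low j))) (inord (swap i (N.*2 - high j))))%g.
Proof.
move=> iN jN.
have -> : (sperm i * sperm j * sperm i = sperm j ^ sperm i)%g.
  have V : ((sperm i)^-1 = sperm i)%g by apply/eqP; rewrite eq_invg_mul spermK.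
  by rewrite conjgE V mulgA.
have E (a : nat) : (a <= N.*2)%N -> sperm i (inord a) = inord (swap i a).
  by move=> aN; apply: val_inj; rewrite /= spermE // !inordK // ltnS swap_le.
have lN : (low j <= N.*2)%N by rewrite /low; case: ifP; lia.
have hN : (high j <= N.*2)%N by rewrite /high; lia.
by rewrite {1}/sperm -lock conjMg !tpermJ !E // leq_subr.
Qed.

Let inord_eq (a b : nat) : a = b -> inord a = inord b :> T.
Proof. by move=> ->. Qed.

Let inord_neq (a b : nat) :
  (a <= N.*2)%N -> (b <= N.*2)%N -> a != b -> inord a != inord b :> T.
Proof. by move=> aN bN; rewrite -(inj_eq val_inj) /= !inordK. Qed.

Let tperm_disjointC (a b c d : T) : [&& a != c, a != d, b != c & b != d] ->
  (tperm a b * tperm c d = tperm c d * tperm a b)%g.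
Proof.
case/and4P=> ac ad bc bd; rewrite (conjgC (tperm c d)) tpermJ.
by rewrite !tpermD // eq_sym.
Qed.

Lemma sperm_braid i j : (i < N)%N -> (j < N)%N -> edgeD i j ->
  (sperm i * sperm j * sperm i = sperm j * sperm i * sperm j)%g.
Proof.
wlog: i j / (i < j)%N => [W iN jN eij|ij iN jN eij].
  case: (ltngtP i j) => [ij|ji|->] //; first exact: W.
  by apply/esym/W => //; rewrite edgeD_sym.
rewrite !spermJ //.
have {eij}: (i == 0%N) && (j == 2%N) || (0 < i)%N && (j == i.+1).
  by case: i j eij ij {iN jN} => [|i] [|j] /=; lia.
case/orP => /andP[i0 /eqP ej]; subst j.
  (* For the edge between 0 and 2 the two transpositions come out in opposite order on the two
     sides. *)
  move/eqP: i0 => i0; subst i; rewrite [RHS]tperm_disjointC.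
    by congr (_ * _)%g; rewrite [RHS]tpermC; congr tperm; apply: inord_eq;
      rewrite /swap /low /high /=; repeat case: ifP; lia.
  by apply/and4P; split; apply: inord_neq; rewrite ?swap_le //;
    rewrite /swap /low /high /=; repeat case: ifP; lia.
by congr (_ * _)%g; congr tperm; apply: inord_eq;
  rewrite /swap /low /high /=; repeat case: ifP; lia.
Qed.

Lemma sperm_comm i j : (i < N)%N -> (j < N)%N -> ~~ edgeD i j ->
  (sperm i * sperm j = sperm j * sperm i)%g.
Proof.
wlog: i j / (i < j)%N => [W iN jN eij|ij iN jN eij].
  case: (ltngtP i j) => [ij|ji|->] //; first exact: W.
  by apply/esym/W => //; rewrite edgeD_sym.
suff E : (sperm i * sperm j * sperm i = sperm j)%g.
  by apply: (mulIg (sperm i)); rewrite E -(mulgA (sperm j)) spermK // mulg1.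
rewrite spermJ // /sperm -lock.
have {eij}: (i == 0%N) && (j == 1%N) || ((i == 0%N) && (2 < j) || (0 < i)%N && (i.+1 < j))%N.
  by case: i j eij ij {iN jN} => [|i] [|j] /=; lia.
(* The letters 0 and 1 move the same four positions; conjugation by s_0 exchanges the two
   transpositions of s_1. In the other cases s_i fixes all positions moved by s_j. *)
case/orP => [/andP[/eqP -> /eqP ->]|ij'].
  rewrite tperm_disjointC.
    by congr (_ * _)%g; rewrite tpermC; congr tperm; apply: inord_eq;
      rewrite /swap /low /high /=; repeat case: ifP; lia.
  by apply/and4P; split; apply: inord_neq; rewrite ?swap_le //;
    rewrite /swap /low /high /=; repeat case: ifP; lia.
have E t : (t \in [:: low j; high j; N.*2 - low j; N.*2 - high j])%N -> swap i t = t.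
  rewrite !inE /swap /low /high.
  have [i0|i0] := eqVneq i 0%N; have [j0|j0] := eqVneq j 0%N;
    do 4?case: ifP; lia.
by rewrite !E ?inE ?eqxx ?orbT.
Qed.

Definition odd_sperm (g : {perm T}) := [forall t, g (rev_ord t) == rev_ord (g t)].

Record state := State {state_val :> {perm T}; _ : odd_sperm state_val}.
HB.instance Definition _ := [isSub for state_val].
HB.instance Definition _ := [Finite of state by <:].

Lemma stateP (x : state) t : x (rev_ord t) = rev_ord (x t).
Proof. by case: x => g /= /forallP/(_ t)/eqP. Qed.

Lemma state_one_subproof : odd_sperm 1%g.
Proof. by apply/forallP => t; rewrite !perm1. Qed.
Definition sid : state := State state_one_subproof.

Lemma move_subproof (x : state) i : odd_sperm (if (i < N)%N then sperm i * x else x)%g.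
Proof.
apply/forallP => t; case: ifP => iN; last by rewrite stateP.
by rewrite !(permM (sperm i)) sperm_rev // stateP.
Qed.
(** Products of permutations apply the left factor first, so this exchanges positions, that is,
    multiplies by s_i on the right in the usual convention. Letters from [N] on do nothing, which
    makes the function total. *)
Definition move (x : state) (i : nat) : state := State (move_subproof x i).

Lemma moveE x i : (i < N)%N -> move x i = (sperm i * x)%g :> {perm T}.
Proof. by rewrite /move /= => ->. Qed.

Lemma moveK x i : (i < N)%N -> move (move x i) i = x.
Proof. by move=> iN; apply: val_inj; rewrite /= iN mulgA spermK // mul1g. Qed.

Lemma move_braid x i j : (i < N)%N -> (j < N)%N -> edgeD i j ->
  move (move (move x i) j) i = move (move (move x j) i) j.
Proof.
move=> iN jN eij; apply: val_inj; rewrite /= iN jN !mulgA sperm_braid //.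
Qed.

Lemma move_comm x i j : (i < N)%N -> (j < N)%N -> ~~ edgeD i j ->
  move (move x i) j = move (move x j) i.
Proof.
move=> iN jN eij; apply: val_inj; rewrite /= iN jN !mulgA.
by rewrite (sperm_comm iN jN).
Qed.

Definition letter_val (x : state) (t : nat) : int := (val (x (inord t)))%:Z.

Lemma letter_valN x t : (t <= N.*2)%N ->
  letter_val x (N.*2 - t) = N.*2%:Z - letter_val x t.
Proof.
move=> tN; rewrite /letter_val.
have -> : inord (N.*2 - t) = rev_ord (inord t) :> T.
  by apply: val_inj; rewrite /= !inordK // ?subSS // ltnS leq_subr.
rewrite stateP /= subSS subzn //.
by rewrite -ltnS.
Qed.

Lemma letter_val_move x i t : (i < N)%N -> (t <= N.*2)%N ->
  letter_val (move x i) t = letter_val x (swap i t).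
Proof.
move=> iN tN; rewrite /letter_val moveE // permM; congr (nat_of_ord (x _))%:Z.
by apply: val_inj; rewrite /= spermE // !inordK // ltnS swap_le.
Qed.

(** The value of the simple root alpha_i on [x]; it is negative exactly when i is a descent of
    [x]. *)
Definition root (x : state) (i : nat) : int :=
  letter_val x (high i) - letter_val x (low i).

Definition cartan (i j : nat) : int :=
  if i == j then 2 else if edgeD i j then -1 else 0.

End SignedPermutations.

(** * Simple roots, inversions and length *)

Section Roots.
Variable N : nat.
Hypothesis N_gt1 : (1 < N)%N.
Local Notation T := 'I_N.*2.+1.

(** The reflection formula s_j(alpha_i) = alpha_i - a_ij alpha_j. The exchange lemma and the
    Demazure relations are deduced from it by comparing signs. *)
Lemma root_move (x : state N) i j : (i < N)%N -> (j < N)%N ->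
  root (move N_gt1 x j) i = root x i - cartan i j * root x j.
Proof.
move=> iN jN; rewrite /root !letter_val_move //; try by rewrite /low /high; do ?case: ifP; lia.
have LN := @letter_valN _ x; rewrite /cartan.
have E (a b : nat) : a = b -> letter_val x a = letter_val x b by move=> ->.
have EN (a b : nat) : (b <= N.*2)%N -> (a = N.*2 - b)%N ->
  letter_val x a = N.*2%:Z - letter_val x b by move=> bN ->; exact: LN.
have [<-|ne] := eqVneq i j.
  rewrite (E (swap N i (high N i)) (low N i)); last first.
    by rewrite /swap /low /high /=; repeat case: ifP; lia.
  rewrite (E (swap N i (low N i)) (high N i)); first by lia.
  by rewrite /swap /low /high /=; repeat case: ifP; lia.
have [e|e] := boolP (edgeD i j).
  have : [|| (i == 0%N) && (j == 2%N), (i == 2%N) && (j == 0%N),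
             (0 < i)%N && (j == i.+1) | (0 < j)%N && (i == j.+1)].
    by case: i j e {iN jN ne} => [|i] [|j] /=; lia.
  case/or4P => /andP[h1 /eqP h2]; subst; try (move/eqP: h1 => h1; subst).
  - rewrite (E (swap N 2 (high N 0)) (high N 0)); last first.
      by rewrite /swap /low /high /=; repeat case: ifP; lia.
    rewrite (EN (swap N 2 (low N 0)) (high N 2)); first last.
    + by rewrite /swap /low /high /=; repeat case: ifP; lia.
    + by rewrite /high; lia.
    rewrite (EN (low N 2) (low N 0)); [lia|by rewrite /low /=; lia|].
    by rewrite /low /=; lia.
  - rewrite (E (swap N 0 (high N 2)) (high N 2)); last first.
      by rewrite /swap /low /high /=; repeat case: ifP; lia.
    rewrite (EN (swap N 0 (low N 2)) (high N 0)); first last.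
    + by rewrite /swap /low /high /=; repeat case: ifP; lia.
    + by rewrite /high; lia.
    rewrite (EN (low N 2) (low N 0)); [lia|by rewrite /low /=; lia|].
    by rewrite /low /=; lia.
  - rewrite (E (swap N i.+1 (high N i)) (high N i.+1)); last first.
      by rewrite /swap /low /high /=; repeat case: ifP; lia.
    rewrite (E (swap N i.+1 (low N i)) (low N i)); last first.
      by rewrite /swap /low /high /=; repeat case: ifP; lia.
    rewrite (E (low N i.+1) (high N i)); first by lia.
    by rewrite /low /high /=; lia.
  - rewrite (E (swap N j (high N j.+1)) (high N j.+1)); last first.
      by rewrite /swap /low /high /=; repeat case: ifP; lia.
    rewrite (E (swap N j (low N j.+1)) (low N j)); last first.
      by rewrite /swap /low /high /=; repeat case: ifP; lia.
    rewrite (E (low N j.+1) (high N j)); first by lia.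
    by rewrite /low /high /=; lia.
have : [|| (i == 0%N) && (j == 1%N), (i == 1%N) && (j == 0%N) |
  ((i == 0) && (2 < j) || (j == 0) && (2 < i) || (0 < i) && (i.+1 < j)
   || (0 < j) && (j.+1 < i))%N].
  by case: i j e ne {iN jN} => [|i] [|j] /=; lia.
case/or3P => [/andP[/eqP-> /eqP->]|/andP[/eqP-> /eqP->]|ij].
- rewrite (EN (swap N 1 (high N 0)) (low N 0)); first last.
  + by rewrite /swap /low /high /=; repeat case: ifP; lia.
  + by rewrite /low /=; lia.
  rewrite (EN (swap N 1 (low N 0)) (high N 0)); first lia.
    by rewrite /high; lia.
  by rewrite /swap /low /high /=; repeat case: ifP; lia.
- rewrite (EN (swap N 0 (high N 1)) (low N 1)); first last.
  + by rewrite /swap /low /high /=; repeat case: ifP; lia.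
  + by rewrite /low /=; lia.
  rewrite (EN (swap N 0 (low N 1)) (high N 1)); first lia.
    by rewrite /high; lia.
  by rewrite /swap /low /high /=; repeat case: ifP; lia.
rewrite (E (swap N j (high N i)) (high N i)); last first.
  by rewrite /swap /low /high /=; repeat case: ifP; lia.
rewrite (E (swap N j (low N i)) (low N i)); first lia.
by rewrite /swap /low /high /=; repeat case: ifP; lia.
Qed.

Lemma root_neq0 (x : state N) i : (i < N)%N -> root x i != 0.
Proof.
move=> iN; rewrite subr_eq0 eqz_nat (inj_eq val_inj) (inj_eq perm_inj) -(inj_eq val_inj).
by rewrite /= !inordK ?ltnS; rewrite /low /high; do ?case: ifP; lia.
Qed.

(* Counts every positive root of D_N twice, as (a, b) and as (-b, -a). *)
Definition inversions (x : state N) : {set (T * T)%type} :=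
  [set ab : (T * T)%type |
    [&& (ab.1 < ab.2)%N, (x ab.2 < x ab.1)%N, ab.1 != rev_ord ab.2,
    (ab.1 != N :> nat) & (ab.2 != N :> nat)]].

Definition len (x : state N) : nat := #|inversions x|./2.

Lemma len1 : len (sid N) = 0%N.
Proof.
rewrite /len (_ : inversions _ = finset.set0) ?finset.cards0 //.
by apply/finset.setP => -[a b]; rewrite !inE /= !perm1; lia.
Qed.

(** The reflection s_i permutes the positive roots other than alpha_i. A positive root being counted
    as two pairs of positions, the inversions of the new state are the images of the old ones and of
    two further pairs. *)
Lemma len_move_gt (x : state N) i : (i < N)%N -> 0 < root x i ->
  len (move N_gt1 x i) = (len x).+1.
Proof.
move=> iN xi; set s := sperm N i.
pose f (ab : (T * T)%type) := (s ab.1, s ab.2).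
have sK : involutive s by move=> t; rewrite -permM spermK // perm1.
have fK : involutive f by case=> a b; rewrite /f /= !sK.
pose l : T := inord (low N i); pose h : T := inord (high N i).
pose nl := rev_ord l; pose nh := rev_ord h.
have lE : l = low N i :> nat by rewrite /l inordK // ltnS /low; case: ifP; lia.
have hE : h = high N i :> nat by rewrite /h inordK // ltnS /high; lia.
have xl : (x l < x h)%N by move: xi; rewrite /root /letter_val -/l -/h /=; lia.
have xn : (x nh < x nl)%N.
  by rewrite !stateP /=; have := ltn_ord (x l); have := ltn_ord (x h); lia.
(* The pairs [(h, l)] and [(nl, nh)] are in decreasing order, hence no inversions of [x]; [f] turns
   them into the inversions [(l, h)] and [(nh, nl)] of the new state. *)
suff : inversions (move N_gt1 x i) =
    f @: (inversions x :|: [set (h, l); (nl, nh)]) => [E|].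
  rewrite /len E card_imset; last exact: inv_inj fK.
  rewrite cardsU (_ : _ :&: _ = finset.set0) ?finset.cards0 ?subn0 ?cards2; last first.
    apply/finset.setP => -[a b]; rewrite !inE !xpair_eqE /=.
    apply/negP => /andP[/and5P[ab _ _ _ _] /orP[]/andP[/eqP ea /eqP eb]];
      move: ab; rewrite ea eb /= ?hE ?lE /low /high; case: ifP; lia.
  have -> : (h, l) != (nl, nh).
    rewrite xpair_eqE -[h == nl](inj_eq val_inj) /= hE lE negb_and /high /low.
    by apply/orP; left; case: ifP; lia.
  by rewrite addn2 /=; lia.
apply/finset.setP => ab; rewrite -[ab]fK (finset.mem_imset _ _ (inv_inj fK)).
case: {ab}(f ab) => a b; rewrite !inE !xpair_eqE /= iN !permM -/s !sK.
have lowhigh : i = 0%N /\ low N i = (N - 2)%N /\ high N i = N.+1 \/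
    (0 < i)%N /\ low N i = (N + i)%N /\ high N i = (N + i).+1.
  by rewrite /low /high; case: eqP; lia.
have swapP (t : T) : t = low N i :> nat /\ swap N i t = high N i \/
    t = high N i :> nat /\ swap N i t = low N i \/
    t = (N.*2 - low N i)%N :> nat /\ swap N i t = (N.*2 - high N i)%N \/
    t = (N.*2 - high N i)%N :> nat /\ swap N i t = (N.*2 - low N i)%N \/
    (t <> low N i :> nat /\ t <> high N i :> nat /\ t <> (N.*2 - low N i)%N :> nat /\
    t <> (N.*2 - high N i)%N :> nat) /\ swap N i t = t.
  by rewrite /swap; do 4?case: eqP => ?; tauto.
have eT (c d : T) : (c == d) = (c == d :> nat) by rewrite -(inj_eq val_inj).
rewrite -sperm_rev // (inj_eq perm_inj) !spermE //.
have swapN (t : T) : (swap N i t != N) = (t != N :> nat).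
  have := ltn_ord t; have := swapP t; clear swapP xl xn.
  by case=> [[-> ->]|[[-> ->]|[[-> ->]|[[-> ->]|[? ->]]]]]; lia.
have sl : swap N i l = h by have := swapP l; clear swapP xl xn swapN; lia.
have sh : swap N i h = l by have := swapP h; clear swapP xl xn swapN; lia.
have snl : swap N i nl = nh.
  have := swapP nl; clear swapP xl xn swapN; rewrite /= lE hE !subSS; lia.
have snh : swap N i nh = nl.
  have := swapP nh; clear swapP xl xn swapN; rewrite /= lE hE !subSS; lia.
have lth : (l < h)%N by lia.
have nlth : (nh < nl)%N by rewrite /= lE hE !subSS; lia.
have lN : [&& (l != N :> nat), (h != N :> nat), (nl != N :> nat), (nh != N :> nat),
    h != rev_ord l & nl != rev_ord nh].
  by rewrite /= lE hE !eT /= lE hE; lia.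
case/and5P: lN => lN hN nlN nhN /andP[hl nln].
have ne1 : (l == h) = false by rewrite eT; lia.
have ne2 : (l == nl) = false by rewrite eT /= lE; lia.
have ne3 : (nh == h) = false by rewrite eT /= hE; lia.
have ne4 : (nh == nl) = false by rewrite eT /= lE hE !subSS; lia.
have asym (c d : nat) : (c < d)%N -> (d < c)%N = false by lia.
have [[-> ->]|n1] := eqVneq (a, b) (l, h).
  by rewrite sl sh (asym _ _ lth) (asym _ _ xl) ne1 ne2 !andbF.
have [[-> ->]|n2] := eqVneq (a, b) (nh, nl).
  by rewrite snl snh (asym _ _ nlth) (asym _ _ xn) ne3 ne4 !andbF.
have [[-> ->]|n3] := eqVneq (a, b) (h, l).
  by rewrite sl sh lth xl hl hN lN !eqxx orbT.
have [[-> ->]|n4] := eqVneq (a, b) (nl, nh).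
  by rewrite snl snh nlth xn nlN nhN nln !eqxx !orbT.
rewrite -!xpair_eqE (negPf n3) (negPf n4) !orbF !swapN.
have [->|ab] := eqVneq a (rev_ord b); first by rewrite !andbF.
have [aN|aN] := eqVneq (a : nat) N; first by rewrite !andbF.
have [bN|bN] := eqVneq (b : nat) N; first by rewrite !andbF.
congr andb.
(* For i > 0 the positions [low] and [high] are adjacent. For i = 0 the positions -1 and 0 lie
   between them: -1 is one of the four exchanged positions, and 0, encoded as [N], is excluded from
   inversions. *)
have other (t : nat) : t <> N -> t <> low N i -> t <> high N i ->
    t <> (N.*2 - low N i)%N -> t <> (N.*2 - high N i)%N ->
    [/\ (t < high N i) = (t < low N i), (high N i < t) = (low N i < t),
    (t < N.*2 - high N i) = (t < N.*2 - low N i) &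
    (N.*2 - high N i < t) = (N.*2 - low N i < t)]%N.
  clear -lowhigh N_gt1 iN.
  by case: lowhigh => -[? [-> ->]] tN t1 t2 t3 t4; split; lia.
case: (swapP b) => [bE|[bE|[bE|[bE|[[b1 [b2 [b3 b4]]] ->]]]]]; last first.
  have [] := other b (elimN eqP bN) b1 b2 b3 b4.
  by case: (swapP a) => [[-> ->]|[[-> ->]|[[-> ->]|[[-> ->]|[? ->]]]]].
all: case: (swapP a) => [aE|[aE|[aE|[aE|[[a1 [a2 [a3 a4]]] ->]]]]];
  try by have [] := other a (elimN eqP aN) a1 a2 a3 a4; case: bE => -> ->.
all: move: ab n1 n2 n3 n4; rewrite !xpair_eqE !eT /= lE hE !subSS.
all: case: aE bE => -> -> [-> ->]; clear -lowhigh N_gt1 iN.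
all: rewrite ?eqxx /= //.
all: case: lowhigh => -[? [-> ->]]; lia.
Qed.

End Roots.

(** * Reduced words *)

(** Braid moves without the cancellation of s_i s_i: they are valid in the Coxeter group and in
    every 0-Hecke family alike, and they keep the length. *)
Inductive braid_eq : seq nat -> seq nat -> Prop :=
| braid_refl u : braid_eq u u
| braid_sym u v of braid_eq u v : braid_eq v u
| braid_trans u v w of braid_eq u v & braid_eq v w : braid_eq u w
| braid_braid u i j v of edgeD i j :
    braid_eq (u ++ [:: i; j; i] ++ v) (u ++ [:: j; i; j] ++ v)
| braid_comm u i j v of ~~ edgeD i j :
    braid_eq (u ++ [:: i; j] ++ v) (u ++ [:: j; i] ++ v).

Lemma braid_all (J : pred nat) u v : braid_eq u v -> all J u = all J v.
Proof.
elim=> {u v} // [u v w _ -> _ -> //|u i j v _|u i j v _].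
  by rewrite !all_cat /=; do 2?case: (J _); rewrite ?andbF.
by rewrite !all_cat /=; do 2?case: (J _); rewrite ?andbF.
Qed.

Lemma braid_size u v : braid_eq u v -> size u = size v.
Proof. by elim=> {u v} // [u v w _ -> _ -> //|u i j v _|u i j v _]; rewrite !size_cat. Qed.

Lemma braid_cat a b u v : braid_eq u v -> braid_eq (a ++ u ++ b) (a ++ v ++ b).
Proof.
elim=> {u v} [u|u v _|u v w _ h _|u i j v e|u i j v e].
- exact: braid_refl.
- exact: braid_sym.
- exact: braid_trans.
- by rewrite -!catA !(catA a); exact: braid_braid.
- by rewrite -!catA !(catA a); exact: braid_comm.
Qed.

Lemma braid_rcons u v i : braid_eq u v -> braid_eq (rcons u i) (rcons v i).
Proof. by rewrite -!cats1 -[u ++ _]cat0s -[v ++ _]cat0s; exact: braid_cat. Qed.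

Section Words.
Variable N : nat.
Hypothesis N_gt1 : (1 < N)%N.
Local Notation mv := (move N_gt1).
Local Notation X := (state N).
Local Notation bounded := (all (fun i => i < N)%N).

Definition word_state (u : seq nat) : X := foldl mv (sid N) u.

Lemma word_state_rcons u i : word_state (rcons u i) = mv (word_state u) i.
Proof. by rewrite /word_state foldl_rcons. Qed.

Lemma word_state_braid u v : bounded u -> braid_eq u v -> word_state u = word_state v.
Proof.
move=> bu uv; elim: uv bu => {u v} [u|u v uv IH|u v w uv IH1 vw IH2|u i j v e|u i j v e] //.
- by rewrite -(braid_all _ uv) => /IH.
- by move=> bu; rewrite IH1 // IH2 // -(braid_all _ uv).
- rewrite !all_cat /= => /and3P[_ /and4P[iN jN _ _] _].
  by rewrite /word_state !foldl_cat /= move_braid.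
- rewrite !all_cat /= => /and3P[_ /and3P[iN jN _] _].
  by rewrite /word_state !foldl_cat /= (move_comm N_gt1 _ iN jN e).
Qed.

Lemma root_mv_self (x : X) i : (i < N)%N -> root (mv x i) i = - root x i.
Proof. by move=> iN; rewrite root_move // /cartan eqxx; lia. Qed.

Lemma root_mv_edge (x : X) i j : (i < N)%N -> (j < N)%N -> edgeD i j ->
  root (mv x j) i = root x i + root x j.
Proof.
move=> iN jN e; rewrite root_move // /cartan e; case: eqP => [ij|]; last lia.
by move: e; rewrite ij; case: (j) => [|k] //=; lia.
Qed.

Lemma root_mv_comm (x : X) i j : (i < N)%N -> (j < N)%N -> ~~ edgeD i j -> i != j ->
  root (mv x j) i = root x i.
Proof. by move=> iN jN /negPf e /negPf ne; rewrite root_move // /cartan e ne; lia. Qed.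

Lemma len_move_lt (x : X) i : (i < N)%N -> root x i < 0 -> len x = (len (mv x i)).+1.
Proof.
move=> iN xi; rewrite -[in LHS](moveK N_gt1 x iN) len_move_gt // root_mv_self //; lia.
Qed.

Lemma root_ltgt (x : X) i : (i < N)%N -> ~~ (root x i < 0) -> 0 < root x i.
Proof. by move=> /(root_neq0 N_gt1 x); lia. Qed.

Lemma len_move_le (x : X) i : (i < N)%N -> (len (mv x i) <= (len x).+1)%N.
Proof.
move=> iN; have [/(len_move_lt iN)|/(root_ltgt iN)/(len_move_gt N_gt1 iN)->] // := boolP (root x i < 0).
by lia.
Qed.

Definition reduced (u : seq nat) := len (word_state u) == size u.

Lemma len_word_le u : bounded u -> (len (word_state u) <= size u)%N.
Proof.
elim/last_ind: u => [|u i IH]; first by rewrite len1.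
rewrite all_rcons word_state_rcons size_rcons => /andP[iN /IH].
by have := len_move_le (word_state u) iN; lia.
Qed.

Lemma reduced_rcons u i : (i < N)%N -> bounded u ->
  reduced (rcons u i) = reduced u && (0 < root (word_state u) i).
Proof.
move=> iN bu; rewrite /reduced word_state_rcons size_rcons.
have := len_word_le bu; have [h|h] := boolP (root (word_state u) i < 0).
  have := len_move_lt iN h.
  by case: (ltgtP 0 (root (word_state u) i)) h => //; lia.
by move/(root_ltgt iN): h => h; rewrite len_move_gt // h andbT eqSS.
Qed.

Lemma braid_reduced u v : bounded u -> braid_eq u v -> reduced u = reduced v.
Proof. by move=> bu uv; rewrite /reduced (word_state_braid bu uv) (braid_size uv). Qed.

(** Strong induction on the length of u = u' i. A negative root at j after the step i forces one
    before it: the two agree if i and j commute, and if they are joined, the sum of the roots of u'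
    at i and j is negative while the one at i is positive. Hence u' is equivalent to t j; in the
    joined case i is in turn a descent of t, so that u becomes t' i j i, and a braid move brings j
    to the end. *)
Lemma exchange u j : (j < N)%N -> bounded u -> reduced u ->
  root (word_state u) j < 0 -> exists t, braid_eq u (rcons t j).
Proof.
have [n] := ubnP (size u); elim: n u j => // n IH u j.
case: (lastP u) => [_ jN _ _ h|{}u i]; first by have := len_move_lt jN h; rewrite len1.
rewrite size_rcons ltnS all_rcons => un jN /andP[iN bu].
rewrite reduced_rcons // word_state_rcons => /andP[ru ui].
have [ij _|ij] := eqVneq i j; first by exists u; rewrite ij; exact: braid_refl.
have [e|e] := boolP (edgeD i j); last first.
  rewrite root_mv_comm // 1?edgeD_sym 1?eq_sym // => uj.
  have [t ut] := IH u j un jN bu ru uj; exists (rcons t i).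
  apply: braid_trans (braid_rcons i ut) _.
  by rewrite -!cats1 -!catA -[[:: i] ++ _]/([:: i; j] ++ [::]);
     apply: braid_trans (braid_sym (braid_comm _ _ e)); rewrite cats0; exact: braid_refl.
rewrite root_mv_edge // 1?edgeD_sym // => uij.
have uj : root (word_state u) j < 0 by lia.
have [t ut] := IH u j un jN bu ru uj.
have btj : bounded (rcons t j) by rewrite -(braid_all _ ut).
have bt : bounded t by move: btj; rewrite all_rcons => /andP[].
have := ru; rewrite (braid_reduced bu ut) reduced_rcons // => /andP[rt tj].
have ti : root (word_state t) i < 0.
  move: uij; rewrite (word_state_braid bu ut) word_state_rcons root_mv_self //.
  by rewrite root_mv_edge //; lia.
have [|t' tt'] := IH t i _ iN bt rt ti.
  by move: un; rewrite (braid_size ut) size_rcons; exact: ltnW.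
exists (t' ++ [:: j; i]); apply: braid_trans (braid_rcons i ut) _.
apply: braid_trans (braid_rcons i (braid_rcons j tt')) _.
rewrite -!cats1 -!catA /=.
have := @braid_braid t' i j [::] e; rewrite !cats0; exact.
Qed.

(** The last letter i of [u] is a descent of the common state, so the exchange lemma brings i to the
    end of [v], and both words can be shortened. *)
Lemma matsumoto u v : bounded u -> bounded v -> reduced u -> reduced v ->
  word_state u = word_state v -> braid_eq u v.
Proof.
elim/last_ind: u v => [|u i IH] v.
  move=> _ _ _ /eqP rv e; move: rv; rewrite -e len1 // => /esym/size0nil->.
  exact: braid_refl.
rewrite all_rcons => /andP[iN bu] bv; rewrite reduced_rcons // => /andP[ru ui] rv e.
have vi : root (word_state v) i < 0.
  by rewrite -e word_state_rcons root_mv_self //; lia.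
have [t vt] := exchange iN bv rv vi.
have bti : bounded (rcons t i) by rewrite -(braid_all _ vt).
have bt : bounded t by move: bti; rewrite all_rcons => /andP[].
have := rv; rewrite (braid_reduced bv vt) reduced_rcons // => /andP[rt ti].
apply: braid_trans (braid_sym vt); apply/braid_rcons/IH => //.
move: e; rewrite (word_state_braid bv vt) !word_state_rcons => /(congr1 (mv^~ i)).
by rewrite !moveK.
Qed.

(** * The Demazure action *)

(** Right multiplication by pi_i on the basis of the pi_w: the product pi_x pi_i is pi_x at a
    descent, and belongs to x s_i otherwise. *)
Definition demazure (x : X) (i : nat) : X := if root x i < 0 then x else mv x i.

Lemma demazure_root x i : (i < N)%N -> root (demazure x i) i < 0.
Proof.
move=> iN; rewrite /demazure; case: ifP => // /negbT/(root_ltgt iN).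
by rewrite root_mv_self //; lia.
Qed.

Lemma demazure_idem x i : (i < N)%N -> demazure (demazure x i) i = demazure x i.
Proof. by move=> iN; rewrite {1}/demazure demazure_root. Qed.

(** Both sides climb to the longest element of the coset of [x] under s_i and s_j. By symmetry
    either i is already a descent, and the last step on the other side is idle, or neither letter is
    one, and the braid relation for [move] applies. *)
Lemma demazure_braid x i j : (i < N)%N -> (j < N)%N -> edgeD i j ->
  demazure (demazure (demazure x i) j) i = demazure (demazure (demazure x j) i) j.
Proof.
move=> iN jN e; have e' : edgeD j i by rewrite edgeD_sym.
wlog: i j iN jN e e' / (root x i < 0) || ~~ (root x j < 0) => [W|].
  have [h|/norP[h1 /negPn h2]] := boolP ((root x i < 0) || ~~ (root x j < 0)).
    exact: W.
  by apply/esym/W => //; rewrite h2.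
have [ri _|ri] := boolP (root x i < 0).
  have xi : demazure x i = x by rewrite /demazure ri.
  rewrite xi; have [rj|rj] := boolP (root x j < 0).
    have xj : demazure x j = x by rewrite /demazure rj.
    by rewrite xj xi xj.
  have xj : demazure x j = mv x j by rewrite /demazure (negPf rj).
  rewrite xj; suff yj : root (demazure (mv x j) i) j < 0 by rewrite [RHS]/demazure yj.
  rewrite /demazure; case: ifP => h; first by rewrite root_mv_self // oppr_lt0 root_ltgt.
  by rewrite root_mv_edge // root_mv_self // root_mv_edge // addrC addrK.
have {}ri := root_ltgt iN ri => rj; have {}rj := root_ltgt jN rj.
have D y k : 0 < root y k -> demazure y k = mv y k.
  by move=> h; rewrite /demazure ltNge (ltW h).
have ei : root (mv x i) j = root x j + root x i by rewrite root_mv_edge.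
have ej : root (mv x j) i = root x i + root x j by rewrite root_mv_edge.
have ij := addr_gt0 ri rj; have ji := addr_gt0 rj ri.
rewrite (D x i ri) (D x j rj) (D (mv x i) j) ?ei //.
rewrite (D (mv x j) i) ?ej // (D _ i) ?(D _ j) //.
- exact: move_braid.
- by rewrite root_mv_edge // root_mv_self // ej addrCA addNr addr0.
- by rewrite root_mv_edge // root_mv_self // ei addrCA addNr addr0.
Qed.

Lemma demazure_comm x i j : (i < N)%N -> (j < N)%N -> ~~ edgeD i j ->
  demazure (demazure x i) j = demazure (demazure x j) i.
Proof.
move=> iN jN e; have [->//|ij] := eqVneq i j.
have e' : ~~ edgeD j i by rewrite edgeD_sym.
have ji : j != i by rewrite eq_sym.
have ei := root_mv_comm x iN jN e ij; have ej := root_mv_comm x jN iN e' ji.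
rewrite /demazure; case ri: (root x i < 0); case rj: (root x j < 0);
  rewrite ?ei ?ej ?ri ?rj //.
exact: move_comm.
Qed.

Definition demazure_word (x : X) (u : seq nat) : X := foldl demazure x u.

Lemma demazure_word_braid x u v : bounded u -> braid_eq u v ->
  demazure_word x u = demazure_word x v.
Proof.
move=> bu uv; elim: uv bu => {u v} [u|u v uv IH|u v w uv IH1 vw IH2|u i j v e|u i j v e] //.
- by rewrite -(braid_all _ uv) => /IH.
- by move=> bu; rewrite IH1 // IH2 // -(braid_all _ uv).
- rewrite !all_cat /= => /and3P[_ /and4P[iN jN _ _] _].
  by rewrite /demazure_word !foldl_cat /= demazure_braid.
- rewrite !all_cat /= => /and3P[_ /and3P[iN jN _] _].
  by rewrite /demazure_word !foldl_cat /= (demazure_comm _ iN jN e).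
Qed.

Lemma demazure_word_reduced u : bounded u -> reduced u ->
  demazure_word (sid N) u = word_state u.
Proof.
elim/last_ind: u => [|u i IH] //; rewrite all_rcons => /andP[iN bu].
rewrite reduced_rcons // => /andP[ru ui].
rewrite /demazure_word foldl_rcons -/(demazure_word _ _) IH // word_state_rcons.
by rewrite /demazure ltNge (ltW ui).
Qed.

(** * Parabolic subgroups and their longest elements *)

Section Parabolic.
Variable J : pred nat.
Hypothesis J_bound : forall i, J i -> (i < N)%N.

Lemma bounded_par u : all J u -> bounded u.
Proof. exact: sub_all. Qed.

Definition par_state (x : X) : bool :=
  `[< exists u, [/\ all J u, reduced u & word_state u = x] >].

Definition par_word (x : X) : seq nat :=
  if pselect (exists u, [/\ all J u, reduced u & word_state u = x]) is left e
  then sval (cid e) else [::].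

Lemma par_wordP x : par_state x ->
  [/\ all J (par_word x), reduced (par_word x) & word_state (par_word x) = x].
Proof.
by move/asboolP => e; rewrite /par_word; case: pselect => // e'; case: cid.
Qed.

Lemma par_stateP u : all J u -> reduced u -> par_state (word_state u).
Proof. by move=> Ju ru; apply/asboolP; exists u. Qed.

Lemma par_state1 : par_state (sid N).
Proof. by apply: (@par_stateP [::]) => //; rewrite /reduced len1. Qed.

Lemma par_word1 : par_word (sid N) = [::].
Proof. by have [_ /eqP + e] := par_wordP par_state1; rewrite e len1 // => /esym/size0nil. Qed.

Lemma par_state_demazure x i : par_state x -> J i -> par_state (demazure x i).
Proof.
move=> Px Ji; rewrite /demazure; case: ifP => // /negbT xi.
have [Ju ru e] := par_wordP Px; have iN := J_bound Ji.
rewrite -e -word_state_rcons; apply: par_stateP; first by rewrite all_rcons Ji.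
by rewrite reduced_rcons ?bounded_par // ru e root_ltgt.
Qed.

(** Take a state of maximal length among those reached by letters of [J]: an ascent in [J] would
    lead to a longer one, so all of [J] are descents. *)
Lemma longest_exists : exists u, [/\ all J u, reduced u,
  forall v, all J v -> reduced v -> (size v <= size u)%N &
  forall i, J i -> root (word_state u) i < 0].
Proof.
pose x := [arg max_(x > sid N | par_state x) len x].
have [Px Mx] : par_state x /\ forall y, par_state y -> (len y <= len x)%N.
  by rewrite /x; case: arg_maxnP => [|y Py My]; [exact: par_state1|split].
have [Ju ru e] := par_wordP Px; exists (par_word x); split => //.
  move=> v Jv rv; have := Mx _ (par_stateP Jv rv).
  by rewrite (eqP rv) -{1}e (eqP ru).
move=> i Ji; rewrite e; apply/negPn/negP => /(root_ltgt (J_bound Ji)) xi.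
have := Mx _ (par_state_demazure Px Ji).
rewrite /demazure ltNge (ltW xi) /=.
by rewrite len_move_gt ?J_bound //; lia.
Qed.

End Parabolic.
End Words.

(** * 0-Hecke families in a ring *)

(** Trivial rings are allowed, so that zero-dimensional representations are covered. *)
Record hecke_family (A : pzRingType) (p : nat -> A) : Prop := HeckeFamily {
  fam_idem : forall i, p i * p i = p i;
  fam_braid : forall i j, edgeD i j -> p i * p j * p i = p j * p i * p j;
  fam_comm : forall i j, ~~ edgeD i j -> p i * p j = p j * p i }.

Definition pword (A : pzRingType) (p : nat -> A) (u : seq nat) : A := \prod_(i <- u) p i.

Section Families.
Variables (A : pzRingType) (p : nat -> A).
Hypothesis hp : hecke_family p.

Lemma pword_cat u v : pword p (u ++ v) = pword p u * pword p v.
Proof. by rewrite /pword big_cat. Qed.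

Lemma pword_rcons u i : pword p (rcons u i) = pword p u * p i.
Proof. by rewrite -cats1 pword_cat /pword big_seq1. Qed.

Lemma pword_braid u v : braid_eq u v -> pword p u = pword p v.
Proof.
elim=> {u v} // [u v w _ -> _ -> //|u i j v e|u i j v e]; rewrite !pword_cat; congr (_ * (_ * _)).
  by rewrite /pword !big_cons big_nil !mulr1 !mulrA fam_braid.
by rewrite /pword !big_cons big_nil !mulr1 fam_comm.
Qed.

(** Here [1 - p i] is the negative of pi_i - 1, a sign that makes it idempotent. The product for a,
    b, a expands to 1 - a - b + ab + ba - aba, whose symmetry in a and b is the braid relation for
    [p]. *)
Lemma family_compl : hecke_family (fun i => 1 - p i).
Proof.
split=> [i|i j e|i j e].
- by rewrite mulrBl mul1r mulrBr mulr1 fam_idem // subrr subr0.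
- have E a b : (1 - p a) * (1 - p b) * (1 - p a) =
      1 - p b - (p a - p a * p b) - (p a * p b * p a - p b * p a).
    have -> : (1 - p a) * (1 - p b) = 1 - p b - (p a - p a * p b).
      by rewrite mulrBl mul1r mulrBr mulr1.
    rewrite mulrBr mulr1; congr (_ - _).
    by rewrite !mulrBl mul1r fam_idem // opprB addrC addrA subrK.
  rewrite !E (fam_braid hp e) !opprB !addrA; exact: (AC 6 (1*4*5*2*3*6))%AC.
- rewrite !(mulrBl, mulrBr, mul1r, mulr1) (fam_comm hp e) !opprB !addrA.
  exact: (AC 4 (1*4*3*2))%AC.
Qed.

Section States.
Variables (N : nat) (N_gt1 : (1 < N)%N) (J : pred nat).
Hypothesis J_bound : forall i, J i -> (i < N)%N.
Local Notation par := (par_state N_gt1 J).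

Definition pstate (x : state N) : A := pword p (par_word N_gt1 J x).

Lemma pstate1 : pstate (sid N) = 1.
Proof. by rewrite /pstate par_word1 // /pword big_nil. Qed.

(** At a descent the exchange lemma lets the word end in i, which is absorbed by idempotence; at an
    ascent the extended word is reduced, and Matsumoto's theorem compares it with the chosen one. *)
Lemma pstate_demazure x i : par x -> J i ->
  pstate x * p i = pstate (demazure N_gt1 x i).
Proof.
move=> Px Ji; have iN := J_bound Ji.
have [Ju ru e] := par_wordP Px; have bu := bounded_par J_bound Ju.
have Py := par_state_demazure J_bound Px Ji.
have [Jv rv e'] := par_wordP Py; have bv := bounded_par J_bound Jv.
have [xi|xi] := boolP (root x i < 0).
  have -> : demazure N_gt1 x i = x by rewrite /demazure xi.
  have [|t ut] := exchange iN bu ru; first by rewrite e.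
  by rewrite /pstate (pword_braid ut) pword_rcons -mulrA fam_idem.
rewrite /pstate -pword_rcons; apply/pword_braid/(matsumoto (N_gt1 := N_gt1)) => //.
- by rewrite all_rcons /= iN.
- by rewrite reduced_rcons // ru e root_ltgt.
- by rewrite e' word_state_rcons e /demazure (negPf xi).
Qed.

Lemma par_demazure_word x u : par x -> all J u -> par (demazure_word N_gt1 x u).
Proof.
elim: u x => //= i u IH x Px /andP[Ji Ju]; apply: IH => //.
exact: par_state_demazure.
Qed.

Lemma pstate_pword x u : par x -> all J u ->
  pstate x * pword p u = pstate (demazure_word N_gt1 x u).
Proof.
elim: u x => [|i u IH] x Px /=; first by rewrite /pword big_nil mulr1.
move=> /andP[Ji Ju]; rewrite -cat1s pword_cat /pword big_seq1 mulrA pstate_demazure //.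
by rewrite IH //; exact: par_state_demazure.
Qed.

(** In the applications [P a] says that [a] does not kill a given vector or functional. On the
    translate by [pstate x] each [p i] then acts by 1 if i is a descent of [x] and by 0
    otherwise. *)
Lemma pstate_maximal (P : A -> Prop) : P 1 -> exists x, [/\ par x, P (pstate x) &
  forall i, J i -> pstate x * p i = pstate x \/ ~ P (pstate x * p i)].
Proof.
move=> P1; pose Q x := par x && `[< P (pstate x) >].
have Q1 : Q (sid N) by rewrite /Q par_state1 //= pstate1; apply/asboolP.
have [x Qx Mx] : exists2 x, Q x & forall y, Q y -> (len y <= len x)%N.
  by case: (@arg_maxnP _ (sid N) Q (@len N) Q1) => x Qx Mx; exists x.
have /andP[Px /asboolP PQ] := Qx; exists x; split=> // i Ji.
rewrite pstate_demazure //; case: (boolP (root x i < 0)) => xi.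
  by left; rewrite /demazure xi.
right=> PP; have /Mx : Q (demazure N_gt1 x i).
  by rewrite /Q par_state_demazure //; apply/asboolP.
have iN := J_bound Ji; rewrite /demazure (negPf xi).
by rewrite (len_move_gt N_gt1 iN (root_ltgt N_gt1 iN xi)) ltnn.
Qed.

Definition longest : seq nat := sval (cid (longest_exists N_gt1 J_bound)).

Lemma longestP : [/\ all J longest, reduced N_gt1 longest,
  forall v, all J v -> reduced N_gt1 v -> (size v <= size longest)%N &
  forall i, J i -> root (word_state N_gt1 longest) i < 0].
Proof. exact: (svalP (cid (longest_exists N_gt1 J_bound))). Qed.

Lemma longest_rcons i : J i -> exists t, braid_eq longest (rcons t i).
Proof.
move=> Ji; have [Jl rl _ /(_ i Ji) li] := longestP.
exact: exchange (J_bound Ji) (bounded_par J_bound Jl) rl li.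
Qed.

Lemma longestMr i : J i -> pword p longest * p i = pword p longest.
Proof.
by case/longest_rcons => t /pword_braid->; rewrite pword_rcons -mulrA fam_idem.
Qed.

Lemma braid_rev u v : braid_eq u v -> braid_eq (rev u) (rev v).
Proof.
elim=> {u v} [u|u v _|u v w _ h _|u i j v e|u i j v e].
- exact: braid_refl.
- exact: braid_sym.
- exact: braid_trans.
- by rewrite !rev_cat -!catA; exact: braid_braid.
- by rewrite !rev_cat -!catA; apply: braid_comm; rewrite edgeD_sym.
Qed.

(* [pword longest] absorbs letters on the right and [pword (rev longest)]
   absorbs them on the left, so both equal their product. *)
Lemma longestMl i : J i -> p i * pword p longest = pword p longest.
Proof.
have revl j : J j -> p j * pword p (rev longest) = pword p (rev longest).
  case/longest_rcons => t /braid_rev/pword_braid->.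
  by rewrite rev_rcons -cat1s pword_cat mulrA /pword big_seq1 fam_idem.
have Jl : all J longest by case: longestP.
have absl u : all J u -> pword p u * pword p (rev longest) = pword p (rev longest).
  elim: u => [|j u IH] /=; first by rewrite /pword big_nil mul1r.
  move=> /andP[Jj Ju]; rewrite -cat1s pword_cat -mulrA IH //.
  by rewrite /pword big_seq1 revl.
have absr u : all J u -> pword p longest * pword p u = pword p longest.
  elim: u => [|j u IH] /=; first by rewrite /pword big_nil mulr1.
  move=> /andP[Jj Ju]; rewrite -cat1s pword_cat mulrA.
  by rewrite [pword p [:: j]]/pword big_seq1 longestMr // IH.
have E : pword p longest = pword p (rev longest).
  by rewrite -[LHS](absr (rev longest)) ?all_rev // absl.
by move=> Ji; rewrite E revl.
Qed.

End States.
End Families.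

(** * Algebras presented by a 0-Hecke family *)

(* The universal property is only required for matrix algebras: these are the
   representations.  Letters outside [J] act by 1, which keeps the relations. *)
Record hecke_algebra (F : fieldType) (A : algType F) (J : pred nat) (p : nat -> A) : Prop :=
  HeckeAlgebra {
  alg_fam : hecke_family p;
  alg_out : forall i, ~~ J i -> p i = 1;
  alg_gen : forall S : A -> Prop, S 1 ->
    (forall (k : F) x y, S x -> S y -> S (k *: x + y)) ->
    (forall x y, S x -> S y -> S (x * y)) -> (forall i, J i -> S (p i)) -> forall a, S a;
  alg_univ : forall d (q : nat -> 'M[F]_d), hecke_family q ->
    (forall i, ~~ J i -> q i = 1) ->
    exists rho : {lrmorphism A -> 'M[F]_d}, forall i, rho (p i) = q i }.

Section FunctionMatrix.
Variables (F : fieldType) (d : nat).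

(** The action is on row vectors, so that products of matrices compose the maps from left to right,
    as the right action [demazure] requires. *)
Definition fun_mx (f : 'I_d -> 'I_d) : 'M[F]_d := \matrix_(a, b) (b == f a)%:R.

Lemma delta_fun_mx f a : delta_mx 0 a *m fun_mx f = delta_mx 0 (f a) :> 'rV_d.
Proof. by rewrite -rowE; apply/rowP => b; rewrite !mxE. Qed.

Lemma fun_mxM f g : fun_mx f * fun_mx g = fun_mx (g \o f).
Proof.
rewrite -[LHS]/(_ *m _).
apply/row_matrixP => a; rewrite row_mul !rowE delta_fun_mx delta_fun_mx.
by rewrite delta_fun_mx.
Qed.

Lemma eq_fun_mx f g : f =1 g -> fun_mx f = fun_mx g.
Proof. by move=> fg; apply/matrixP => a b; rewrite !mxE fg. Qed.

Lemma scalar_family (c : nat -> F) : (forall i, c i * c i = c i) ->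
  hecke_family (fun i => (c i)%:M : 'M[F]_d).
Proof.
move=> cc; have E a b : a%:M * b%:M = (a * b)%:M :> 'M[F]_d by rewrite scalar_mxM.
split=> [i|i j _|i j _]; rewrite !E ?cc //.
  by congr _%:M; rewrite mulrAC cc [RHS]mulrAC cc mulrC.
by rewrite mulrC.
Qed.

End FunctionMatrix.

Section HeckeAlgebra.
Variables (F : fieldType) (A : algType F) (J : pred nat) (p : nat -> A).
Hypothesis hA : hecke_algebra J p.

Let hp : hecke_family p := alg_fam hA.

(** The target comes with its scalar action as a bare function [s], which covers matrix rings and
    the field itself by one statement. *)
Lemma alg_eq (B : pzRingType) (f g : A -> B) (s : F -> B -> B) :
  (forall k x y, f (k *: x + y) = s k (f x) + f y) ->
  (forall k x y, g (k *: x + y) = s k (g x) + g y) ->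
  (forall x y, f (x * y) = f x * f y) -> (forall x y, g (x * y) = g x * g y) ->
  f 1 = g 1 -> (forall i, J i -> f (p i) = g (p i)) -> f =1 g.
Proof.
move=> fL gL fM gM fg1 fgp.
by apply: (alg_gen hA) => [|k x y ex ey|x y ex ey|]; rewrite ?fL ?gL ?fM ?gM ?ex ?ey.
Qed.

(** Affine dependence of [p] on [q] allows both [q = p] and [q = 1 - p]. The induction runs over all
    predicates [S] at once: for a product, the first factor is replaced by words with the second one
    fixed, then the second. *)
Lemma alg_span_word (q : nat -> A) (S : A -> Prop) :
  (forall i, J i -> exists c d : F, p i = c *: q i + d *: 1) ->
  S 0 -> (forall (k : F) x y, S x -> S y -> S (k *: x + y)) ->
  (forall u, all J u -> S (pword q u)) -> forall a, S a.
Proof.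
move=> pq S0 SL Sw a; move: a S S0 SL Sw.
apply: (alg_gen hA) => [S _ _ Sw|k x y hx hy S S0 SL Sw|x y hx hy S S0 SL Sw|i Ji S S0 SL Sw].
- by have := Sw [::] isT; rewrite /pword big_nil.
- by apply: (SL); [exact: (hx S)|exact: (hy S)].
- apply: (hx (fun x => S (x * y))) => [|k x1 x2 S1 S2|u Ju]; rewrite ?mul0r //.
    by rewrite mulrDl -scalerAl; exact: SL.
  apply: (hy (fun y => S (pword q u * y))) => [|k x1 x2 S1 S2|v Jv]; rewrite ?mulr0 //.
    by rewrite mulrDr -scalerAr; exact: SL.
  by rewrite -pword_cat; apply: Sw; rewrite all_cat Ju.
- have [c [d ->]] := pq i Ji; apply: (SL).
    by have := Sw [:: i]; rewrite /= Ji /pword big_seq1; exact.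
  rewrite -[X in S X]addr0; apply: SL => //.
  by have := Sw [::] isT; rewrite /pword big_nil.
Qed.

Section Characters.
Variable I : pred nat.

(** On a letter of [I] the value 0 of [p i] means that pi_i - 1 acts by -1: this is the simple
    module with descent set [I]. *)
Lemma char_subproof : exists rho : {lrmorphism A -> 'M[F]_1},
  forall i, rho (p i) = (~~ (J i && I i))%:R%:M.
Proof.
apply: (alg_univ hA); last by move=> i /negPf->.
by apply: scalar_family => i; case: (_ && _); rewrite ?mulr0 ?mulr1.
Qed.

Definition char_rep : {lrmorphism A -> 'M[F]_1} := sval (cid char_subproof).

Definition char (a : A) : F := char_rep a 0 0.

Lemma char_repE a : char_rep a = (char a)%:M.
Proof. by apply/matrixP => i j; rewrite !ord1 !mxE eqxx mulr1n. Qed.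

Lemma charM a b : char (a * b) = char a * char b.
Proof. by rewrite /char rmorphM /= mxE big_ord1. Qed.

Lemma char1 : char 1 = 1.
Proof. by rewrite /char rmorph1 /= mxE. Qed.

Lemma charL k a b : char (k *: a + b) = k * char a + char b.
Proof. by rewrite /char linearP !mxE. Qed.

Lemma charp i : char (p i) = (~~ (J i && I i))%:R.
Proof. by rewrite /char (svalP (cid char_subproof)) mxE eqxx mulr1n. Qed.

Lemma charB a b : char (a - b) = char a - char b.
Proof. by rewrite -[- b]scaleN1r addrC charL mulN1r addrC. Qed.

Lemma char_pword (q : nat -> A) (u : seq nat) :
  {in u, forall i, char (q i) = 1} -> char (pword q u) = 1.
Proof.
elim: u => [|i u IH] h; first by rewrite /pword big_nil char1.
rewrite /pword big_cons charM h ?mem_head // mul1r; apply: IH => j ju.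
by apply: h; rewrite inE ju orbT.
Qed.

Lemma char_semilinear (V : lmodType F) (f : A -> V) :
  (forall k x y, f (k *: x + y) = k *: f x + f y) ->
  (forall i b, J i -> f (p i * b) = char (p i) *: f b) ->
  forall a b, f (a * b) = char a *: f b.
Proof.
move=> fL fp; apply: (alg_gen hA) => [b|k x y hx hy b|x y hx hy b|i Ji b].
- by rewrite char1 scale1r mul1r.
- by rewrite mulrDl -scalerAl fL hx hy charL scalerDl scalerA.
- by rewrite -mulrA hx hy charM scalerA.
- exact: fp.
Qed.

End Characters.

Section States.
Variables (N : nat) (N_gt1 : (1 < N)%N).
Hypothesis J_bound : forall i, J i -> (i < N)%N.
Local Notation par := (par_state N_gt1 J).
Local Notation X := (state N).

Lemma alg_span_state (q : nat -> A) (S : A -> Prop) : hecke_family q ->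
  (forall i, J i -> exists c d : F, p i = c *: q i + d *: 1) ->
  S 0 -> (forall (k : F) x y, S x -> S y -> S (k *: x + y)) ->
  (forall x, par x -> S (pstate q N_gt1 J x)) -> forall a, S a.
Proof.
move=> hq pq S0 SL Sx; apply: (alg_span_word pq) => // u Ju.
rewrite -[pword q u]mul1r -(pstate1 q N_gt1 J) pstate_pword ?par_state1 //.
by apply: Sx; apply: par_demazure_word => //; exact: par_state1.
Qed.

(** The regular representation, by [demazure] on all states; it is what proves the [pstate x]
    linearly independent. *)
Definition reg_gen (i : nat) : 'M[F]_#|{: X}| := if J i
  then fun_mx F (fun a => enum_rank (demazure N_gt1 (enum_val a) i)) else 1.

Lemma reg_family : hecke_family reg_gen.
Proof.
have e x : enum_val (enum_rank x) = x :> X by rewrite enum_rankK.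
split=> [i|i j eij|i j eij]; rewrite /reg_gen.
- case: ifP => Ji; rewrite ?mulr1 // fun_mxM; apply: eq_fun_mx => a /=.
  by rewrite !e demazure_idem ?J_bound.
- case: ifP => Ji; case: ifP => Jj; rewrite ?mulr1 ?mul1r //.
  + rewrite !fun_mxM; apply: eq_fun_mx => a /=.
    by rewrite !e demazure_braid ?J_bound.
  + by rewrite fun_mxM; apply: eq_fun_mx => a /=; rewrite !e demazure_idem ?J_bound.
  + by rewrite fun_mxM; apply: eq_fun_mx => a /=; rewrite !e demazure_idem ?J_bound.
- case: ifP => Ji; case: ifP => Jj; rewrite ?mulr1 ?mul1r //.
  rewrite !fun_mxM; apply: eq_fun_mx => a /=.
  by rewrite !e demazure_comm ?J_bound.
Qed.

Lemma reg_subproof : exists rho : {lrmorphism A -> 'M[F]_#|{: X}|},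
  forall i, rho (p i) = reg_gen i.
Proof.
by apply: (alg_univ hA reg_family) => i /negPf; rewrite /reg_gen => ->.
Qed.

Definition reg_rep := sval (cid reg_subproof).

Lemma reg_repE i : reg_rep (p i) = reg_gen i.
Proof. exact: (svalP (cid reg_subproof)). Qed.

(* The coordinates of [a] in the basis of the [pstate x]. *)
Definition coords (a : A) : 'rV[F]_#|{: X}| := row (enum_rank (sid N)) (reg_rep a).

Lemma coordsL k a b : coords (k *: a + b) = k *: coords a + coords b.
Proof. by rewrite /coords !linearP. Qed.

Lemma coords0 : coords 0 = 0.
Proof. by rewrite /coords !linear0. Qed.

Lemma coords_pword u : all J u ->
  coords (pword p u) = delta_mx 0 (enum_rank (demazure_word N_gt1 (sid N) u)).
Proof.
elim/last_ind: u => [|u i IH]; first by rewrite /coords /pword big_nil rmorph1 rowE mulmx1.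
rewrite all_rcons => /andP[Ji Ju]; rewrite pword_rcons /coords rmorphM /= row_mul.
rewrite -/(coords _) IH // reg_repE /reg_gen Ji.
by rewrite delta_fun_mx enum_rankK /demazure_word foldl_rcons.
Qed.

Lemma coords_pstate x : par x -> coords (pstate p N_gt1 J x) = delta_mx 0 (enum_rank x).
Proof.
case/par_wordP => Ju ru e; rewrite coords_pword // demazure_word_reduced ?e //.
exact: (bounded_par J_bound Ju).
Qed.

Lemma pq_id i : J i -> exists c d : F, p i = c *: p i + d *: 1.
Proof. by exists 1, 0; rewrite scale1r scale0r addr0. Qed.

Lemma pq_compl i : J i -> exists c d : F, p i = c *: (1 - p i) + d *: 1.
Proof. by exists (-1), 1; rewrite scaleN1r scale1r opprB subrK. Qed.

Lemma coordsE a : a = \sum_(x | par x) coords a 0 (enum_rank x) *: pstate p N_gt1 J x.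
Proof.
move: a; apply: (alg_span_state hp pq_id) => [|k a b ha hb|x Px].
- by rewrite coords0 big1 // => x _; rewrite mxE scale0r.
- rewrite coordsL {1}ha {1}hb scaler_sumr -big_split /=; apply: eq_bigr => x _.
  by rewrite !mxE scalerDl scalerA.
- rewrite coords_pstate // (bigD1 x) //= mxE !eqxx scale1r big1 ?addr0 // => y /andP[_ yx].
  by rewrite mxE eqxx /= (inj_eq enum_rank_inj) (negPf yx) scale0r.
Qed.

Lemma coords_inj a b : coords a = coords b -> a = b.
Proof. by move=> e; rewrite (coordsE a) (coordsE b) e. Qed.

Lemma coords_par a x : ~~ par x -> coords a 0 (enum_rank x) = 0.
Proof.
move=> Px; move: a; apply: (alg_span_state hp pq_id) => [|k a b ha hb|y Py].
- by rewrite coords0 mxE.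
- by rewrite coordsL [LHS]mxE [X in X + _]mxE ha hb mulr0 addr0.
- rewrite coords_pstate // mxE eqxx (inj_eq enum_rank_inj) /=.
  by case: eqP Px => // ->; rewrite Py.
Qed.

End States.
End HeckeAlgebra.

(** * Projective indecomposables as left ideals *)

Section Idempotents.
Variables (F : fieldType) (A : algType F) (J : pred nat) (p : nat -> A).
Hypothesis hA : hecke_algebra J p.
Variables (N : nat) (N_gt1 : (1 < N)%N).
Hypothesis J_bound : forall i, J i -> (i < N)%N.
Local Notation par := (par_state N_gt1 J).
Local Notation X := (state N).
Local Notation d := #|{: X}|.
Local Notation q := (fun i => 1 - p i).
Local Notation coords := (coords hA N_gt1 J_bound).

Let hp : hecke_family p := alg_fam hA.
Let hq : hecke_family q := family_compl hp.

Lemma bound_in (I : pred nat) i : J i && I i -> (i < N)%N.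
Proof. by case/andP => /J_bound. Qed.
Lemma bound_out (I : pred nat) i : J i && ~~ I i -> (i < N)%N.
Proof. by case/andP => /J_bound. Qed.

Definition word_in I := longest N_gt1 (@bound_in I).
Definition word_out I := longest N_gt1 (@bound_out I).
Definition elt_in I := pword q (word_in I).
Definition elt_out I := pword p (word_out I).
(** Up to sign the generator of the projective module with descent set [I]: each factor [1 - p i] is
    the negative of pi_i - 1. *)
Definition pim_elt I := elt_in I * elt_out I.

(** Each of the two elements absorbs the letters of the other, one from the left and one from the
    right, so both equal their product. *)
Lemma elt_out_unique (I I' : pred nat) :
  (forall i, J i -> I i = I' i) -> elt_out I = elt_out I'.
Proof.
move=> II; have [a _ _ _] := longestP N_gt1 (@bound_out I).
have [a' _ _ _] := longestP N_gt1 (@bound_out I').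
rewrite -/(word_out I) in a; rewrite -/(word_out I') in a'.
have E : elt_out I * elt_out I' = elt_out I'.
  rewrite /elt_out; elim: (word_out I) a => [|i u IH] /=.
    by rewrite [pword _ [::]]/pword big_nil mul1r.
  case/andP => /andP[Ji Ii] /IH e; rewrite -cat1s pword_cat -mulrA e.
  by rewrite [pword _ [:: _]]/pword big_seq1 longestMl // Ji -II.
have E' : elt_out I * elt_out I' = elt_out I.
  rewrite {2}/elt_out; elim/last_ind: (word_out I') a' => [|u i IH] /=.
    by rewrite [pword _ [::]]/pword big_nil mulr1.
  rewrite all_rcons => /andP[/andP[Ji Ii]] /IH e; rewrite pword_rcons mulrA e.
  by rewrite /elt_out longestMr // Ji II.
by rewrite -E E'.
Qed.

Definition has_descents (x : X) (I : pred nat) : bool :=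
  [forall i : 'I_N, J i ==> ((root x i < 0) == I i)].

Lemma has_descentsP x I :
  reflect (forall i, J i -> (root x i < 0) = I i) (has_descents x I).
Proof.
apply: (iffP forallP) => [h i Ji|h i]; last by apply/implyP => /h/eqP.
by have := h (Ordinal (J_bound Ji)); rewrite /= Ji => /eqP.
Qed.

Definition descents_of (x : X) : pred nat := fun i => root x i < 0.

Lemma has_descents_of x : has_descents x (descents_of x).
Proof. exact/has_descentsP. Qed.

Local Notation qstate x := (pstate q N_gt1 J x).

Lemma qstateMq x i : par x -> J i -> root x i < 0 -> qstate x * q i = qstate x.
Proof. by move=> Px Ji xi; rewrite (pstate_demazure hq J_bound Px Ji) /demazure xi. Qed.

Lemma qstate_in x I : par x -> has_descents x I -> qstate x * elt_in I = qstate x.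
Proof.
move=> Px /has_descentsP xI; have [a _ _ _] := longestP N_gt1 (@bound_in I).
rewrite /elt_in /word_in; elim: (longest _ _) a => [|i u IH] /=.
  by rewrite [pword _ [::]]/pword big_nil mulr1.
case/andP => /andP[Ji Ii] /IH e; rewrite -cat1s pword_cat mulrA.
by rewrite [pword _ [:: i]]/pword big_seq1 qstateMq // xI.
Qed.

(** The product of [qstate x] and [elt_in I] is some [qstate y] for which all of [I] are descents.
    If y has a further descent i, a factor [1 - p i] can be split off on the right, and it kills
    [elt_out I] because [p i] is absorbed there. *)
Lemma pim_span (I : pred nat) (S : A -> Prop) : S 0 ->
  (forall (k : F) x y, S x -> S y -> S (k *: x + y)) ->
  (forall x, par x -> has_descents x I -> S (qstate x * elt_out I)) ->
  forall a, S (a * pim_elt I).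
Proof.
move=> S0 SL Sx.
apply: (alg_span_state hA (q := q) (S := fun a => S (a * pim_elt I)) J_bound hq
  (pq_compl p)) => [|k a b Sa Sb|x Px].
- by rewrite mul0r.
- by rewrite mulrDl -scalerAl; exact: SL.
have [a _ _ _] := longestP N_gt1 (@bound_in I); rewrite -/(word_in I) in a.
have aJ : all J (word_in I) by apply: sub_all a => i /andP[].
rewrite mulrA /elt_in pstate_pword //.
set y := demazure_word _ _ _; have Py : par y by exact: par_demazure_word.
have yI i : J i -> I i -> root y i < 0.
  move=> Ji Ii; have iN := J_bound Ji.
  have [|t ut] := longest_rcons N_gt1 (@bound_in I) (i := i); first by rewrite Ji.
  rewrite /y (demazure_word_braid N_gt1 _ (bounded_par J_bound aJ) ut).
  by rewrite /demazure_word foldl_rcons demazure_root.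
have [yD|] := boolP (has_descents y I); first exact: Sx.
case/forallPn => i; rewrite negb_imply => /andP[Ji ne].
have Ii : ~~ I i by apply: contra ne => Ii; rewrite yI.
have yi : root y i < 0 by move: ne; rewrite (negPf Ii); case: (root y i < 0).
rewrite -(qstateMq Py Ji yi) -mulrA mulrBl mul1r.
by rewrite longestMl ?Ji // subrr mulr0.
Qed.

(** One element for each group element: those with descent set [I] span the left ideal of
    [pim_elt I], and all together will form a basis of the algebra. *)
Definition pim_basis (x : X) : A := qstate x * elt_out (descents_of x).

Lemma pim_basisE x I : has_descents x I -> pim_basis x = qstate x * elt_out I.
Proof. by move/has_descentsP => xI; congr (_ * _); exact: elt_out_unique. Qed.

Lemma pim_basis_mem x I : par x -> has_descents x I ->
  pim_basis x = qstate x * pim_elt I.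
Proof. by move=> Px xI; rewrite mulrA qstate_in // (pim_basisE xI). Qed.

Lemma char_pim I : char hA I (pim_elt I) = 1.
Proof.
have [a _ _ _] := longestP N_gt1 (@bound_in I).
have [b _ _ _] := longestP N_gt1 (@bound_out I).
rewrite charM !char_pword ?mulr1 // => i.
  by move/(allP b) => /andP[Ji Ii]; rewrite charp Ji (negPf Ii).
by move/(allP a) => /andP[Ji Ii]; rewrite charB char1 charp Ji Ii subr0.
Qed.

Lemma char_pim0 I K i : J i -> I i != K i -> char hA K (pim_elt I) = 0.
Proof.
move=> Ji; rewrite charM; case Ii: (I i); case Ki: (K i) => // _.
  have : elt_in I * q i = elt_in I by apply: longestMr; rewrite ?Ji ?Ii.
  by move/(congr1 (char hA K)); rewrite charM charB char1 charp Ji Ki subrr mulr0 => <-; rewrite mul0r.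
have : p i * elt_out I = elt_out I by apply: longestMl; rewrite ?Ji ?Ii.
by move/(congr1 (char hA K)); rewrite charM charp Ji Ki mul0r => <-; rewrite mulr0.
Qed.

(* The left ideals generated by the [pim_elt I] add up to the whole algebra: an
   eigenvector among the functionals vanishing on them would be a character. *)
Lemma pim_basis_total (c : 'cV[F]_d) :
  (forall x, par x -> coords (pim_basis x) *m c = 0) ->
  forall x, par x -> c (enum_rank x) 0 = 0.
Proof.
move=> hc x Px; pose l (a : A) := (coords a *m c) 0 0.
have lL k a b : l (k *: a + b) = k * l a + l b.
  by rewrite /l coordsL mulmxDl -scalemxAl !mxE.
have l0 I a : l (a * pim_elt I) = 0.
  apply: (pim_span (S := fun b => l b = 0)) a => [|k a b ea eb|y Py yI].
  - by rewrite /l coords0 mul0mx mxE.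
  - by rewrite lL ea eb mulr0 addr0.
  - by rewrite -(pim_basisE yI) /l hc // mxE.
apply/eqP/negPn/negP => cx.
have [|y [Py [b0 lb0] ymax]] := pstate_maximal hp N_gt1 J_bound
    (P := fun a => exists b, l (a * b) <> 0).
  exists (pstate p N_gt1 J x); rewrite mul1r /l coords_pstate // -rowE mxE.
  exact/eqP.
pose f b := l (pstate p N_gt1 J y * b) : F^o.
(* These are the letters that the maximal element does not absorb; by maximality [f] vanishes on
   their left multiples. *)
pose I i := ~~ `[< pstate p N_gt1 J y * p i = pstate p N_gt1 J y >].
have fL k a b : f (k *: a + b) = k *: f a + f b.
  by rewrite /f mulrDr -scalerAr lL.
have fp i b : J i -> f (p i * b) = char hA I (p i) *: f b.
  move=> Ji; rewrite charp Ji /I /=; case: asboolP => [e|ne] /=.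
    by rewrite scale1r /f mulrA e.
  rewrite scale0r /f mulrA; have [//|h] := ymax i Ji.
  by apply/eqP/negPn/negP => /eqP hl; apply: h; exists b.
have fE := char_semilinear fL fp.
have f1 : f 1 <> 0 by move=> f1; apply: lb0; rewrite -/(f b0) -[b0]mulr1 fE f1 scaler0.
(* By [fE] the functional takes the nonzero value [f 1] on [pim_elt I], where it has to vanish. *)
have := fE (pim_elt I) 1; rewrite mulr1 char_pim scale1r {1}/f l0 => /esym.
by [].
Qed.

(** Unit vectors fill the rows of the states outside the parabolic subgroup, which keeps the matrix
    square: the spanning property [pim_basis_total] then makes it invertible, so that the spanning
    vectors are independent. *)
Definition pim_mx : 'M[F]_d := \matrix_(r < d)
  (if par (enum_val r) then coords (pim_basis (enum_val r)) else delta_mx 0 r).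

Lemma row_pim_mx x : par x -> row (enum_rank x) pim_mx = coords (pim_basis x).
Proof. by move=> Px; rewrite rowK enum_rankK Px. Qed.

Lemma pim_mx_unit : pim_mx \in unitmx.
Proof.
rewrite -unitmx_tr -row_free_unit; apply: inj_row_free => v vW.
have Wv : pim_mx *m v^T = 0 by rewrite -[LHS]trmxK trmx_mul trmxK vW trmx0.
have hr r : row r pim_mx *m v^T = 0 by rewrite -row_mul Wv row0.
apply/rowP => r; rewrite mxE; have [Pr|Pr] := boolP (par (enum_val r)).
  have := @pim_basis_total v^T _ _ Pr; rewrite enum_valK mxE; apply=> x Px.
  by rewrite -row_pim_mx.
have := hr r; rewrite rowK (negPf Pr) -rowE => /matrixP/(_ 0 0).
by rewrite !mxE.
Qed.

Definition pim_coords (a : A) : 'rV[F]_d := coords a *m invmx pim_mx.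

Lemma pim_coordsL k a b : pim_coords (k *: a + b) = k *: pim_coords a + pim_coords b.
Proof. by rewrite /pim_coords coordsL mulmxDl scalemxAl. Qed.

Lemma pim_coordsLE k a b r :
  pim_coords (k *: a + b) 0 r = k * pim_coords a 0 r + pim_coords b 0 r.
Proof. by rewrite pim_coordsL mxE [X in X + _]mxE. Qed.

Lemma pim_coords0 : pim_coords 0 = 0.
Proof. by rewrite /pim_coords coords0 mul0mx. Qed.

Lemma pim_coords_inj a b : pim_coords a = pim_coords b -> a = b.
Proof.
move/(congr1 (mulmx^~ pim_mx)); rewrite !mulmxKV ?pim_mx_unit //.
exact: coords_inj.
Qed.

Lemma pim_coords_basis x : par x -> pim_coords (pim_basis x) = delta_mx 0 (enum_rank x).
Proof.
move=> Px; rewrite /pim_coords -row_pim_mx // -row_mul mulmxV ?pim_mx_unit //.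
by rewrite rowE mulmx1.
Qed.

Lemma pim_coords_basisE x y : par x ->
  pim_coords (pim_basis x) 0 (enum_rank y) = (y == x)%:R.
Proof. by move=> Px; rewrite pim_coords_basis // mxE eqxx (inj_eq enum_rank_inj). Qed.

Lemma pim_coords_sum (P : pred X) (c : X -> F) (v : X -> A) r :
  pim_coords (\sum_(x | P x) c x *: v x) 0 r = \sum_(x | P x) c x * pim_coords (v x) 0 r.
Proof.
elim/big_rec2: _ => [|x y1 y2 _ <-]; first by rewrite pim_coords0 mxE.
by rewrite pim_coordsLE.
Qed.

Lemma pim_coords_par a x : ~~ par x -> pim_coords a 0 (enum_rank x) = 0.
Proof.
move=> Px; have := coords_par hA J_bound a Px.
rewrite -[X in fun_of_matrix X](mulmxKV pim_mx_unit) -/(pim_coords a) mxE.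
have E r : pim_mx r (enum_rank x) = (r == enum_rank x)%:R.
  rewrite mxE; case: ifP => Pr; last by rewrite mxE eqxx eq_sym.
  rewrite (coords_par hA J_bound _ Px); case: eqP Px => // re.
  by rewrite re enum_rankK in Pr; rewrite Pr.
rewrite (bigD1 (enum_rank x)) //= E eqxx mulr1.
by rewrite big1 ?addr0 // => r rx; rewrite E (negPf rx) mulr0.
Qed.

Lemma pim_coordsE a :
  a = \sum_(x | par x) pim_coords a 0 (enum_rank x) *: pim_basis x.
Proof.
apply/pim_coords_inj/rowP => r; rewrite pim_coords_sum -[r]enum_valK.
have [Pr|Pr] := boolP (par (enum_val r)).
  rewrite (bigD1 (enum_val r)) //= pim_coords_basisE // eqxx mulr1 big1 ?addr0 //.
  by move=> x /andP[Px xr]; rewrite pim_coords_basisE // eq_sym (negPf xr) mulr0.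
rewrite pim_coords_par // big1 // => x Px; rewrite pim_coords_basisE //.
by case: eqP Pr => [->|]; rewrite ?Px // mulr0.
Qed.

Lemma pim_coords_mem a I x : ~~ has_descents x I ->
  pim_coords (a * pim_elt I) 0 (enum_rank x) = 0.
Proof.
move=> xI; pose S b := pim_coords b 0 (enum_rank x) = 0.
apply: (pim_span (S := S)) => [|k b c hb hc|y Py yI]; rewrite /S.
- by rewrite pim_coords0 mxE.
- by rewrite pim_coordsLE hb hc mulr0 addr0.
- rewrite -(pim_basisE yI) pim_coords_basisE //.
  by case: eqP xI => // ->; rewrite yI.
Qed.

(** The component of 1 in the left ideal of [pim_elt I], with respect to the decomposition of the
    algebra into these ideals. *)
Definition pim_idem (I : pred nat) : A :=
  \sum_(x | par x && has_descents x I) pim_coords 1 0 (enum_rank x) *: pim_basis x.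

Lemma pim_idem_mem I : exists a, pim_idem I = a * pim_elt I.
Proof.
exists (\sum_(x | par x && has_descents x I) pim_coords 1 0 (enum_rank x) *: qstate x).
rewrite mulr_suml; apply: eq_bigr => x /andP[Px xI].
by rewrite -scalerAl (pim_basis_mem Px xI).
Qed.

(* Follows from the directness of the sum of the left ideals [A * pim_elt I]. *)
Lemma pim_idem_unit I a : a * pim_elt I * pim_idem I = a * pim_elt I.
Proof.
set b := a * pim_elt I; apply/pim_coords_inj/rowP => r; rewrite -[r]enum_valK.
set s := enum_val r; have [sI|sI] := boolP (has_descents s I); last first.
  have [c ->] := pim_idem_mem I; rewrite mulrA !pim_coords_mem //.
have bE : b = \sum_(x | par x) pim_coords 1 0 (enum_rank x) *: (b * pim_basis x).
  rewrite -[LHS]mulr1 [X in b * X]pim_coordsE mulr_sumr.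
  by apply: eq_bigr => x _; rewrite -scalerAr.
rewrite [in RHS]bE /pim_idem mulr_sumr.
under eq_bigr do rewrite -scalerAr.
rewrite !pim_coords_sum [RHS](bigID (has_descents^~ I)) /= [X in _ = _ + X]big1 ?addr0 //.
move=> x /andP[Px xI]; rewrite (pim_basis_mem Px (has_descents_of x)) mulrA.
rewrite pim_coords_mem ?mulr0 //; apply: contra xI => /has_descentsP sx.
apply/has_descentsP => i Ji; rewrite -[LHS]/(descents_of x i) -sx //.
by move/has_descentsP: sI; apply.
Qed.

Lemma char_idem I : char hA I (pim_idem I) = 1.
Proof.
have := pim_idem_unit I 1; rewrite mul1r => /(congr1 (char hA I)).
by rewrite charM char_pim mul1r.
Qed.

Lemma char_idem0 I K i : J i -> I i != K i -> char hA K (pim_idem I) = 0.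
Proof.
move=> Ji ne; have [a ->] := pim_idem_mem I.
by rewrite charM (char_pim0 Ji ne) mulr0.
Qed.

End Idempotents.

(** * Additive maps, presentations and bases of abelian groups *)

Definition addm (U V : zmodType) (f : U -> V) := {morph f : x y / x + y}.

Section AdditiveMaps.
Variables (U V : zmodType) (f : U -> V).
Hypothesis fD : addm f.

Lemma addm0 : f 0 = 0.
Proof. by apply: (@addrI _ (f 0)); rewrite -fD !addr0. Qed.

Lemma addmN x : f (- x) = - f x.
Proof. by apply: (@addrI _ (f x)); rewrite -fD !subrr addm0. Qed.

Lemma addmB x y : f (x - y) = f x - f y.
Proof. by rewrite fD addmN. Qed.

Lemma addmMz x (n : int) : f (x *~ n) = f x *~ n.
Proof.
have fM (m : nat) : f (x *+ m) = f x *+ m.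
  by elim: m => [|m IH]; rewrite ?addm0 // !mulrS fD IH.
by case: n => n; rewrite -?pmulrn ?NegzE ?mulrNz -?pmulrn ?addmN fM.
Qed.

Lemma addm_sum I (r : seq I) (P : pred I) (F : I -> U) :
  f (\sum_(i <- r | P i) F i) = \sum_(i <- r | P i) f (F i).
Proof. exact: (big_morph f fD addm0). Qed.

End AdditiveMaps.

Lemma addm_morphB (U V : zmodType) (f : U -> V) : {morph f : x y / x - y} -> addm f.
Proof.
move=> fB x y; have f0 : f 0 = 0 by rewrite -(subrr 0) fB subrr.
have fN z : f (- z) = - f z by rewrite -[LHS](congr1 f (sub0r z)) fB f0 sub0r.
by rewrite -[in LHS](opprK y) fB fN opprK.
Qed.

Lemma addm_id (U : zmodType) : addm (id : U -> U).
Proof. by []. Qed.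

Lemma addm_comp (U V W : zmodType) (f : V -> W) (g : U -> V) :
  addm f -> addm g -> addm (fun x => f (g x)).
Proof. by move=> fD gD x y; rewrite gD fD. Qed.

Lemma addm_add (U V : zmodType) (f g : U -> V) :
  addm f -> addm g -> addm (fun x => f x + g x).
Proof. by move=> fD gD x y; rewrite fD gD addrACA. Qed.

Lemma addm_bigsum (U V : zmodType) (I : Type) (r : seq I) (f : I -> U -> V) :
  (forall i, addm (f i)) -> addm (fun x => \sum_(i <- r) f i x).
Proof. by move=> fD x y; rewrite -big_split; apply: eq_bigr => i _; exact: fD. Qed.

Lemma freegU_intr (K : choiceType) (n : int) (k : K) :
  << n *g k >> = << k >> *~ n :> {freeg K}.
Proof. by rewrite freegU_mulz intz. Qed.

Lemma freeg_zind (K : choiceType) (P : {freeg K} -> Prop) : P 0 ->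
  (forall x y, P x -> P y -> P (x - y)) -> (forall k, P << k >>) -> forall x, P x.
Proof.
move=> P0 PB Pk x; have PN y : P y -> P (- y) by move=> Py; rewrite -sub0r; exact: PB.
have PD y z : P y -> P z -> P (y + z) by move=> Py /PN Pz; rewrite -[z]opprK; exact: PB.
have PM (m : nat) k : P (<< k >> *+ m) by elim: m => [|m IH]; rewrite ?mulr0n // mulrS; exact: PD.
rewrite -[x]freeg_sumE; elim/big_ind: _ => // k _; rewrite freegU_intr.
by case: (coeff k x) => n; rewrite -?pmulrn ?NegzE ?mulrNz -?pmulrn; [|apply: PN].
Qed.

Section Presentations.
Variables (K : choiceType) (S : set {freeg K}).

Lemma presZ_ind (P : presZ S -> Prop) : P 0 ->
  (forall x y, P x -> P y -> P (x - y)) -> (forall k, P (presZ_gen S k)) -> forall x, P x.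
Proof.
move=> P0 PB Pk x; rewrite -[x](@reprK _ (Quotient.quot (zspan S))).
apply: (freeg_zind (P := fun r => P (\pi_(Quotient.quot (zspan S)) r))).
- by rewrite (_ : \pi_(_) 0 = 0 :> presZ S) // raddf0.
- move=> r s Pr Ps; rewrite (_ : \pi_(_) (r - s) = \pi_(Quotient.quot (zspan S)) r
    - \pi_(Quotient.quot (zspan S)) s :> presZ S); first exact: PB.
  by rewrite raddfB.
- exact: Pk.
Qed.

Lemma presZ_eq (W : zmodType) (f g : presZ S -> W) : addm f -> addm g ->
  (forall k, f (presZ_gen S k) = g (presZ_gen S k)) -> forall x, f x = g x.
Proof.
move=> fD gD fg; apply: (presZ_ind (P := fun x => f x = g x)) => [|x y ex ey|k]; last exact: fg.
  by rewrite !addm0.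
by rewrite !addmB // ex ey.
Qed.

Lemma presZ_relP (a b c : K) : S (<< a >> - << b >> - << c >>) ->
  presZ_gen S a = presZ_gen S b + presZ_gen S c.
Proof.
move=> Sr; apply/eqP; rewrite -subr_eq0 opprD addrA; apply/eqP.
have -> : presZ_gen S a - presZ_gen S b - presZ_gen S c =
    \pi_(Quotient.quot (zspan S)) (<< a >> - << b >> - << c >>) :> presZ S.
  by rewrite !raddfB.
have -> : 0 = \pi_(Quotient.quot (zspan S)) 0 :> presZ S by rewrite raddf0.
by apply/eqP; rewrite -Quotient.idealrBE subr0; exact: zspan_gen.
Qed.

End Presentations.

Section TensorLemmas.
Variables (U V : zmodType).
Implicit Types (u : U) (v : V).

Lemma pureDl u u' v : pure (u + u') v = pure u v + pure u' v.
Proof. by apply: presZ_relP; exact: btensor_relDl. Qed.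

Lemma pureDr u v v' : pure u (v + v') = pure u v + pure u v'.
Proof. by apply: presZ_relP; exact: btensor_relDr. Qed.

Lemma pure_bi : biadditive (@pure U V).
Proof. by split=> [u v v'|v u u']; [exact: pureDr|exact: pureDl]. Qed.

Lemma tensor_eq (W : zmodType) (f g : tensor U V -> W) : addm f -> addm g ->
  (forall u v, f (pure u v) = g (pure u v)) -> forall x, f x = g x.
Proof. by move=> fD gD fg; apply: presZ_eq => // -[u v]; exact: fg. Qed.

Lemma tliftD (W : zmodType) (f : U -> V -> W) : biadditive f -> addm (tlift f).
Proof. by move=> fb; exact: (addm_morphB (tlift_additive fb)). Qed.

Lemma biaddl (W : zmodType) (f : U -> V -> W) v : biadditive f -> addm (f^~ v).
Proof. by case=> _ h; exact: h. Qed.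

Lemma biaddr (W : zmodType) (f : U -> V -> W) u : biadditive f -> addm (f u).
Proof. by case=> h _; exact: h. Qed.

End TensorLemmas.

Section TensorMaps.
Variables (U U' V V' : zmodType) (f : U -> U') (g : V -> V').
Hypotheses (fD : addm f) (gD : addm g).

Lemma tmap_bi : biadditive (fun u v => pure (f u) (g v)).
Proof. by split=> [u v v'|v u u']; rewrite ?fD ?gD ?pureDl ?pureDr. Qed.

Lemma tmap_pure u v : tmap f g (pure u v) = pure (f u) (g v).
Proof. exact: (tlift_pure tmap_bi). Qed.

Lemma tmapD : addm (tmap f g).
Proof. exact: (tliftD tmap_bi). Qed.

End TensorMaps.

Section TensorAssoc.
Variables (U V W : zmodType).

Let bi1 (w : W) : biadditive (fun (u : U) (v : V) => pure u (pure v w)).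
Proof. by split=> [u v v'|v u u']; rewrite ?pureDl ?pureDr. Qed.

Lemma tassoc_bi :
  biadditive (fun (t : tensor U V) (w : W) => tlift (fun (u : U) (v : V) => pure u (pure v w)) t).
Proof.
split=> [t w w'|w]; last exact: (tliftD (bi1 w)).
move: t; apply: tensor_eq; try exact: (tliftD (bi1 _)).
  by apply: addm_add; exact: (tliftD (bi1 _)).
by move=> u v; rewrite !(tlift_pure (bi1 _)) !pureDr.
Qed.

Lemma tassoc_pure (u : U) (v : V) (w : W) :
  tassoc (pure (pure u v) w) = pure u (pure v w).
Proof. by rewrite /tassoc (tlift_pure tassoc_bi) (tlift_pure (bi1 w)). Qed.

Lemma tassocD : addm (@tassoc U V W).
Proof. exact: (tliftD tassoc_bi). Qed.
End TensorAssoc.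

Section DirectSums.
Variable V : nat -> zmodType.

Lemma dsum_inD n : addm (dsum_in (V := V) (n := n)).
Proof. by move=> x y; apply: presZ_relP; exact: dsum_relD. Qed.

Lemma dsum_ind (P : dsum V -> Prop) : P 0 -> (forall x y, P x -> P y -> P (x - y)) ->
  (forall n (x : V n), P (dsum_in x)) -> forall x, P x.
Proof. by move=> P0 PB Px; apply: (presZ_ind (P := P)) => // -[n x]; exact: Px. Qed.

Definition dsum_lift (W : zmodType) (f : forall n, V n -> W) (x : dsum V) : W :=
  presZ_lift (fun t : {n & V n} => f (tag t) (tagged t)) x.

Variables (W : zmodType) (f : forall n, V n -> W).
Hypothesis fD : forall n, addm (@f n).

Let f_rel r : dsum_rel r ->
  fglift ((fun t : {n & V n} => f (tagged t)) : _ -> zmodule W) r = 0.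
Proof.
by case=> n x y; rewrite !lift_is_additive !liftU !scale1r /= fD -addrA -opprD subrr.
Qed.

Lemma dsum_liftE n (x : V n) : dsum_lift f (dsum_in x) = f x.
Proof. exact: (presZ_lift_gen f_rel). Qed.

Lemma dsum_liftD : addm (dsum_lift f).
Proof. exact/addm_morphB/(presZ_lift_additive f_rel). Qed.

End DirectSums.

(** Freeness in the form in which it is used: an induction principle and the existence of additive
    maps with prescribed values; uniqueness of these maps follows from the former. *)
Record zbasis (V : zmodType) (L : Type) (b : L -> V) : Prop := ZBasis {
  zb_gen : forall P : V -> Prop, P 0 -> (forall x y, P x -> P y -> P (x - y)) ->
    (forall l, P (b l)) -> forall x, P x;
  zb_ext : forall (W : zmodType) (f : L -> W),
    exists phi : V -> W, addm phi /\ forall l, phi (b l) = f l }.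

Section ZBasis.
Variables (V : zmodType) (L : Type) (b : L -> V).
Hypothesis hb : zbasis b.

Lemma zb_eq (W : zmodType) (f g : V -> W) : addm f -> addm g ->
  (forall l, f (b l) = g (b l)) -> forall x, f x = g x.
Proof.
move=> fD gD fg; apply: (zb_gen hb) => [|x y ex ey|l]; last exact: fg.
  by rewrite !addm0.
by rewrite !addmB // ex ey.
Qed.

Definition zlift (W : zmodType) (f : L -> W) : V -> W := sval (cid (zb_ext hb f)).

Lemma zliftD (W : zmodType) (f : L -> W) : addm (zlift f).
Proof. by have [h _] := svalP (cid (zb_ext hb f)); exact: h. Qed.

Lemma zliftE (W : zmodType) (f : L -> W) l : zlift f (b l) = f l.
Proof. by have [_ h] := svalP (cid (zb_ext hb f)); exact: h. Qed.

Lemma zlift_add (W : zmodType) (f g : L -> W) x :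
  zlift (fun l => f l + g l) x = zlift f x + zlift g x.
Proof.
move: x; apply: zb_eq; [exact: zliftD|apply: addm_add; exact: zliftD|].
by move=> l; rewrite !zliftE.
Qed.

End ZBasis.

Section ZBasis2.
Variables (U V W : zmodType) (L M : Type) (b : L -> U) (c : M -> V).
Hypotheses (hb : zbasis b) (hc : zbasis c).

Definition zlift2 (f : L -> M -> W) (u : U) (v : V) : W :=
  zlift hb (fun l => zlift hc (f l) v) u.

Lemma zlift2_bi f : biadditive (zlift2 f).
Proof.
split=> [u v v'|v]; last exact: zliftD.
by rewrite /zlift2 -zlift_add; congr (zlift hb _ u); apply/funext => l; exact: zliftD.
Qed.

Lemma zlift2E f l m : zlift2 f (b l) (c m) = f l m.
Proof. by rewrite /zlift2 !zliftE. Qed.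

Lemma biadd_eq (f g : U -> V -> W) : biadditive f -> biadditive g ->
  (forall l m, f (b l) (c m) = g (b l) (c m)) -> forall u v, f u v = g u v.
Proof.
move=> fb gb fg u v; move: u.
apply: (zb_eq hb); [exact: biaddl|exact: biaddl|move=> l].
by move: v; apply: (zb_eq hc); [exact: biaddr|exact: biaddr|].
Qed.

End ZBasis2.

Lemma fgliftD (W : zmodType) (L : choiceType) (f : L -> W) :
  addm (fglift (f : L -> zmodule W) : {freeg L} -> W).
Proof.
have fB : {morph fglift (f : L -> zmodule W) : x y / x - y}.
  exact: lift_is_additive.
exact: (addm_morphB fB).
Qed.

(** A unitriangular family of functionals forces independence: in a vanishing combination take a
    label k of minimal height; the functional [c k] sees no other label of the support, so it
    returns the coefficient of k. *)
Lemma zbasis_crit (V : zmodType) (L : choiceType) (b : L -> V)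
    (c : L -> V -> int) (ht : L -> nat) :
  (forall P : V -> Prop, P 0 -> (forall x y, P x -> P y -> P (x - y)) ->
    (forall l, P (b l)) -> forall x, P x) ->
  (forall l, addm (c l)) -> (forall l, c l (b l) = 1) ->
  (forall l k, c l (b k) != 0 -> k = l \/ (ht k < ht l)%N) -> zbasis b.
Proof.
move=> gen cD c1 ctri; split=> // W f.
pose phi : {freeg L} -> V := fglift (b : L -> zmodule V).
have phiD : addm phi := fgliftD b.
have phiU l : phi << l >> = b l by rewrite /phi liftU scale1r.
have phi_inj D : phi D = 0 -> D = 0.
  move=> phiD0; apply/eqP/negPn/negP; rewrite -dom_eq0 => D0.
  have [k kD kmin] : exists2 k, k \in dom D & forall l, l \in dom D -> (ht k <= ht l)%N.
    have ex : exists n, has (fun k => ht k == n) (dom D).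
      by case: (dom D) D0 => // k s _; exists (ht k); rewrite /= eqxx.
    case: (ex_minnP ex) => n /hasP[k kD /eqP kn] nmin; exists k => // l lD.
    by rewrite kn; apply: nmin; apply/hasP; exists l.
  have := congr1 (c k) phiD0; rewrite (addm0 (cD k)) -[D]freeg_sumE (addm_sum phiD).
  rewrite (addm_sum (cD k)) (bigD1_seq k) ?uniq_dom //= big1_seq => [|l /andP[lk lD]].
    rewrite addr0 freegU_intr !addmMz // phiU c1 -mulrzr mul1r intz => e.
    by move: kD; rewrite mem_dom e eqxx.
  rewrite freegU_intr !addmMz // phiU; case: (eqVneq (c k (b l)) 0) => [->|/ctri].
    by rewrite mul0rz.
  by case=> [e|lt]; [rewrite e eqxx in lk|have := kmin l lD; rewrite leqNgt lt].
have phi_surj x : exists D, phi D = x.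
  move: x; apply: gen => [|x y [D <-] [D' <-]|l]; first by exists 0; rewrite addm0.
    by exists (D - D'); rewrite addmB.
  by exists << l >>.
pose psi x : {freeg L} := sval (cid (phi_surj x)).
have psiK x : phi (psi x) = x := svalP (cid (phi_surj x)).
have phiI D D' : phi D = phi D' -> D = D'.
  by move=> e; apply/eqP; rewrite -subr_eq0; apply/eqP/phi_inj; rewrite addmB // e subrr.
exists (fun x => fglift (f : L -> zmodule W) (psi x)); split=> [x y|l].
  have -> : psi (x + y) = psi x + psi y by apply: phiI; rewrite phiD !psiK.
  exact: fgliftD.
have -> : psi (b l) = << l >> by apply: phiI; rewrite psiK phiU.
by rewrite liftU scale1r.
Qed.

(** * Finite-dimensional modules *)

Lemma mx_eq_col (R : pzRingType) m n (A B : 'M[R]_(m, n)) :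
  (forall j, A *m delta_mx j (0 : 'I_1) = B *m delta_mx j 0) -> A = B.
Proof.
by move=> h; apply/matrixP => i j; have /colP/(_ i) := h j; rewrite -!colE !mxE.
Qed.

(** Dimensions being bounded, there is a subspace of largest dimension inside [S]; a vector of [S]
    outside it would enlarge it. *)
Lemma vspace_pred (F : fieldType) (V : vectType F) (S : V -> Prop) : S 0 ->
  (forall k x y, S x -> S y -> S (k *: x + y)) ->
  exists U : {vspace V}, forall v, v \in U <-> S v.
Proof.
move=> S0 SL; pose Q n := `[< exists U : {vspace V}, \dim U = n /\ forall v, v \in U -> S v >].
have Q0 : exists n, Q n.
  by exists 0%N; apply/asboolP; exists 0%VS; rewrite dimv0; split=> // v; rewrite memv0 => /eqP->.
have Qle n : Q n -> (n <= dim V)%N.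
  by move/asboolP => [U [<- _]]; rewrite -dimvf dimvS ?subvf.
case: (ex_maxnP Q0 Qle) => n /asboolP[U [Un US]] nmax; exists U => v; split; first exact: US.
move=> Sv; apply/negPn/negP => vU.
have : Q (\dim (<[v]> + U)).
  apply/asboolP; exists (<[v]> + U)%VS; split=> // _ /memv_addP[_ /vlineP[k ->] [u uU ->]].
  by apply: SL => //; exact: US.
move/nmax; rewrite -Un leqNgt => /negP; apply.
rewrite (ltn_leqif (dimv_leqif_sup (addvSr _ _))) subv_add subvv andbT.
by rewrite -memvE.
Qed.

(** Rank and nullity relative to subspaces. With [g = 0] and a zero third space it also compares
    dimensions along an isomorphism. *)
Lemma exact_dim (F : fieldType) (V1 V2 V3 : vectType F) (f : 'Hom(V1, V2))
    (g : 'Hom(V2, V3)) (U1 : {vspace V1}) (U2 : {vspace V2}) (U3 : {vspace V3}) :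
  (forall u, u \in U1 -> f u \in U2 /\ g (f u) = 0) ->
  (forall u, u \in U1 -> f u = 0 -> u = 0) ->
  (forall u, u \in U2 -> g u \in U3) ->
  (forall w, w \in U3 -> exists2 u, u \in U2 & g u = w) ->
  (forall u, u \in U2 -> g u = 0 -> exists2 w, w \in U1 & f w = u) ->
  \dim U2 = (\dim U1 + \dim U3)%N.
Proof.
move=> fU finj gU gsurj ex; rewrite -(limg_ker_dim g U2); congr addn.
  rewrite (_ : (U2 :&: lker g)%VS = (f @: U1)%VS).
    apply: limg_dim_eq; apply/eqP; rewrite -subv0; apply/subvP => u.
    by rewrite memv_cap memv_ker memv0 => /andP[uU /eqP/finj->].
  apply/vspaceP => u; rewrite memv_cap memv_ker; apply/idP/idP.
    by case/andP => uU /eqP /ex [] // w wU <-; exact: memv_img.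
  by case/memv_imgP => w wU ->; have [-> ->] := fU w wU; rewrite eqxx.
congr (\dim _); apply/vspaceP => w; apply/idP/idP.
  by case/memv_imgP => u uU ->; exact: gU.
by case/gsurj => u uU <-; exact: memv_img.
Qed.

Section LRMorphisms.
Variables (F : fieldType) (A : algType F) (d : nat) (rho : A -> 'M[F]_d).
Hypothesis rhoL : forall k a b, rho (k *: a + b) = k *: rho a + rho b.
Hypothesis rho1 : rho 1 = 1.
Hypothesis rhoM : forall a b, rho (a * b) = rho a * rho b.

Lemma lrmorphism_mx : exists r : {lrmorphism A -> 'M[F]_d}, forall a, r a = rho a.
Proof.
have rho_mul : monoid_morphism rho by split.
pose mL := GRing.isLinear.Build F A 'M[F]_d *:%R rho rhoL.
pose mM := GRing.isMonoidMorphism.Build A 'M[F]_d rho rho_mul.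
pose r : {lrmorphism A -> 'M[F]_d} := HB.pack rho mL mM.
by exists r.
Qed.
End LRMorphisms.

Section Modules.
Variables (F : fieldType) (A : algType F).
Implicit Types (M N : rep A).

Lemma ract_alg M (k : F) : ract M k%:A = k%:M.
Proof. by rewrite linearZ rmorph1 /= scalemx1. Qed.

Lemma repmod_scaleE M (a : A) (v : repmod M) : a *: v = ract M a *m v.
Proof. by []. Qed.

Lemma repmod_alg M (k : F) (v : 'cV[F]_(rdim M)) : (k%:A : A) *: (v : repmod M) = k *: v.
Proof. by rewrite repmod_scaleE ract_alg mul_scalar_mx. Qed.

Definition hom_mx M N (X : 'M[F]_(rdim N, rdim M)) :=
  forall a, ract N a *m X = X *m ract M a.

Section MxLin.
Variables (M N : rep A) (X : 'M[F]_(rdim N, rdim M)).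
Hypothesis hX : hom_mx X.

Lemma mx_lin : exists f : {linear repmod M -> repmod N}, forall v, f v = X *m v.
Proof.
pose f (v : repmod M) : repmod N := X *m v.
have fL : linear f.
  move=> a u v; rewrite /f -[a *: u]/(ract M a *m u) mulmxDr mulmxA -hX -mulmxA.
  by [].
pose m := GRing.isLinear.Build A (repmod M) (repmod N) *:%R f fL.
pose g : {linear repmod M -> repmod N} := HB.pack f m.
by exists g.
Qed.
End MxLin.

Lemma lin_mx (M N : rep A) (f : {linear repmod M -> repmod N}) :
  exists2 X : 'M[F]_(rdim N, rdim M), hom_mx X & forall v, f v = X *m v.
Proof.
pose X : 'M[F]_(rdim N, rdim M) := \matrix_(i, j) f (delta_mx j 0 : 'cV_ _) i 0.
have fZ k (u : 'cV[F]_(rdim M)) : f (k *: u : 'cV_ _) = k *: (f u : 'cV_ _).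
  by rewrite -(repmod_alg (M := M)) -(repmod_alg (M := N)); exact: linearZ.
have fX (v : 'cV_(rdim M)) : f v = X *m v.
  have -> : f v = \sum_j v j 0 *: (f (delta_mx j 0 : 'cV_ _) : 'cV_ _).
    rewrite {1}[v]matrix_sum_delta -[LHS]/(f (\sum_i \sum_(j < 1) v i j *: delta_mx i j : repmod M)).
    by rewrite raddf_sum; apply: eq_bigr => i _; rewrite big_ord1; exact: fZ.
  by apply/colP => r; rewrite summxE mxE; apply: eq_bigr => i _; rewrite !mxE mulrC.
exists X => // a; apply: mx_eq_col => j; rewrite -!mulmxA -!fX.
by rewrite -[RHS]/(f (a *: ((delta_mx j 0 : 'cV_(rdim M)) : repmod M))) linearZ.
Qed.

(** An exact sequence with a splitting [Y], [W] over the field, where only [X] and [Z] commute with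
    the action. Exactness becomes a set of matrix equations, which tensoring with an identity matrix
    and restriction visibly preserve. *)
Definition split_exact_mx M' M M'' (X : 'M[F]_(rdim M, rdim M'))
    (Z : 'M[F]_(rdim M'', rdim M)) Y W :=
  [/\ hom_mx X, hom_mx Z, Y *m X = 1%:M, Z *m W = 1%:M & X *m Y + W *m Z = 1%:M].

Lemma split_exact0 M' M M'' X Z Y W : @split_exact_mx M' M M'' X Z Y W -> Z *m X = 0.
Proof.
case=> _ _ YX ZW e; have := congr1 (mulmx Z) e.
rewrite mulmxDr mulmx1 (mulmxA Z W) ZW mul1mx -[RHS]add0r => /addIr ZXY.
by rewrite -[X]mulmx1 -YX !mulmxA -(mulmxA Z X Y) ZXY mul0mx.
Qed.

Lemma short_exactP M' M M'' : short_exact M' M M'' <->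
  exists X Z Y W, @split_exact_mx M' M M'' X Z Y W.
Proof.
split=> [[f [g [finj gsurj ex]]]|[X [Z [Y [W h]]]]].
  have [X hX fX] := lin_mx f; have [Z hZ gZ] := lin_mx g.
  have Xfull : row_full X.
    rewrite /row_full -mxrank_tr -/(row_free X^T); apply: inj_row_free => v vX.
    have : f (v^T : 'cV_ _) = f 0.
      by rewrite linear0 fX -[LHS]trmxK trmx_mul trmxK vX trmx0.
    by move/finj/(congr1 trmx); rewrite trmxK trmx0.
  have Zfree : row_free Z.
    apply: inj_row_free => v vZ; apply/rowP => j.
    have [y] := gsurj (delta_mx j 0 : 'cV_(rdim M'')); rewrite gZ => e.
    have := congr1 (mulmx v) e; rewrite mulmxA vZ mul0mx -colE => /colP/(_ 0).
    by rewrite !mxE.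
  have [Y YX] : exists Y, Y *m X = 1%:M by exists (pinvmx X); exact: mulVpmx.
  have [W ZW] : exists W, Z *m W = 1%:M by exists (pinvmx Z); exact: mulmxVp.
  have ZX : Z *m X = 0.
    apply: mx_eq_col => j; rewrite -mulmxA -fX -gZ mul0mx.
    by apply/ex; exists (delta_mx j 0 : 'cV_ _).
  have XY V : Z *m V = 0 -> X *m (Y *m V) = V.
    move=> ZV; apply: mx_eq_col => j; rewrite -!mulmxA.
    have /ex[x] : g (V *m delta_mx j 0) = 0 by rewrite gZ mulmxA ZV mul0mx.
    by rewrite fX => <-; rewrite (mulmxA Y) YX mul1mx.
  (* The left inverse of [X] is corrected to vanish on the image of [W], as the last equation
     demands. *)
  exists X, Z, (Y *m (1%:M - W *m Z)), W; split=> //.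
    by rewrite -mulmxA mulmxBl mul1mx -mulmxA ZX mulmx0 subr0.
  by rewrite XY ?subrK // mulmxBr mulmx1 mulmxA ZW mul1mx subrr.
have ZX := split_exact0 h; have [hX hZ YX ZW e] := h.
have [f fX] := mx_lin hX; have [g gZ] := mx_lin hZ; exists f, g; split.
- by move=> u v; rewrite !fX => /(congr1 (mulmx Y)); rewrite !mulmxA YX !mul1mx.
- by move=> z; exists (W *m z); rewrite gZ mulmxA ZW mul1mx.
- move=> y; rewrite gZ; split=> [Zy|[x <-]].
    exists (Y *m y); rewrite fX mulmxA -[y in RHS]mul1mx -e mulmxDl.
    by rewrite -[W *m Z *m y]mulmxA Zy mulmx0 addr0.
  by rewrite fX mulmxA ZX mul0mx.
Qed.

Lemma hom_mxM M N P (Y : 'M_(rdim P, rdim N)) (X : 'M_(rdim N, rdim M)) :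
  hom_mx Y -> hom_mx X -> hom_mx (M := M) (N := P) (Y *m X).
Proof. by move=> hY hX a; rewrite mulmxA hY -!mulmxA hX. Qed.

Lemma hom_mx1 M : hom_mx (M := M) (N := M) 1%:M.
Proof. by move=> a; rewrite mulmx1 mul1mx. Qed.

Lemma hom_mxB M N (X Y : 'M_(rdim N, rdim M)) : hom_mx X -> hom_mx Y -> hom_mx (X - Y).
Proof. by move=> hX hY a; rewrite mulmxBr mulmxBl hX hY. Qed.

Lemma projective_mx P M N (Z : 'M_(rdim N, rdim M)) (W : 'M_(rdim M, rdim N))
    (f : 'M_(rdim N, rdim P)) :
  projective P -> hom_mx Z -> Z *m W = 1%:M -> hom_mx f ->
  exists2 h : 'M_(rdim M, rdim P), hom_mx h & Z *m h = f.
Proof.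
move=> prP hZ ZW hf; have [g gZ] := mx_lin hZ; have [f' fE] := mx_lin hf.
have [|h hE] := prP (repmod M) (repmod N) g f'.
  by move=> v; exists (W *m v); rewrite gZ mulmxA ZW mul1mx.
have [H hH HE] := lin_mx h; exists H => //; apply: mx_eq_col => j.
by rewrite -mulmxA -HE -gZ hE fE.
Qed.

Lemma hom_space_subproof M N : exists U : {vspace 'M[F]_(rdim N, rdim M)},
  forall X, X \in U <-> hom_mx X.
Proof.
apply: vspace_pred => [a|k X Y hX hY a]; first by rewrite mulmx0 mul0mx.
by rewrite mulmxDr mulmxDl -scalemxAl -scalemxAr hX hY.
Qed.

Definition hom_space M N := sval (cid (hom_space_subproof M N)).
Definition hdim M N : nat := \dim (hom_space M N).

Lemma hom_spaceP M N X : X \in hom_space M N <-> hom_mx X.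
Proof. exact: (svalP (cid (hom_space_subproof M N))). Qed.

Lemma hdimP M N : hom_dim M N (hdim M N).
Proof. by exists (hom_space M N) => // X; exact: hom_spaceP. Qed.

Lemma hdim_exact_r P M' M M'' : projective P -> short_exact M' M M'' ->
  hdim P M = (hdim P M' + hdim P M'')%N.
Proof.
move=> prP /short_exactP[X [Z [Y [W h]]]].
have ZX := split_exact0 h; have [hX hZ YX ZW e] := h.
apply: (exact_dim (f := linfun (mulmx X)) (g := linfun (mulmx Z))).
- move=> V /hom_spaceP hV; rewrite !lfunE /= mulmxA ZX mul0mx; split=> //.
  by apply/hom_spaceP; exact: hom_mxM.
- by move=> V _; rewrite lfunE /= => /(congr1 (mulmx Y)); rewrite mulmxA YX mul1mx mulmx0.
- by move=> V /hom_spaceP hV; rewrite lfunE; apply/hom_spaceP; exact: hom_mxM.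
- move=> V /hom_spaceP hV; have [H hH HE] := projective_mx prP hZ ZW hV.
  by exists H; [apply/hom_spaceP|rewrite lfunE].
- move=> V /hom_spaceP hV; rewrite lfunE /= => ZV.
  have XYV : X *m (Y *m V) = V.
    by rewrite mulmxA -[RHS]mul1mx -e mulmxDl -(mulmxA W) ZV mulmx0 addr0.
  exists (Y *m V); last by rewrite lfunE.
  apply/hom_spaceP => a; rewrite -[LHS]mul1mx -YX -!mulmxA (mulmxA X) -hX.
  by rewrite -(mulmxA _ X) XYV hV !mulmxA.
Qed.

Lemma projective_split M' M P X Z Y W : projective P -> @split_exact_mx M' M P X Z Y W ->
  exists s r, [/\ hom_mx s, hom_mx r, Z *m s = 1%:M, r *m X = 1%:M &
    X *m r + s *m Z = 1%:M :> 'M_(rdim M)].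
Proof.
move=> prP h; have ZX := split_exact0 h; have [hX hZ YX ZW e] := h.
have [s hs Zs] := projective_mx prP hZ ZW (@hom_mx1 P).
pose r := 1%:M - s *m Z; have hr : hom_mx r.
  by apply: hom_mxB; [exact: hom_mx1|exact: hom_mxM].
have Zr : Z *m r = 0 by rewrite /r mulmxBr mulmx1 mulmxA Zs mul1mx subrr.
have XYr : X *m (Y *m r) = r.
  by rewrite mulmxA -[RHS]mul1mx -e mulmxDl -(mulmxA W) Zr mulmx0 addr0.
exists s, (Y *m r); split=> //.
- move=> a; rewrite -[LHS]mul1mx -YX -!mulmxA (mulmxA X) -hX.
  by rewrite -(mulmxA _ X) XYr hr !mulmxA.
- by rewrite -mulmxA /r mulmxBl mul1mx -mulmxA ZX mulmx0 subr0.
- by rewrite XYr subrK.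
Qed.

(** A projective [P''] splits the sequence compatibly with the action, so Hom into any module is
    exact on it; this makes the pairing well defined on K_0. *)
Lemma hdim_exact_l P' P P'' M : projective P'' -> short_exact P' P P'' ->
  hdim P M = (hdim P' M + hdim P'' M)%N.
Proof.
move=> prP /short_exactP[X [Z [Y [W h]]]].
have ZX := split_exact0 h; have [hX hZ _ _ _] := h.
have [s [r [hs hr Zs rX e]]] := projective_split prP h.
rewrite addnC; apply: (exact_dim (f := linfun (mulmxr Z)) (g := linfun (mulmxr X))).
- move=> V /hom_spaceP hV; rewrite !lfunE /= -mulmxA ZX mulmx0; split=> //.
  by apply/hom_spaceP; exact: hom_mxM.
- by move=> V _; rewrite lfunE /= => /(congr1 (mulmx^~ s)); rewrite -mulmxA Zs mulmx1 mul0mx.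
- by move=> V /hom_spaceP hV; rewrite lfunE; apply/hom_spaceP; exact: hom_mxM.
- move=> V /hom_spaceP hV; exists (V *m r); first by apply/hom_spaceP; exact: hom_mxM.
  by rewrite lfunE /= -mulmxA rX mulmx1.
- move=> V /hom_spaceP hV; rewrite lfunE /= => VX; exists (V *m s).
    by apply/hom_spaceP; exact: hom_mxM.
  rewrite lfunE /= -[RHS]mulmx1 -e mulmxDr (mulmxA V X) VX mul0mx add0r mulmxA.
  by [].
Qed.

(** * Grothendieck groups and the pairing *)

Lemma G0_exact M' M M'' : short_exact M' M M'' ->
  G0_class M = G0_class M' + G0_class M''.
Proof. by move=> h; apply: presZ_relP; exact: groth_rel_exact. Qed.

Lemma K0_exact (P' P P'' : prep A) : short_exact P' P P'' ->
  K0_class P = K0_class P' + K0_class P''.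
Proof. by move=> h; apply: presZ_relP; exact: groth_rel_exact. Qed.

Lemma prepP (P : prep A) : projective P.
Proof. by case: P. Qed.

Section G0Lift.
Variables (W : zmodType) (f : rep A -> W).
Hypothesis f_exact : forall M' M M'', short_exact M' M M'' -> f M = f M' + f M''.

Let f_rel r : groth_rel (id : rep A -> rep A) r ->
  fglift (f : rep A -> zmodule W) r = 0.
Proof.
case=> M' M M'' /f_exact e; rewrite !lift_is_additive !liftU !scale1r e.
by rewrite -addrA -opprD subrr.
Qed.

Definition G0_lift (x : G0 A) : W := presZ_lift f x.

Lemma G0_liftE M : G0_lift (G0_class M) = f M.
Proof. exact: (presZ_lift_gen f_rel). Qed.

Lemma G0_liftD : addm G0_lift.
Proof. exact: (addm_morphB (presZ_lift_additive f_rel)). Qed.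
End G0Lift.

Section K0Lift.
Variables (W : zmodType) (f : prep A -> W).
Hypothesis f_exact : forall P' P P'' : prep A, short_exact P' P P'' ->
  f P = f P' + f P''.

Let f_rel r : groth_rel (@prep_rep F A) r -> fglift (f : prep A -> zmodule W) r = 0.
Proof.
case=> M' M M'' /f_exact e; rewrite !lift_is_additive !liftU !scale1r e.
by rewrite -addrA -opprD subrr.
Qed.

Definition K0_lift (x : K0 A) : W := presZ_lift f x.

Lemma K0_liftE P : K0_lift (K0_class P) = f P.
Proof. exact: (presZ_lift_gen f_rel). Qed.

Lemma K0_liftD : addm K0_lift.
Proof. exact: (addm_morphB (presZ_lift_additive f_rel)). Qed.
End K0Lift.

Definition G0_pair (P : prep A) (y : G0 A) : int := G0_lift (fun M => (hdim P M)%:Z) y.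

Lemma G0_pairE (P : prep A) M : G0_pair P (G0_class M) = (hdim P M)%:Z.
Proof. by apply: G0_liftE => M1 M2 M3 /(hdim_exact_r (@prepP P))->. Qed.

Lemma G0_pairD (P : prep A) : addm (G0_pair P).
Proof. by apply: G0_liftD => M1 M2 M3 /(hdim_exact_r (@prepP P))->. Qed.

Definition K0_pair (x : K0 A) (M : rep A) : int := K0_lift (fun P => (hdim P M)%:Z) x.

Lemma K0_pairE (P : prep A) M : K0_pair (K0_class P) M = (hdim P M)%:Z.
Proof. by apply: K0_liftE => M1 M2 M3 /(hdim_exact_l M (@prepP M3))->. Qed.

Lemma K0_pairD M : addm (K0_pair^~ M).
Proof. by apply: K0_liftD => M1 M2 M3 /(hdim_exact_l M (@prepP M3))->. Qed.

Lemma G0_ind (S : G0 A -> Prop) : S 0 -> (forall x y, S x -> S y -> S (x - y)) ->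
  (forall M, S (G0_class M)) -> forall x, S x.
Proof. by move=> S0 SB SM; apply: (presZ_ind (P := S)). Qed.

Lemma K0_ind (S : K0 A -> Prop) : S 0 -> (forall x y, S x -> S y -> S (x - y)) ->
  (forall P, S (K0_class P)) -> forall x, S x.
Proof. by move=> S0 SB SM; apply: (presZ_ind (P := S)). Qed.

(** * Submodules and finitely generated modules as matrix representations *)

(** The map [iota], injective on [S], bounds the dimension of [S]; preimages of a basis of its image
    serve as a basis of [S], in which the action is written. As [U] is given as a module over [A]
    only, scalars act through [k%:A]. *)
Lemma rep_of_sub (U : lmodType A) (S : U -> Prop) (d : nat) (iota : U -> 'rV[F]_d) :
  S 0 -> (forall x y, S x -> S y -> S (x + y)) -> (forall a x, S x -> S (a *: x)) ->
  (forall k x y, iota (k%:A *: x + y) = k *: iota x + iota y) ->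
  (forall x, S x -> iota x = 0 -> x = 0) ->
  exists (M : rep A) (f : {linear repmod M -> U}),
    injective f /\ forall u, S u <-> exists x, f x = u.
Proof.
move=> S0 SD SZ iL iinj.
have i0 : iota 0 = 0 by have := iL (-1) 0 0; rewrite scaler0 addr0 scaleN1r addNr.
have SB x y : S x -> S y -> S (x - y).
  by move=> Sx Sy; rewrite -[- y]scaleN1r; apply: (SD) => //; exact: SZ.
have iD x y : iota (x + y) = iota x + iota y by rewrite -[x in LHS]scale1r -(scale1r 1) iL scale1r.
have iZ k x : iota (k%:A *: x) = k *: iota x by rewrite -[X in iota X]addr0 iL i0 addr0.
have iN x : iota (- x) = - iota x by rewrite -scaleN1r -(scaleN1r (1 : A)) iZ scaleN1r.
have inj x y : S x -> S y -> iota x = iota y -> x = y.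
  move=> Sx Sy e; apply/eqP; rewrite -subr_eq0; apply/eqP/iinj; first exact: SB.
  by rewrite iD iN e subrr.
have [V VE] : exists V : {vspace 'rV[F]_d}, forall v, v \in V <-> exists2 x, S x & iota x = v.
  apply: vspace_pred => [|k _ _ [x Sx <-] [y Sy <-]]; first by exists 0.
  by exists (k%:A *: x + y); [apply: (SD) => //; exact: SZ|rewrite iL].
pose r := \dim V; pose b := vbasis V.
have bx (j : 'I_r) : exists2 x, S x & iota x = b`_j.
  by apply/VE; apply: vbasis_mem; rewrite mem_nth ?size_tuple.
pose x j : U := s2val (cid2 (bx j)).
have Sx j : S (x j) by rewrite /x; case: cid2.
have ix j : iota (x j) = b`_j by rewrite /x; case: cid2.
have i_sum (I : Type) (t : seq I) (c : I -> F) (y : I -> U) :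
    iota (\sum_(j <- t) (c j)%:A *: y j) = \sum_(j <- t) c j *: iota (y j).
  by elim/big_rec2: _ => [//|j u v _ <-]; rewrite iL.
have S_sum (I : Type) (t : seq I) (c : I -> A) (y : I -> U) : (forall j, S (y j)) ->
    S (\sum_(j <- t) c j *: y j).
  by move=> Sy; elim/big_ind: _ => // j _; exact: SZ.
pose f (v : 'cV[F]_r) : U := \sum_(j < r) (v j 0)%:A *: x j.
have Sf v : S (f v) by exact: S_sum.
have fi v : iota (f v) = \sum_(j < r) v j 0 *: b`_j.
  by rewrite i_sum; apply: eq_bigr => j _; rewrite ix.
have bfree := basis_free (vbasisP V).
have f_inj : injective f.
  move=> u v /(congr1 iota); rewrite !fi => e; apply/colP => j.
  by rewrite -(coord_sum_free (fun j => u j 0) j bfree) e coord_sum_free.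
have fV y : S y -> f (\col_j coord b j (iota y)) = y.
  move=> Sy; apply: inj => //; rewrite fi.
  under eq_bigr do rewrite mxE.
  by rewrite -(coord_vbasis (v := iota y)) //; apply/VE; exists y.
have fS y : S y -> exists v, f v = y by move/fV => e; eexists; exact: e.
pose rho (a : A) : 'M[F]_r := \matrix_(i, j) coord b i (iota (a *: x j)).
have fL k u v : f (k *: u + v) = k%:A *: f u + f v.
  rewrite /f scaler_sumr -big_split; apply: eq_bigr => j _ /=.
  by rewrite !mxE !scalerDl scalerA -[_%:A * _]scalerAl mul1r scalerA.
have fD u v : f (u + v) = f u + f v by rewrite -[u in LHS]scale1r fL !scale1r.
have f0 : f 0 = 0 by rewrite /f big1 // => j _; rewrite mxE !scale0r.
have f_mx (X : 'M_r) v : f (X *m v) = \sum_(j < r) (v j 0)%:A *: f (col j X).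
  have -> : X *m v = \sum_j v j 0 *: col j X.
    by apply/colP => i; rewrite !mxE summxE; apply: eq_bigr => j _; rewrite !mxE mulrC.
  elim/big_rec2: _ => [//|j u w _ <-]; by rewrite fL.
have fcol a j : f (col j (rho a)) = a *: x j.
  rewrite -[RHS]fV; last exact: SZ.
  by congr f; apply/colP => i; rewrite !mxE.
have algC (k : F) (a : A) (u : U) : a *: (k%:A *: u) = k%:A *: (a *: u).
  by rewrite !scalerA -scalerAr -scalerAl mulr1 mul1r.
have fact a v : f (rho a *m v) = a *: f v.
  by rewrite f_mx scaler_sumr; apply: eq_bigr => j _; rewrite fcol algC.
have mx_eq (X Y : 'M_r) : (forall v, f (X *m v) = f (Y *m v)) -> X = Y.
  by move=> e; apply: mx_eq_col => j; exact/f_inj/e.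
have rho_lin k a c : rho (k *: a + c) = k *: rho a + rho c.
  apply: mx_eq => v; rewrite fact mulmxDl -scalemxAl fL !fact scalerDl scalerA.
  by rewrite -scalerAl mul1r.
have rho1 : rho 1 = 1 by apply: mx_eq => v; rewrite fact scale1r mul1mx.
have rhoM a c : rho (a * c) = rho a * rho c.
  by apply: mx_eq => v; rewrite -[rho a * rho c]/(_ *m _) -mulmxA !fact scalerA.
have [R RE] := lrmorphism_mx rho_lin rho1 rhoM.
pose M := Rep R; have gL : linear (f : repmod M -> U).
  by move=> a u v; rewrite fD -[a *: u]/(R a *m u) RE fact.
pose m := GRing.isLinear.Build A (repmod M) U *:%R (f : repmod M -> U) gL.
pose g : {linear repmod M -> U} := HB.pack (f : repmod M -> U) m.
exists M, g; split; first exact: f_inj.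
by move=> u; split=> [/fS|[v <-]]; [|exact: Sf].
Qed.

Lemma kernel_exact M N (Z : 'M[F]_(rdim N, rdim M)) W : hom_mx Z -> Z *m W = 1%:M ->
  exists K, short_exact K M N.
Proof.
move=> hZ ZW; have [g gZ] := mx_lin hZ.
have [|||||K [f [finj fS]]] := @rep_of_sub (repmod M) (fun v => Z *m v = 0) _ trmx.
- by rewrite mulmx0.
- by move=> u v u0 v0; rewrite mulmxDr u0 v0 addr0.
- by move=> a v v0; rewrite repmod_scaleE mulmxA -hZ -mulmxA v0 mulmx0.
- by move=> k u v; rewrite repmod_alg linearP.
- by move=> u _ /(congr1 trmx); rewrite trmxK trmx0.
exists K, f, g; split=> // [z|y]; first by exists (W *m z); rewrite gZ mulmxA ZW mul1mx.
by rewrite gZ; exact: fS.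
Qed.

End Modules.

(** * Grothendieck groups of 0-Hecke algebras *)

Lemma zb_sep (V : zmodType) (L : choiceType) (b : L -> V) (c : L -> V -> int) :
  zbasis b -> (forall l, addm (c l)) -> (forall l k, c l (b k) = (k == l)%:R) ->
  forall x y, (forall l, c l x = c l y) -> x = y.
Proof.
move=> hb cD cb x y exy; pose psi := zlift hb (fun l => << l >> : {freeg L}).
have psiD : addm psi := zliftD _ _.
have psib l : psi (b l) = << l >> := zliftE _ _ _.
have cE l z : coeff l (psi z) = c l z.
  move: z; apply: (zb_eq hb) => // [u v|k]; first by rewrite psiD coeffD.
  by rewrite psib coeffU mul1r cb.
have recon z : fglift (b : L -> zmodule V) (psi z) = z.
  move: z; apply: (zb_eq hb) => // [u v|l].
    by rewrite psiD; exact: fgliftD.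
  by rewrite psib liftU scale1r.
have e : psi x = psi y by apply/eqP/freeg_eqP => l; rewrite !cE.
by rewrite -(recon x) -(recon y) e.
Qed.

Section RepLemmas.
Variables (F : fieldType) (A : algType F).

Lemma short_exact_dim (M' M M'' : rep A) : short_exact M' M M'' ->
  rdim M = (rdim M' + rdim M'')%N.
Proof.
case/short_exactP => X [Z [Y [W h]]]; have ZX := split_exact0 h.
have [_ _ YX ZW e] := h.
have dE n : \dim {:'cV[F]_n} = n by rewrite dimvf /dim /= muln1.
rewrite -[LHS]dE -(dE (rdim M')) -(dE (rdim M'')).
apply: (exact_dim (f := linfun (mulmx X)) (g := linfun (mulmx Z))).
- by move=> u _; rewrite memvf !lfunE /= mulmxA ZX mul0mx.
- by move=> u _; rewrite lfunE => /(congr1 (mulmx Y)); rewrite mulmxA YX mul1mx mulmx0.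
- by move=> u _; rewrite memvf.
- by move=> w _; exists (W *m w); rewrite ?memvf // lfunE /= mulmxA ZW mul1mx.
- move=> u _; rewrite lfunE /= => Zu; exists (Y *m u); rewrite ?memvf // lfunE /=.
  by rewrite mulmxA -[RHS]mul1mx -e mulmxDl -(mulmxA W) Zu mulmx0 addr0.
Qed.

(** The class of a zero module then satisfies [M] = [M] + [M], hence vanishes. *)
Lemma short_exact_rdim0 (M : rep A) : rdim M = 0%N -> short_exact M M M.
Proof.
move=> M0; apply/short_exactP; exists 1%:M, 1%:M, 1%:M, 1%:M.
have E (X Y : 'M[F]_(rdim M)) : X = Y.
  by apply/matrixP => i; have := ltn_ord i; rewrite [X in (_ < X)%N]M0.
by split; rewrite ?mulmx1 //; exact: hom_mx1.
Qed.

Lemma retract_projective (K P : rep A) (X : 'M[F]_(rdim P, rdim K)) r :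
  projective P -> hom_mx X -> hom_mx r -> r *m X = 1%:M -> projective K.
Proof.
move=> prP hX hr rX U V g f gsurj.
have [X' X'E] := mx_lin hX; have [r' r'E] := mx_lin hr.
have [h hE] := prP U V g (f \o r')%FUN gsurj.
by exists (h \o X')%FUN => x; rewrite /= hE /= r'E X'E mulmxA rX mul1mx.
Qed.

Lemma dim_hom_line (M N : rep A) (r : 'M[F]_(rdim N, rdim M)) : hom_mx r -> r != 0 ->
  (forall s : 'M[F]_(rdim N, rdim M), hom_mx s -> exists k, s = k *: r) -> hdim M N = 1%N.
Proof.
move=> hr r0 hs; rewrite /hdim (_ : hom_space M N = <[r]>%VS) ?dim_vline ?r0 //.
apply/vspaceP => s; apply/idP/idP => [/hom_spaceP/hs[k ->]|/vlineP[k ->]].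
  by rewrite memvZ ?memv_line.
by rewrite memvZ //; apply/hom_spaceP.
Qed.

Lemma dim_hom0 (M N : rep A) :
  (forall s : 'M[F]_(rdim N, rdim M), hom_mx s -> s = 0) -> hdim M N = 0%N.
Proof.
move=> h; apply/eqP; rewrite /hdim dimv_eq0 -subv0; apply/subvP => s.
by move=> /hom_spaceP/h->; rewrite mem0v.
Qed.

End RepLemmas.

(** Functions supported on [J] represent each subset of [J] exactly once, as labels of a basis
    must. *)
Record subset (J : pred nat) := Subset {
  subset_val :> nat -> bool; _ : `[< forall i, subset_val i -> J i >] }.
HB.instance Definition _ J := [isSub for @subset_val J].
HB.instance Definition _ J := [Choice of subset J by <:].

Lemma subsetP J (I : subset J) i : I i -> J i.
Proof. by case: I => I /= /asboolP h; exact: h. Qed.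

Lemma subset_neq J (I K : subset J) : I != K -> exists i, J i /\ I i != K i.
Proof.
move=> ne; have [i hi] : exists i, I i != K i.
  apply: contrapT => h; move/eqP: ne; apply; apply: val_inj; apply/funext => i.
  by apply/eqP/negPn/negP => hi; apply: h; exists i.
exists i; split=> //; case Ki: (K i); first exact: subsetP Ki.
case Ii: (I i); first exact: subsetP Ii.
by move: hi; rewrite Ki Ii eqxx.
Qed.

Lemma subset_trim_subproof (J : pred nat) (I : nat -> bool) :
  `[< forall i, J i && I i -> J i >].
Proof. by apply/asboolP => i /andP[]. Qed.
Definition subset_trim J I : subset J := Subset (@subset_trim_subproof J I).

Section HeckeGrothendieck.
Variables (F : fieldType) (A : algType F) (J : pred nat) (p : nat -> A).
Hypothesis hA : hecke_algebra J p.
Variables (N : nat) (N_gt1 : (1 < N)%N).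
Hypothesis J_bound : forall i, J i -> (i < N)%N.

Let hp : hecke_family p := alg_fam hA.

Definition simple (I : pred nat) : rep A := Rep (char_rep hA I).

Lemma simple_act I a : ract (simple I) a = (char hA I a)%:M.
Proof. exact: char_repE. Qed.

Lemma simple_hom M I (r : 'rV[F]_(rdim M)) :
  hom_mx (N := simple I) r <-> forall a, r *m ract M a = char hA I a *: r.
Proof.
split=> h a; first by rewrite -h /= char_repE mul_scalar_mx.
by rewrite /= char_repE mul_scalar_mx h.
Qed.

(** A row vector is a functional, and a nonzero common eigenrow is a surjection onto a simple
    module. The letters not absorbed by the maximal element [a] form its descent set. *)
Lemma eigen_row (M : rep A) (v : 'rV[F]_(rdim M)) : v != 0 ->
  exists (I : subset J) (a : A), v *m ract M a != 0 /\
    hom_mx (M := M) (N := simple I) (v *m ract M a).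
Proof.
move=> v0; have [|x [Px vx xmax]] := pstate_maximal hp N_gt1 J_bound
   (P := fun a => v *m ract M a <> 0); first by rewrite rmorph1 mulmx1; exact/eqP.
set a := pstate p N_gt1 J x in vx xmax; set w := v *m ract M a in vx.
pose I := subset_trim J (fun i => ~~ `[< a * p i = a >]).
exists I, a; split; first exact/eqP.
apply/simple_hom => b; pose f c : 'rV[F]_(rdim M) := w *m ract M c.
have fL k c d : f (k *: c + d) = k *: f c + f d.
  by rewrite /f linearP mulmxDr scalemxAr.
have fp i c : J i -> f (p i * c) = char hA I (p i) *: f c.
  move=> Ji; rewrite charp /= Ji /f rmorphM mulmxA /= -mulmxA mulmxA.
  rewrite /w -(mulmxA v) -[ract M a *m _]rmorphM.
  case: asboolP => [->|ne] /=; first by rewrite scale1r.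
  have [//|/contrapT->] := xmax i Ji.
  by rewrite mul0mx scale0r.
have := char_semilinear fL fp b 1.
by rewrite /f mulr1 rmorph1 mulmx1.
Qed.

Lemma row_split n (r : 'rV[F]_n) : r != 0 -> exists W, r *m W = 1%:M.
Proof. by move=> r0; exists (pinvmx r); apply: mulmxVp; rewrite /row_free rank_rV r0. Qed.

Lemma G0_simple_gen (S : G0 A -> Prop) : S 0 -> (forall x y, S x -> S y -> S (x - y)) ->
  (forall I : subset J, S (G0_class (simple I))) -> forall x, S x.
Proof.
move=> S0 SB SI; have SD x y : S x -> S y -> S (x + y).
  move=> Sx Sy; rewrite -[y]opprK; apply: (SB) => //; rewrite -sub0r; exact: SB.
apply: G0_ind => // M; have [n] := ubnP (rdim M); elim: n M => // n IH M Mn.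
have [M0|M0] := posnP (rdim M).
  have /G0_exact/eqP := short_exact_rdim0 M0.
  by rewrite -subr_eq0 opprD addrA subrr sub0r oppr_eq0 => /eqP->.
have v0 : delta_mx 0 (Ordinal M0) != 0 :> 'rV[F]_(rdim M).
  by apply/eqP => /matrixP/(_ 0 (Ordinal M0))/eqP; rewrite !mxE !eqxx oner_eq0.
have [I [a [r0 hr]]] := eigen_row v0.
have [W rW] := row_split r0; have [K KM] := kernel_exact hr rW.
rewrite (G0_exact KM); apply: SD; last exact: SI.
by apply: IH; move: Mn; rewrite (short_exact_dim KM) addn1 ltnS.
Qed.

Lemma pim_exists (I : pred nat) : exists (P : rep A) (f : {linear repmod P -> A^o}),
  injective f /\
  forall h : A, (exists x, f x = h) <-> (exists a, h = a * pim_elt p N_gt1 J_bound I).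
Proof.
set e := pim_elt _ _ _ _.
have [|x y [a ->] [b ->]|a x [b ->]|k x y|x _|P [f [finj fS]]] := @rep_of_sub F A A^o
  (fun x => exists a, x = a * e) _ (coords hA N_gt1 J_bound).
- by exists 0; rewrite mul0r.
- by exists (a + b); rewrite mulrDl.
- by exists (a * b); rewrite -mulrA.
- by rewrite -coordsL -[k%:A *: x]scalerAl mul1r.
- by rewrite -(coords0 hA N_gt1 J_bound) => /coords_inj.
by exists P, f; split=> // h; split=> [/fS|/fS].
Qed.

Section PIM.
Variables (I : pred nat) (P : rep A) (f : {linear repmod P -> A^o}).
Hypothesis f_inj : injective f.
Hypothesis f_im :
  forall h : A, (exists x, f x = h) <-> (exists a, h = a * pim_elt p N_gt1 J_bound I).

Let gen_subproof : exists t, f t = pim_idem hA N_gt1 J_bound I.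
Proof. by apply/f_im; exact: pim_idem_mem. Qed.
Let t := sval (cid gen_subproof).
Let ft : f t = pim_idem hA N_gt1 J_bound I := svalP (cid gen_subproof).

Let f_gen x : (f x : A) *: t = x.
Proof.
apply: f_inj; rewrite linearZ /= ft; have /f_im[a e] : exists y, f y = f x by exists x.
by rewrite e -[_ *: _]/(_ * _) pim_idem_unit.
Qed.

(** The preimage [t] of the idempotent generates [P], with [f x *: t = x]; any preimage of the image
    of [t] therefore determines a lift. *)
Lemma pim_projective : projective P.
Proof.
move=> U V g phi gsurj; have [u gu] := gsurj (phi t).
pose h (x : repmod P) : U := (f x : A) *: u.
have hL : linear h by move=> a x y; rewrite /h linearP scalerDl scalerA.
pose m := GRing.isLinear.Build A (repmod P) U *:%R h hL.
pose h' : {linear repmod P -> U} := HB.pack h m.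
by exists h' => x; rewrite /= /h linearZ /= gu -linearZ f_gen.
Qed.

Let hom_gen K (r : 'rV[F]_(rdim P)) : hom_mx (N := simple K) r ->
  forall x, r *m x = char hA K (f x) *: (r *m t).
Proof.
move/simple_hom => h x; rewrite -[x in LHS]f_gen repmod_scaleE mulmxA h.
by rewrite scalemxAl.
Qed.

Lemma pim_hom : exists r : 'rV[F]_(rdim P), [/\ hom_mx (N := simple I) r, r != 0 &
  forall s, hom_mx (M := P) (N := simple I) s -> exists k, s = k *: r].
Proof.
pose phi (x : repmod P) : repmod (simple I) := (char hA I (f x))%:M.
have phiL : linear phi.
  move=> a x y; rewrite /phi linearP /= repmod_scaleE /= char_repE.
  rewrite -[a *: (f x : A^o)]/(a * f x) mul_scalar_mx.
  have -> : char hA I (a * f x + f y) = char hA I a * char hA I (f x) + char hA I (f y).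
    by rewrite -[a * f x]scale1r charL mul1r charM.
  by rewrite scale_scalar_mx raddfD.
pose m := GRing.isLinear.Build A (repmod P) (repmod (simple I)) *:%R phi phiL.
pose g : {linear repmod P -> repmod (simple I)} := HB.pack phi m.
have [r hr rE] := lin_mx g.
have rt : r *m t = 1%:M by rewrite -rE /= /phi ft char_idem.
exists r; split=> //.
  by apply/eqP => r0; move/matrixP/(_ 0 0)/eqP: rt; rewrite r0 mul0mx !mxE eq_sym oner_eq0.
move=> s hs; have [c st] : exists c, s *m t = c%:M by eexists; exact: mx11_scalar.
exists c; apply: mx_eq_col => j.
rewrite (hom_gen hs) -scalemxAl (hom_gen hr) rt st !scale_scalar_mx.
by rewrite mulr1 mulrC.
Qed.

Lemma hdim_pim : hdim P (simple I) = 1%N.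
Proof. by have [r [hr r0 rl]] := pim_hom; exact: dim_hom_line hr r0 rl. Qed.

Lemma pim_hom0 K i (s : 'rV[F]_(rdim P)) : J i -> I i != K i ->
  hom_mx (N := simple K) s -> s = 0.
Proof.
move=> Ji ne hs; apply: mx_eq_col => j; rewrite (hom_gen hs) (hom_gen hs t) ft.
by rewrite (char_idem0 hA N_gt1 J_bound Ji ne) scale0r scaler0 mul0mx.
Qed.

Lemma hdim_pim0 K i : J i -> I i != K i -> hdim P (simple K) = 0%N.
Proof. by move=> Ji ne; apply: dim_hom0 => s; exact: (pim_hom0 Ji ne). Qed.

Lemma pim_rdim : (0 < rdim P)%N.
Proof.
have [r [_ + _]] := pim_hom; rewrite lt0n; apply: contraNneq => P0.
by apply/eqP/matrixP => i j; have := ltn_ord j; rewrite [X in (_ < X)%N]P0.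
Qed.

End PIM.

Definition pim_rep I : rep A := sval (cid (pim_exists I)).
Definition pim_map I : {linear repmod (pim_rep I) -> A^o} :=
  sval (cid (svalP (cid (pim_exists I)))).

Lemma pim_map_inj I : injective (@pim_map I).
Proof. by have [] := svalP (cid (svalP (cid (pim_exists I)))). Qed.

Lemma pim_map_im I h : (exists x, @pim_map I x = h) <->
  (exists a, h = a * pim_elt p N_gt1 J_bound I).
Proof. by have [_] := svalP (cid (svalP (cid (pim_exists I)))). Qed.

Definition pim I : prep A := PRep (pim_projective (@pim_map_inj I) (@pim_map_im I)).

(** Lift [r] to a map h into [pim I]. Were h not surjective, some eigenrow of [pim I] would vanish
    on its image; only the character of [I] occurs, and its eigenrows are multiples of [r1], whose
    composite with h is [r]. The kernel of h is a direct summand of [P] because [pim I] is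
    projective. *)
Lemma pim_split_off (P : rep A) (I : subset J) (r : 'rV[F]_(rdim P)) :
  projective P -> hom_mx (N := simple I) r -> r != 0 ->
  exists2 K : prep A, short_exact K P (pim I) & (rdim K < rdim P)%N.
Proof.
move=> prP hr r0; have [r1 [hr1 r10 r1l]] := pim_hom (@pim_map_inj I) (@pim_map_im I).
have [W1 rW1] := row_split r10.
have [h hh r1h] := projective_mx prP hr1 rW1 hr.
have hfree : row_free h.
  apply: inj_row_free => v vh; apply/eqP/negPn/negP => v0.
  have [K [a [w0 hw]]] := @eigen_row (pim I) v v0.
  have wh : v *m ract (pim I) a *m h = 0 by rewrite -mulmxA hh mulmxA vh mul0mx.
  have KI : K = I.
    apply/eqP/negPn/negP => /subset_neq[i [Ji ne]].
    move/eqP: w0; apply; apply: (pim_hom0 (@pim_map_inj I) (@pim_map_im I) Ji _ hw).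
    by rewrite eq_sym.
  rewrite KI in hw; have [k e] := r1l _ hw.
  move: wh; rewrite e -scalemxAl r1h => /eqP; rewrite scaler_eq0 (negPf r0) orbF => /eqP k0.
  by move: w0; rewrite e k0 scale0r eqxx.
have hW := mulmxVp hfree; have [K KP] := kernel_exact hh hW.
have prK : projective K.
  have /short_exactP[X [Z [Y [W sp]]]] := KP.
  have [s [r' [_ hr' _ rX _]]] := projective_split (@prepP _ _ (pim I)) sp.
  by have [hX _ _ _ _] := sp; exact: retract_projective prP hX hr' rX.
exists (PRep prK) => //=.
by rewrite (short_exact_dim KP) -[X in (X < _)%N]addn0 ltn_add2l (pim_rdim (@pim_map_inj I) (@pim_map_im I)).
Qed.

Lemma K0_pim_gen (S : K0 A -> Prop) : S 0 -> (forall x y, S x -> S y -> S (x - y)) ->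
  (forall I : subset J, S (K0_class (pim I))) -> forall x, S x.
Proof.
move=> S0 SB SI; have SD x y : S x -> S y -> S (x + y).
  move=> Sx Sy; rewrite -[y]opprK; apply: (SB) => //; rewrite -sub0r; exact: SB.
apply: K0_ind => // P; have [n] := ubnP (rdim P); elim: n P => // n IH P Pn.
have [P0|P0] := posnP (rdim P).
  have /K0_exact/eqP := short_exact_rdim0 P0.
  by rewrite -subr_eq0 opprD addrA subrr sub0r oppr_eq0 => /eqP->.
have v0 : delta_mx 0 (Ordinal P0) != 0 :> 'rV[F]_(rdim P).
  by apply/eqP => /matrixP/(_ 0 (Ordinal P0))/eqP; rewrite !mxE !eqxx oner_eq0.
have [I [a [r0 hr]]] := eigen_row v0.
have [K KP Klt] := pim_split_off (@prepP _ _ P) hr r0.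
rewrite (K0_exact KP); apply: SD; last exact: SI.
by apply: IH; apply: leq_trans Klt _.
Qed.

Lemma hdim_delta (I K : subset J) : hdim (pim I) (simple K) = (I == K).
Proof.
have [<-|ne] := eqVneq I K; first exact: hdim_pim (@pim_map_inj I) (@pim_map_im I).
have [i [Ji hi]] := subset_neq ne.
exact: (hdim_pim0 (@pim_map_inj I) (@pim_map_im I) Ji hi).
Qed.

Lemma G0_zbasis : zbasis (fun I : subset J => G0_class (simple I)).
Proof.
apply: (zbasis_crit (c := fun I : subset J => G0_pair (pim I)) (ht := fun=> 0%N)).
- exact: G0_simple_gen.
- by move=> I; exact: G0_pairD.
- by move=> I; rewrite G0_pairE hdim_delta eqxx.
- move=> I K; rewrite G0_pairE hdim_delta; case: (eqVneq I K) => [->|]; first by left.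
  by rewrite eqxx.
Qed.

Lemma K0_zbasis : zbasis (fun I : subset J => K0_class (pim I)).
Proof.
apply: (zbasis_crit (c := fun (I : subset J) x => K0_pair x (simple I)) (ht := fun=> 0%N)).
- exact: K0_pim_gen.
- by move=> I; exact: K0_pairD.
- by move=> I; rewrite K0_pairE hdim_delta eqxx.
- move=> I K; rewrite K0_pairE hdim_delta; case: (eqVneq K I) => [->|]; first by left.
  by rewrite eqxx.
Qed.

(** The dimensions of Hom into the simples are the coordinates in the basis of the [pim I]; later
    identities in K_0 are proved through them. *)
Lemma K0_sep (x y : K0 A) :
  (forall I : subset J, K0_pair x (simple I) = K0_pair y (simple I)) -> x = y.
Proof.
apply: (zb_sep (c := fun (I : subset J) z => K0_pair z (simple I)) K0_zbasis) => [I|I K]; first exact: K0_pairD.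
by rewrite K0_pairE hdim_delta natz.
Qed.

End HeckeGrothendieck.

(** * The algebras of types A and D *)

Section HeckeLift.
Variables (F : fieldType) (G : diagram) (C : pzRingType) (cst : F -> C) (q : gen G -> C).
Hypothesis cstD : forall a b, cst (a + b) = cst a + cst b.
Hypothesis cstM : forall a b, cst (a * b) = cst a * cst b.
Hypothesis cst1 : cst 1 = 1.
Hypothesis cst_central : forall a x, cst a * x = x * cst a.
Hypothesis q_idem : forall i, q i * q i = q i.
Hypothesis q_braid : forall i j, edge G (val i) (val j) -> q i * q j * q i = q j * q i * q j.
Hypothesis q_comm : forall i j, ~~ edge G (val i) (val j) -> q i * q j = q j * q i.

(** The target is a mere ring, possibly trivial, where the scalars are given by a central map
    [cst]. *)
Fixpoint heval (t : hterm F G) : C := match t with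
  | HScal a => cst a
  | HGen i => q i
  | HAdd x y => heval x + heval y
  | HMul x y => heval x * heval y
  end.

Lemma heval_heq x y : heq x y -> heval x = heval y.
Proof.
have cst0 : cst 0 = 0 by apply: (@addrI _ (cst 0)); rewrite -cstD !addr0.
have cstN1 : cst (-1) = -1.
  by apply/eqP; rewrite -addr_eq0 -cst1 -cstD addNr cst0.
elim=> {x y} //=; try by move=> *; congruence.
- by move=> *; rewrite addrA.
- by move=> *; rewrite addrC.
- by move=> *; rewrite cst0 add0r.
- by move=> *; rewrite cstN1 mulN1r addNr cst0.
- by move=> *; rewrite mulrA.
- by move=> *; rewrite cst1 mul1r.
- by move=> *; rewrite mulrDl.
- by move=> *; rewrite mulrDr.
- by move=> i j /q_braid; rewrite !mulrA.
Qed.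

Definition hecke_lift (x : hecke F G) : C := heval (hrepr x).

Lemma hecke_lift_pi t : hecke_lift (hpi t) = heval t.
Proof. exact/heval_heq/hrepr_pi. Qed.

Lemma hecke_liftD x y : hecke_lift (x + y) = hecke_lift x + hecke_lift y.
Proof. exact: hecke_lift_pi. Qed.

Lemma hecke_liftM x y : hecke_lift (x * y) = hecke_lift x * hecke_lift y.
Proof. exact: hecke_lift_pi. Qed.

Lemma hecke_liftZ a x : hecke_lift (a *: x) = cst a * hecke_lift x.
Proof. exact: hecke_lift_pi. Qed.

Lemma hecke_lift1 : hecke_lift 1 = 1.
Proof. by rewrite -cst1; exact: hecke_lift_pi. Qed.

Lemma hecke_lift_gen i : hecke_lift (hgen F i) = q i.
Proof. exact: hecke_lift_pi. Qed.

End HeckeLift.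

Section HeckeInd.
Variables (F : fieldType) (G : diagram).

Lemma hecke_gen_ind (S : hecke F G -> Prop) : S 1 ->
  (forall (k : F) x y, S x -> S y -> S (k *: x + y)) ->
  (forall x y, S x -> S y -> S (x * y)) -> (forall i, S (hgen F i)) -> forall a, S a.
Proof.
move=> S1 SL SM Sg a.
have S0 : S 0 by rewrite -(addNr 1) -scaleN1r; apply: SL.
rewrite -(hreprK a); elim: (hrepr a) => [k|i|x Sx y Sy|x Sx y Sy].
- have -> : hpi (HScal G k) = k *: 1 + 0 :> hecke F G; last exact: SL.
  rewrite addr0 -[k in LHS]mulr1; apply/hpiP.
  apply: heq_trans (heq_scalM _ _ _) _; apply: heq_mul; first exact: heq_refl.
  exact/heq_sym/hrepr_pi.
- exact: Sg.
- have -> : hpi (HAdd x y) = 1 *: hpi x + hpi y; last exact: SL.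
  rewrite scale1r; apply/hpiP; apply: heq_add; exact/heq_sym/hrepr_pi.
- have -> : hpi (HMul x y) = hpi x * hpi y; last exact: SM.
  by apply/hpiP; apply: heq_mul; exact/heq_sym/hrepr_pi.
Qed.

End HeckeInd.

Lemma vertex_bound c n i : vertex (cdiagram c n) i -> (i < n)%N.
Proof. by case: c => //= /andP[]. Qed.

(** The diagrams of both types are cut out of [edgeD], in type A because 0 is no vertex. *)
Lemma edge_edgeD c n i j : vertex (cdiagram c n) i -> vertex (cdiagram c n) j ->
  edge (cdiagram c n) i j = edgeD i j.
Proof. by case: c => /=; case: i j => [|i] [|j]. Qed.

Section HeckeFamily.
Variables (F : fieldType) (c : family) (n : nat).
Local Notation H := (H0 F c n).
Local Notation V := (vertex (cdiagram c n)).

Definition hfam (i : nat) : H :=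
  if insub i is Some g then hgen F (g : gen (cdiagram c n)) else 1.

Lemma hfam_gen (g : gen (cdiagram c n)) : hfam (val g) = hgen F g.
Proof. by rewrite /hfam valK. Qed.

Lemma hfam_out i : ~~ V i -> hfam i = 1.
Proof. by move=> Vi; rewrite /hfam insubF //; exact/negbTE. Qed.

Lemma hfam_family : hecke_family hfam.
Proof.
have VP i : V i -> exists g : gen (cdiagram c n), val g = i.
  by move=> Vi; exists (Sub i Vi); rewrite SubK.
have idem i : hfam i * hfam i = hfam i.
  have [/VP[g <-]|/hfam_out->] := boolP (V i); rewrite ?mulr1 //.
  by rewrite hfam_gen hgen_idem.
split=> // i j e.
  have [/VP[g gi]|/hfam_out->] := boolP (V i); last by rewrite !mulr1 mul1r idem.
  have [/VP[h hj]|/hfam_out->] := boolP (V j); last by rewrite !mulr1 mul1r idem.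
  rewrite -gi -hj !hfam_gen -!mulrA hgen_braid // edge_edgeD ?gi ?hj //.
  - by rewrite -gi; exact: valP.
  - by rewrite -hj; exact: valP.
have [/VP[g gi]|/hfam_out->] := boolP (V i); last by rewrite mulr1 mul1r.
have [/VP[h hj]|/hfam_out->] := boolP (V j); last by rewrite mulr1 mul1r.
rewrite -gi -hj !hfam_gen; apply: hgen_comm; rewrite edge_edgeD ?gi ?hj //.
- by rewrite -gi; exact: valP.
- by rewrite -hj; exact: valP.
Qed.

Section Univ.
Variables (C : pzRingType) (cst : F -> C) (q : nat -> C).
Hypothesis cstD : forall a b, cst (a + b) = cst a + cst b.
Hypothesis cstM : forall a b, cst (a * b) = cst a * cst b.
Hypothesis cst1 : cst 1 = 1.
Hypothesis cst_central : forall a x, cst a * x = x * cst a.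
Hypothesis q_fam : hecke_family q.
Hypothesis q_out : forall i, ~~ V i -> q i = 1.

Lemma hfam_univ : exists f : H -> C, [/\ forall x y, f (x + y) = f x + f y,
  forall x y, f (x * y) = f x * f y, forall a x, f (a *: x) = cst a * f x,
  f 1 = 1 & forall i, f (hfam i) = q i].
Proof.
pose q' (g : gen (cdiagram c n)) := q (val g).
have qi g : q' g * q' g = q' g by exact: fam_idem.
have qb g h : edge (cdiagram c n) (val g) (val h) -> q' g * q' h * q' g = q' h * q' g * q' h.
  by rewrite edge_edgeD; [exact: fam_braid|exact: valP|exact: valP].
have qc g h : ~~ edge (cdiagram c n) (val g) (val h) -> q' g * q' h = q' h * q' g.
  by rewrite edge_edgeD; [exact: fam_comm|exact: valP|exact: valP].
exists (hecke_lift cst q'); split=> [x y|x y|a x||i].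
- exact: hecke_liftD.
- exact: hecke_liftM.
- exact: hecke_liftZ.
- exact: hecke_lift1.
have [Vi|Vi] := boolP (V i); last by rewrite (hfam_out Vi) (q_out Vi) hecke_lift1.
have -> : i = val (Sub i Vi : gen (cdiagram c n)) by rewrite SubK.
by rewrite hfam_gen hecke_lift_gen.
Qed.
End Univ.

Lemma hfam_algebra : hecke_algebra V hfam.
Proof.
split; [exact: hfam_family|exact: hfam_out| |].
- move=> S S1 SL SM Sp; apply: hecke_gen_ind => // i.
  by rewrite -hfam_gen; apply/Sp/valP.
- move=> d q hq qout.
  have [||||f [fD fM fZ f1 fq]] := @hfam_univ 'M[F]_d (fun a => a%:M) q _ _ _ _ hq qout.
  + by move=> a b; rewrite raddfD.
  + by move=> a b; rewrite scalar_mxM.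
  + by [].
  + by move=> a x; exact: (esym (scalar_mxC a x)).
  have [r rE] := lrmorphism_mx (rho := f)
    (fun k a b => etrans (fD _ _) (congr1 (+%R^~ _) (etrans (fZ k a) (mul_scalar_mx _ _)))) f1 fM.
  by exists r => i; rewrite rE fq.
Qed.

End HeckeFamily.

Section Parabolic.
Variables (F : fieldType) (c : family) (m n : nat).
Local Notation H := (H0 F c n).
Local Notation B := (subalg (@par_gens F c m n)).
Local Notation V := (vertex (cdiagram c n)).

Definition par_letters : pred nat := fun i => V i && (i != m).

Definition pfam (i : nat) : B := insubd (1 : B) (if i == m then 1 else hfam F c n i).

Lemma val_pfam i : val (pfam i) = if i == m then 1 else hfam F c n i.
Proof.
rewrite val_insubd rmorph1; case: ifP => // /negP[]; apply/asboolP.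
case: eqP => [_|/eqP im]; first exact: subalg_ind1.
have [Vi|/hfam_out->] := boolP (V i); last exact: subalg_ind1.
apply: subalg_ind_gen; exists (Sub i Vi); rewrite ?SubK //=.
by rewrite -hfam_gen SubK.
Qed.

Lemma pfam_family : hecke_family pfam.
Proof.
have hf := hfam_family F c n; split=> [i|i j e|i j e]; apply: val_inj;
  rewrite !rmorphM /= !val_pfam.
- by case: ifP; rewrite ?mulr1 ?fam_idem.
- by case: ifP => _; case: ifP => _; rewrite ?mulr1 ?mul1r ?fam_idem // fam_braid.
- by case: ifP => _; case: ifP => _; rewrite ?mulr1 ?mul1r // fam_comm.
Qed.

(** A family that is 1 at the letter m is still a family on all letters, hence defines a
    representation of the whole algebra, whose restriction is the one sought. *)
Lemma pfam_algebra : hecke_algebra par_letters pfam.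
Proof.
split; first exact: pfam_family.
- move=> i h; apply: val_inj; rewrite val_pfam rmorph1; case: ifP => // /negbT im.
  by rewrite hfam_out //; apply: contra h => Vi; rewrite /par_letters Vi.
- move=> S S1 SL SM Sp b.
  have := valP b => /asboolP; suff E x : subalg_ind (@par_gens F c m n) x ->
      exists2 b : B, val b = x & S b.
    by case/E => b' /val_inj->.
  elim=> {x} [x [g gm <-]||k x y _ [b1 <- S1'] _ [b2 <- S2]|x y _ [b1 <- S1'] _ [b2 <- S2]].
  + exists (pfam (val g)); last by apply: Sp; rewrite /par_letters (valP g) gm.
    by rewrite val_pfam (negPf gm) hfam_gen.
  + by exists 1; rewrite ?rmorph1.
  + by exists (k *: b1 + b2); [rewrite linearP|exact: SL].
  + by exists (b1 * b2); [rewrite rmorphM|exact: SM].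
- move=> d q hq qout; have [|r rE] := alg_univ (hfam_algebra F c n) hq.
    by move=> i Vi; apply: qout; rewrite /par_letters (negPf Vi).
  have [|||r' r'E] := @lrmorphism_mx F B d (fun b => r (val b)).
  + by move=> k a b; rewrite !linearP.
  + by rewrite !rmorph1.
  + by move=> a b; rewrite !rmorphM.
  exists r' => i; rewrite r'E val_pfam; case: eqP => [->|_]; last exact: rE.
  by rewrite rmorph1 qout // /par_letters eqxx andbF.
Qed.

End Parabolic.

(** * Tensor products of matrices *)

Section TensorIndex.
Variables (m n : nat).

Lemma tidx_subproof (i : 'I_m) (k : 'I_n) : (i * n + k < m * n)%N.
Proof. by have := ltn_ord i; have := ltn_ord k; nia. Qed.
(** The index of a pair of basis vectors in the block layout of [tprod]. *)
Definition tidx (i : 'I_m) (k : 'I_n) : 'I_(m * n) := Ordinal (tidx_subproof i k).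

Lemma tidx_bij : bijective (fun ik : 'I_m * 'I_n => tidx ik.1 ik.2).
Proof.
apply: inj_card_bij; last by rewrite card_prod !card_ord.
move=> [i k] [j l] /(congr1 val) /= e.
have n0 : (0 < n)%N := leq_ltn_trans (leq0n _) (ltn_ord k).
have ij : i = j.
  by apply: val_inj; have := congr1 (divn^~ n) e; rewrite !divnMDl // !divn_small // !addn0.
by move: e; rewrite ij => /addnI e; congr (_, _); exact: val_inj.
Qed.

Lemma tidxP (a : 'I_(m * n)) : exists i k, a = tidx i k.
Proof. by have [g _ gK] := tidx_bij; exists (g a).1, (g a).2; rewrite gK. Qed.

Lemma sum_tidx (V : nmodType) (f : 'I_(m * n) -> V) :
  \sum_a f a = \sum_i \sum_k f (tidx i k).
Proof.
rewrite pair_bigA /= (reindex (fun ik : 'I_m * 'I_n => tidx ik.1 ik.2)) //.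
exact: onW_bij tidx_bij.
Qed.

Lemma tidx_eq i j k l : (tidx i k == tidx j l) = (i == j) && (k == l).
Proof.
by have /= := inj_eq (bij_inj tidx_bij) (i, k) (j, l); rewrite xpair_eqE.
Qed.
End TensorIndex.

Section TensorEntries.
Variable F : fieldType.

Lemma trowE n1 (A : 'rV[F]_n1) m2 n2 (B : 'M[F]_(m2, n2)) k j l :
  trow A B k (tidx j l) = A 0 j * B k l.
Proof.
elim: n1 A j => [|n1 IH] A j; first by case: j.
rewrite [trow A B]/(row_mx _ _); case: (unliftP ord0 j) => [j'|] ->.
  have -> : tidx (fintype.lift ord0 j') l = rshift n2 (tidx j' l) :> 'I_(n2 + n1 * n2).
    by apply: val_inj; rewrite /= /bump /=; lia.
  by rewrite row_mxEr IH mxE; congr (A _ _ * _); apply: val_inj.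
have -> : tidx (ord0 : 'I_n1.+1) l = lshift (n1 * n2) l :> 'I_(n2 + n1 * n2).
  by apply: val_inj.
by rewrite row_mxEl !mxE; congr (A _ _ * _); apply: val_inj.
Qed.

Lemma tprod_tidx m1 n1 (A : 'M[F]_(m1, n1)) m2 n2 (B : 'M[F]_(m2, n2)) i j k l :
  tprod A B (tidx i k) (tidx j l) = A i j * B k l.
Proof.
elim: m1 A i => [|m1 IH] A i; first by case: i.
rewrite [tprod A B]/(col_mx _ _); case: (unliftP ord0 i) => [i'|] ->.
  have -> : tidx (fintype.lift ord0 i') k = rshift m2 (tidx i' k) :> 'I_(m2 + m1 * m2).
    by apply: val_inj; rewrite /= /bump /=; lia.
  by rewrite col_mxEd IH mxE; congr (A _ _ * _); apply: val_inj.
have -> : tidx (ord0 : 'I_m1.+1) k = lshift (m1 * m2) k :> 'I_(m2 + m1 * m2).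
  by apply: val_inj.
by rewrite col_mxEu trowE mxE; congr (A _ _ * _); apply: val_inj.
Qed.

Lemma tprodP m1 n1 m2 n2 (X Y : 'M[F]_(m1 * m2, n1 * n2)) :
  (forall i j k l, X (tidx i k) (tidx j l) = Y (tidx i k) (tidx j l)) -> X = Y.
Proof.
move=> h; apply/matrixP => a b; have [i [k ->]] := tidxP a.
by have [j [l ->]] := tidxP b.
Qed.

Lemma tprodDl m1 n1 m2 n2 (A A' : 'M[F]_(m1, n1)) (B : 'M[F]_(m2, n2)) :
  tprod (A + A') B = tprod A B + tprod A' B.
Proof. by apply: tprodP => i j k l; rewrite mxE !tprod_tidx !mxE mulrDl. Qed.

Lemma tprodDr m1 n1 m2 n2 (A : 'M[F]_(m1, n1)) (B B' : 'M[F]_(m2, n2)) :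
  tprod A (B + B') = tprod A B + tprod A B'.
Proof. by apply: tprodP => i j k l; rewrite mxE !tprod_tidx !mxE mulrDr. Qed.

Lemma tprodZl m1 n1 m2 n2 c (A : 'M[F]_(m1, n1)) (B : 'M[F]_(m2, n2)) :
  tprod (c *: A) B = c *: tprod A B.
Proof. by apply: tprodP => i j k l; rewrite mxE !tprod_tidx !mxE mulrA. Qed.

Lemma tprodZr m1 n1 m2 n2 c (A : 'M[F]_(m1, n1)) (B : 'M[F]_(m2, n2)) :
  tprod A (c *: B) = c *: tprod A B.
Proof. by apply: tprodP => i j k l; rewrite mxE !tprod_tidx !mxE mulrCA. Qed.

Lemma tprod1E m n (A : 'M[F]_m) (B : 'M[F]_n) :
  tprod A 1%:M * tprod 1%:M B = tprod A B.
Proof. by rewrite -[LHS]tprodE mulmx1 mul1mx. Qed.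

Lemma tprod1C m n (A : 'M[F]_m) (B : 'M[F]_n) :
  tprod A 1%:M * tprod 1%:M B = tprod 1%:M B * tprod A 1%:M.
Proof. by rewrite -[RHS]tprodE mulmx1 mul1mx tprod1E. Qed.

Lemma tprodMl m n (A A' : 'M[F]_m) :
  tprod A 1%:M * tprod A' 1%:M = tprod (A * A') 1%:M :> 'M[F]_(m * n).
Proof. by rewrite -[LHS]tprodE mulmx1. Qed.

Lemma tprodMr m n (B B' : 'M[F]_n) :
  tprod 1%:M B * tprod 1%:M B' = tprod 1%:M (B * B') :> 'M[F]_(m * n).
Proof. by rewrite -[LHS]tprodE mulmx1. Qed.

End TensorEntries.

(** * Outer tensor products *)

Section HomGen.
Variables (F : fieldType) (A : algType F) (J : pred nat) (p : nat -> A).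
Hypothesis hA : hecke_algebra J p.

Lemma hom_mx_gen (M N : rep A) (X : 'M[F]_(rdim N, rdim M)) :
  (forall i, J i -> ract N (p i) *m X = X *m ract M (p i)) -> hom_mx X.
Proof.
move=> h; apply: (alg_gen hA) => // [|k x y hx hy|x y hx hy].
- by rewrite !rmorph1 mulmx1 mul1mx.
- have E (R : rep A) : ract R (k *: x + y) = k *: ract R x + ract R y by exact: linearP.
  by rewrite !E mulmxDl mulmxDr -scalemxAl -scalemxAr hx hy.
- by rewrite !rmorphM /= -mulmxA hy !mulmxA hx.
Qed.

Lemma G0_class_simple (R : rep A) (I : pred nat) (r : 'rV[F]_(rdim R)) :
  rdim R = 1%N -> hom_mx (N := simple hA I) r -> r != 0 ->
  G0_class R = G0_class (simple hA I).
Proof.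
move=> R1 hr r0; have [W rW] := row_split r0; have [K KR] := kernel_exact hr rW.
rewrite (G0_exact KR).
have K0 : rdim K = 0%N.
  by apply/eqP; rewrite -(eqn_add2r 1) add0n -{2}R1 (short_exact_dim KR).
have /G0_exact/eqP := short_exact_rdim0 K0.
by rewrite -subr_eq0 opprD addrA subrr sub0r oppr_eq0 => /eqP->; rewrite add0r.
Qed.
End HomGen.

Section Outer.
Variables (F : fieldType) (c : family) (m n p : nat).
Hypothesis lo_m : (lo c <= m)%N.
Hypothesis mnp : (m + n)%N = p.
Local Notation Hm := (H0 F c m).
Local Notation Hn := (H0 F TypeA n).
Local Notation B := (subalg (@par_gens F c m p)).
Local Notation pB := (pfam F c m p).
Local Notation hB := (pfam_algebra F c m p).
Local Notation hm := (hfam_algebra F c m).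
Local Notation hn := (hfam_algebra F TypeA n).

Lemma par_lettersP k : par_letters c m p k <->
  (k < m)%N /\ vertex (cdiagram c m) k \/
  (m < k)%N /\ vertex (cdiagram TypeA n) (k - m)%N.
Proof.
rewrite /par_letters; move: lo_m; case: c => /= _; split; lia.
Qed.

Lemma hfamA0 l : hfam F TypeA l 0 = 1.
Proof. exact: hfam_out. Qed.

(** Factors from the two sides commute, so an edge may join letters on different sides only if one
    of them is sent to 1. Consecutive letters are separated by m, sent to 1 as [q2 0]. An edge from
    0 to 2 can cross at m = 1 only, which type D excludes, while in type A the letter 0 is sent to
    1. *)
Lemma outer_family (C : pzRingType) (q1 q2 : nat -> C) :
  hecke_family q1 -> hecke_family q2 -> q2 0 = 1 ->
  (forall k, ~~ vertex (cdiagram c m) k -> q1 k = 1) ->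
  (forall i j, q1 i * q2 j = q2 j * q1 i) ->
  hecke_family (fun k => if (k < m)%N then q1 k else q2 (k - m)%N).
Proof.
move=> h1 h2 q20 q1out q12.
have idem k : (if (k < m)%N then q1 k else q2 (k - m)%N) *
    (if (k < m)%N then q1 k else q2 (k - m)%N) =
    (if (k < m)%N then q1 k else q2 (k - m)%N) by case: ifP => _; rewrite fam_idem.
have br1 (a b : C) : a = 1 -> b * b = b -> a * b * a = b * a * b.
  by move=> -> bb; rewrite !mulr1 mul1r bb.
split=> // i j e.
  have [i1|i1] := ltnP i m; have [j1|j1] := ltnP j m.
  - exact: fam_braid.
  - have [jm|jm] := eqVneq j m; first by apply/esym/br1; rewrite ?jm ?subnn ?fam_idem.
    apply: br1; last by rewrite fam_idem.
    apply: q1out; move: lo_m i1 j1 e jm; case: c => /=; case: i => [|i]; case: j => [|j] //=; lia.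
  - have [im|im] := eqVneq i m; first by apply: br1; rewrite ?im ?subnn ?fam_idem.
    apply/esym; apply: br1; last by rewrite fam_idem.
    apply: q1out; move: lo_m i1 j1 e im; case: c => /=; case: i => [|i]; case: j => [|j] //=; lia.
  - have [im|im] := eqVneq i m; first by apply: br1; rewrite ?im ?subnn ?fam_idem.
    have [jm|jm] := eqVneq j m; first by apply/esym/br1; rewrite ?jm ?subnn ?fam_idem.
    apply: fam_braid => //; move: i1 j1 e im jm.
    case: i => [|i]; case: j => [|j] //=; try lia.
    by move=> i1 j1 e im jm; rewrite (subSn (_ : m <= i)%N) ?(subSn (_ : m <= j)%N) /=; lia.
have [i1|i1] := ltnP i m; have [j1|j1] := ltnP j m.
- exact: fam_comm.
- exact: q12.
- exact/esym/q12.
- have [im|im] := eqVneq i m; first by rewrite im subnn q20 mulr1 mul1r.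
  have [jm|jm] := eqVneq j m; first by rewrite jm subnn q20 mulr1 mul1r.
  apply: fam_comm => //; move: i1 j1 e im jm.
  case: i => [|i]; case: j => [|j] //=; try lia.
  by move=> i1 j1 e im jm; rewrite (subSn (_ : m <= i)%N) ?(subSn (_ : m <= j)%N) /=; lia.
Qed.

Section OuterRep.
Variables (M : rep Hm) (N : rep Hn).

Definition outer_l (x : Hm) : 'M[F]_(rdim M * rdim N) := tprod (ract M x) 1%:M.
Definition outer_r (y : Hn) : 'M[F]_(rdim M * rdim N) := tprod 1%:M (ract N y).

Lemma outer_l1 : outer_l 1 = 1.
Proof.
have e : ract M 1 = 1%:M by rewrite rmorph1.
by rewrite /outer_l e tprod1.
Qed.

Lemma outer_r1 : outer_r 1 = 1.
Proof.
have e : ract N 1 = 1%:M by rewrite rmorph1.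
by rewrite /outer_r e tprod1.
Qed.

Definition outer_gen (k : nat) : 'M[F]_(rdim M * rdim N) :=
  if (k < m)%N then outer_l (hfam F c m k) else outer_r (hfam F TypeA n (k - m)%N).

Lemma outer_gen_family : hecke_family outer_gen.
Proof.
have fl : hecke_family (fun k => outer_l (hfam F c m k)).
  have h := hfam_family F c m; split=> [i|i j e|i j e].
  - by rewrite tprodMl -rmorphM fam_idem.
  - by rewrite !tprodMl -!rmorphM fam_braid.
  - by rewrite !tprodMl -!rmorphM fam_comm.
have fr : hecke_family (fun k => outer_r (hfam F TypeA n k)).
  have h := hfam_family F TypeA n; split=> [i|i j e|i j e].
  - by rewrite tprodMr -rmorphM fam_idem.
  - by rewrite !tprodMr -!rmorphM fam_braid.
  - by rewrite !tprodMr -!rmorphM fam_comm.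
apply: (outer_family fl fr) => [|k /hfam_out->|i j]; last exact: tprod1C.
  by rewrite hfamA0 outer_r1.
exact: outer_l1.
Qed.

Lemma outer_gen_out k : ~~ par_letters c m p k -> outer_gen k = 1.
Proof.
move=> /negP h; rewrite /outer_gen; case: ifP => km.
  rewrite hfam_out ?outer_l1 //.
  by apply/negP => Vk; apply: h; apply/par_lettersP; left.
have [->|ne] := eqVneq k m.
  by rewrite subnn hfamA0 outer_r1.
rewrite hfam_out ?outer_r1 //.
by apply/negP => Vk; apply: h; apply/par_lettersP; right; split=> //; lia.
Qed.

Let rho_ex := alg_univ hB outer_gen_family outer_gen_out.

Definition outer_rep : rep B := Rep (sval (cid rho_ex)).

Lemma outer_repE k : ract outer_rep (pB k) = outer_gen k.
Proof. exact: (svalP (cid rho_ex)). Qed.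

Lemma outerP : outer M N outer_rep.
Proof.
exists (sval (cid rho_ex)); split=> // b k bk.
have E : val k != m -> b = pB (val k).
  by move=> km; apply: val_inj; rewrite bk val_pfam (negPf km) hfam_gen.
split=> [i ik|j jk].
  have im : (val k < m)%N by rewrite -ik; exact: vertex_bound (valP i).
  rewrite E; last by rewrite neq_ltn im.
  rewrite -[LHS]/(ract outer_rep _) outer_repE /outer_gen im /outer_l -ik.
  by rewrite hfam_gen.
have j0 : (0 < val j)%N by have /andP[] := valP j.
rewrite E; last by rewrite -jk; lia.
rewrite -[LHS]/(ract outer_rep _) outer_repE /outer_gen -jk ltnNge leq_addr /=.
by rewrite addKn /outer_r hfam_gen.
Qed.

End OuterRep.

Lemma outer_exact_l (M' M M'' : rep Hm) (N : rep Hn) : short_exact M' M M'' ->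
  short_exact (outer_rep M' N) (outer_rep M N) (outer_rep M'' N).
Proof.
case/short_exactP => X [Z [Y [W [hX hZ YX ZW e]]]]; apply/short_exactP.
exists (tprod X 1%:M), (tprod Z 1%:M), (tprod Y 1%:M), (tprod W 1%:M).
have hom (M1 M2 : rep Hm) (V : 'M_(rdim M2, rdim M1)) : hom_mx V ->
    hom_mx (M := outer_rep M1 N) (N := outer_rep M2 N) (tprod V 1%:M).
  move=> hV; apply: (hom_mx_gen hB) => i _; rewrite !outer_repE /outer_gen.
  by case: ifP => _; rewrite /outer_l /outer_r -!tprodE !mulmx1 ?mul1mx // hV.
split; [exact: hom|exact: hom| | |]; rewrite -?tprodE ?YX ?ZW ?mulmx1 ?tprod1 //.
by rewrite -tprodDl e tprod1.
Qed.

Lemma outer_exact_r (M : rep Hm) (N' N N'' : rep Hn) : short_exact N' N N'' ->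
  short_exact (outer_rep M N') (outer_rep M N) (outer_rep M N'').
Proof.
case/short_exactP => X [Z [Y [W [hX hZ YX ZW e]]]]; apply/short_exactP.
exists (tprod 1%:M X), (tprod 1%:M Z), (tprod 1%:M Y), (tprod 1%:M W).
have hom (N1 N2 : rep Hn) (V : 'M_(rdim N2, rdim N1)) : hom_mx V ->
    hom_mx (M := outer_rep M N1) (N := outer_rep M N2) (tprod 1%:M V).
  move=> hV; apply: (hom_mx_gen hB) => i _; rewrite !outer_repE /outer_gen.
  by case: ifP => _; rewrite /outer_l /outer_r -!tprodE !mulmx1 ?mul1mx // hV.
split; [exact: hom|exact: hom| | |]; rewrite -?tprodE ?YX ?ZW ?mulmx1 ?tprod1 //.
by rewrite -tprodDr e tprod1.
Qed.

Definition left_part (L : nat -> bool) : pred nat := fun k => L k && (k < m)%N.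
(** For k = 0 the shifted letter would be m, which belongs to neither factor. *)
Definition right_part (L : nat -> bool) : pred nat := fun k => (0 < k)%N && L (m + k)%N.

Lemma char_left L k : vertex (cdiagram c m) k -> (k < m)%N ->
  char hm (left_part L) (hfam F c m k) = char hB L (pB k).
Proof.
move=> Vk km; rewrite !charp Vk /left_part km andbT /=.
suff -> : par_letters c m p k by [].
by apply/par_lettersP; left.
Qed.

Lemma char_right L k : vertex (cdiagram TypeA n) (k - m)%N -> (m < k)%N ->
  char hn (right_part L) (hfam F TypeA n (k - m)%N) = char hB L (pB k).
Proof.
move=> Vk km; rewrite !charp Vk /right_part subn_gt0 km subnKC 1?ltnW //.
suff -> : par_letters c m p k by [].
by apply/par_lettersP; right.
Qed.

Lemma outer_simple L :
  G0_class (outer_rep (simple hm (left_part L)) (simple hn (right_part L))) =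
  G0_class (simple hB L).
Proof.
set R := outer_rep _ _.
apply: (@G0_class_simple _ _ _ _ hB R L (1%:M : 'M[F]_(1 * 1))) => //.
  apply: (hom_mx_gen hB) => k Jk; rewrite mulmx1 mul1mx /R outer_repE simple_act /outer_gen.
  have sc (a : F) : tprod (a%:M : 'M_1) (1%:M : 'M_1) = a%:M.
    by rewrite -[in LHS](scalemx1 1 a) tprodZl tprod1 scalemx1.
  have sc' (a : F) : tprod (1%:M : 'M_1) (a%:M : 'M_1) = a%:M.
    by rewrite -[in LHS](scalemx1 1 a) tprodZr tprod1 scalemx1.
  have /par_lettersP[[km Vk]|[km Vk]] := Jk.
    by rewrite km /outer_l simple_act char_left //; exact: sc.
  by rewrite ltnNge ltnW //= /outer_r simple_act char_right //; exact: sc'.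
by apply/eqP => /matrixP/(_ 0 0)/eqP; rewrite !mxE oner_eq0.
Qed.

(** The matrix [E' *m E] projects row vectors onto [U], so membership in [U] becomes a matrix
    equation. *)
Lemma row_basis d (U : {vspace 'rV[F]_d}) : exists (E : 'M[F]_(\dim U, d)) E',
  E *m E' = 1%:M /\ forall y : 'rV_d, y \in U <-> y *m E' *m E = y.
Proof.
pose b := vbasis U; pose E : 'M[F]_(\dim U, d) := \matrix_j b`_j.
have yE (v : 'rV_(\dim U)) : v *m E = \sum_j v 0 j *: b`_j.
  by rewrite mulmx_sum_row; apply: eq_bigr => j _; rewrite rowK.
have Efree : row_free E.
  apply: inj_row_free => v; rewrite yE => e; apply/rowP => j.
  have := basis_free (vbasisP U); rewrite mxE => bfree.
  by rewrite -(coord_sum_free (fun j => v 0 j) j bfree) e linear0.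
exists E, (pinvmx E); split; first exact: mulmxVp.
move=> y; split=> [yU|<-].
  have [v ->] : exists v, y = v *m E.
    exists (\row_j coord b j y); rewrite yE [LHS](coord_vbasis yU).
    by apply: eq_bigr => j _; rewrite mxE.
  by rewrite -(mulmxA v E) mulmxVp // mulmx1.
rewrite yE; apply: memv_suml => j _; apply: memvZ; apply: vbasis_mem.
by rewrite mem_nth ?size_tuple.
Qed.

(* Row vectors on a tensor product are matrices [Y], and the eigenvectors for a
   pair of characters are the [E1^T *m Z *m E2], for [E1] and [E2] bases of
   eigenvectors on the two factors. *)
Lemma hdim_outer (M : rep Hm) (N : rep Hn) L : hdim (outer_rep M N) (simple hB L) =
  (hdim M (simple hm (left_part L)) * hdim N (simple hn (right_part L)))%N.
Proof.
set U1 := hom_space M (simple hm (left_part L)).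
set U2 := hom_space N (simple hn (right_part L)).
have [E1 [E1' [EE1 h1]]] := row_basis U1; have [E2 [E2' [EE2 h2]]] := row_basis U2.
pose vec (Y : 'M[F]_(rdim M, rdim N)) : 'rV[F]_(rdim M * rdim N) :=
  \sum_i \sum_k Y i k *: delta_mx 0 (tidx i k).
have vecE Y i k : vec Y 0 (tidx i k) = Y i k.
  rewrite /vec summxE (bigD1 i) //= summxE (bigD1 k) //= !mxE !eqxx mulr1.
  rewrite big1 => [|k' kk]; last first.
    by rewrite !mxE tidx_eq (eq_sym k) (negPf kk) !andbF mulr0.
  rewrite big1 ?addr0 // => i' ii; rewrite summxE big1 // => k' _.
  by rewrite !mxE tidx_eq (eq_sym i) (negPf ii) andbF mulr0.
have vecP (y z : 'rV[F]_(rdim M * rdim N)) :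
    (forall i k, y 0 (tidx i k) = z 0 (tidx i k)) -> y = z.
  by move=> e; apply/rowP => a; have [i [k ->]] := tidxP a.
have vecM Y (X : 'M_(rdim M)) (Z : 'M_(rdim N)) : vec Y *m tprod X Z = vec (X^T *m Y *m Z).
  apply: vecP => j l; rewrite vecE mxE sum_tidx exchange_big /= mxE.
  apply: eq_bigr => k _; rewrite mxE mulr_suml; apply: eq_bigr => i _.
  by rewrite vecE tprod_tidx mxE mulrA [X in X * _]mulrC.
have vec_surj y : exists Y, y = vec Y.
  by exists (\matrix_(i, k) y 0 (tidx i k)); apply: vecP => i k; rewrite vecE mxE.
have vecZ a Y : a *: vec Y = vec (a *: Y) by apply: vecP => i k; rewrite !(vecE, mxE).
have vec_inj Y Y' : vec Y = vec Y' -> Y = Y'.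
  by move=> e; apply/matrixP => i k; rewrite -vecE e vecE.
have hB_gen (y : 'rV[F]_(rdim M * rdim N)) : hom_mx (M := outer_rep M N) (N := simple hB L) y <->
    forall k, par_letters c m p k -> y *m outer_gen M N k = char hB L (pB k) *: y.
  split=> [/simple_hom h k _|h]; first by rewrite -outer_repE h.
  by apply: (hom_mx_gen hB) => k Jk; rewrite simple_act outer_repE h // mul_scalar_mx.
have hm_gen (y : 'rV[F]_(rdim M)) : y \in U1 <-> forall k, vertex (cdiagram c m) k ->
    y *m ract M (hfam F c m k) = char hB L (pB k) *: y.
  split=> [/hom_spaceP/simple_hom h k Vk|h].
    by rewrite h char_left //; exact: vertex_bound Vk.
  apply/hom_spaceP; apply: (hom_mx_gen hm) => k Vk.
  by rewrite simple_act h // char_left ?mul_scalar_mx //; exact: vertex_bound Vk.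
have hn_gen (y : 'rV[F]_(rdim N)) : y \in U2 <-> forall k, vertex (cdiagram TypeA n) k ->
    y *m ract N (hfam F TypeA n k) = char hB L (pB (m + k)%N) *: y.
  have k0 k : vertex (cdiagram TypeA n) k -> (m < m + k)%N by case/andP; lia.
  have ch k : vertex (cdiagram TypeA n) k ->
      char hn (right_part L) (hfam F TypeA n k) = char hB L (pB (m + k)%N).
    by move=> Vk; have := @char_right L (m + k)%N; rewrite addKn; apply=> //; exact: k0.
  split=> [/hom_spaceP/simple_hom h k Vk|h]; first by rewrite h ch.
  by apply/hom_spaceP; apply: (hom_mx_gen hn) => k Vk; rewrite simple_act h // ch ?mul_scalar_mx.
have homY Y : hom_mx (M := outer_rep M N) (N := simple hB L) (vec Y) <->
    (forall k, row k Y^T \in U1) /\ (forall i, row i Y \in U2).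
  split=> [/hB_gen h|[hl hr]].
    split=> [k|i].
      apply/hm_gen => l Vl; have lm := vertex_bound Vl.
      have /h : par_letters c m p l by apply/par_lettersP; left.
      rewrite /outer_gen lm /outer_l vecM mulmx1 vecZ => /vec_inj e.
      by rewrite -row_mul -[Y^T *m _]trmxK trmx_mul trmxK e linearZ linearZ.
    apply/hn_gen => l Vl; have l0 : (0 < l)%N by case/andP: Vl.
    have /h : par_letters c m p (m + l)%N.
      by apply/par_lettersP; right; rewrite addKn; split=> //; lia.
    rewrite /outer_gen ltnNge leq_addr /= addKn /outer_r vecM trmx1 mul1mx vecZ => /vec_inj e.
    by rewrite -row_mul e linearZ.
  apply/hB_gen => l /par_lettersP[[lm Vl]|[lm Vl]].
    rewrite /outer_gen lm /outer_l vecM mulmx1 vecZ; congr vec.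
    apply: trmx_inj; rewrite trmx_mul trmxK; apply/row_matrixP => k.
    by rewrite row_mul; have /hm_gen-> := hl k; rewrite // -linearZ -linearZ.
  rewrite /outer_gen ltnNge ltnW //= /outer_r vecM trmx1 mul1mx vecZ; congr vec.
  apply/row_matrixP => i; rewrite row_mul; have /hn_gen-> := hr i => //.
  by rewrite subnKC 1?ltnW // -linearZ.
pose g (Z : 'M[F]_(\dim U1, \dim U2)) := vec (E1^T *m Z *m E2).
have gL : linear g.
  move=> a X Z; rewrite /g; apply: vecP => i k; rewrite mulmxDr mulmxDl -scalemxAr -scalemxAl.
  by rewrite !(mxE, vecE).
pose gl := GRing.isLinear.Build F _ _ *:%R g gL.
pose g' : {linear 'M[F]_(\dim U1, \dim U2) -> 'rV[F]_(rdim M * rdim N)} := HB.pack g gl.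
rewrite -[RHS]addn0 -[X in (_ + X)%N](dimv0 'rV[F]_(rdim M * rdim N)).
have -> : (hdim M (simple hm (left_part L)) * hdim N (simple hn (right_part L)))%N =
    \dim {:'M[F]_(\dim U1, \dim U2)} by rewrite dimvf.
apply: (exact_dim (f := linfun g') (g := 0%VF)).
- move=> Z _; rewrite lfunE zero_lfunE /=; split=> //.
  apply: (iffRL (@hom_spaceP _ _ (outer_rep M N) (simple hB L) _)); apply/homY; split=> j.
    apply/h1; rewrite /g !trmx_mul trmxK !row_mul -!mulmxA (mulmxA E1) EE1 mul1mx.
    by rewrite !mulmxA.
  by apply/h2; rewrite /g !row_mul -!mulmxA (mulmxA E2) EE2 mul1mx !mulmxA.
- move=> Z _; rewrite lfunE /= /g => e.
  have {}e : E1^T *m Z *m E2 = 0.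
    by apply: vec_inj; rewrite e; apply: vecP => i k; rewrite vecE !mxE.
  have := congr1 (fun Y => E1'^T *m Y *m E2') e.
  by rewrite mulmx0 mul0mx !mulmxA -trmx_mul EE1 trmx1 mul1mx -mulmxA EE2 mulmx1.
- by move=> u _; rewrite zero_lfunE mem0v.
- by move=> w; rewrite memv0 => /eqP->; exists 0; rewrite ?mem0v ?linear0.
- move=> y /(iffLR (@hom_spaceP _ _ (outer_rep M N) (simple hB L) _)) hy _.
  have [Y eY] := vec_surj y; rewrite eY in hy *.
  have [hl hr] := iffLR (homY Y) hy.
  exists (E1'^T *m Y *m E2'); rewrite ?memvf // lfunE /= /g; congr vec.
  have -> : E1^T *m (E1'^T *m Y *m E2') *m E2 = (Y^T *m E1' *m E1)^T *m E2' *m E2.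
    by rewrite !trmx_mul trmxK !mulmxA.
  have -> : Y^T *m E1' *m E1 = Y^T.
    by apply/row_matrixP => k; rewrite !row_mul; apply/h1.
  by rewrite trmxK; apply/row_matrixP => i; rewrite !row_mul; apply/h2.
Qed.

End Outer.

(** * Dual bases and induction *)

Section DualBasis.
Variables (F : fieldType) (A : algType F).

(* The row [Phi s] lists the coordinates of the [s]-th basis vector of [M] under
   an [A]-linear section of the projection from a free module onto [M]. *)
Definition dual_basis (M : rep A) (Phi : 'I_(rdim M) -> 'I_(rdim M) -> A) :=
  (forall s, \sum_k ract M (Phi s k) *m delta_mx k 0 = delta_mx s 0 :> 'cV_(rdim M)) /\
  (forall a s k, \sum_t ract M a t s *: Phi t k = a * Phi s k).

Lemma projective_dual_basis (M : rep A) : projective M -> exists Phi, @dual_basis M Phi.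
Proof.
move=> prM; pose d := rdim M; pose e (k : 'I_d) : repmod M := (delta_mx k 0 : 'cV_d).
pose U : lmodType A := {ffun 'I_d -> A^o}.
pose g (u : U) : repmod M := \sum_k (u k : A) *: e k.
have gL : linear g.
  move=> a u v; rewrite /g scaler_sumr -big_split; apply: eq_bigr => k _ /=.
  by rewrite !ffunE scalerDl scalerA.
pose gl := GRing.isLinear.Build A U (repmod M) *:%R g gL.
pose g' : {linear U -> repmod M} := HB.pack g gl.
have vE (v : 'cV[F]_d) : v = \sum_k ((v k 0)%:A *: e k : repmod M).
  rewrite [LHS]matrix_sum_delta; apply: eq_bigr => k _.
  by rewrite big_ord1 -repmod_alg.
have [|h hE] := prM U (repmod M) g' idfun.
  move=> v; exists [ffun k => ((v : 'cV_d) k 0)%:A]; rewrite [RHS](vE v) /= /g.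
  by apply: eq_bigr => k _; rewrite ffunE.
exists (fun s k => h (e s) k); split=> [s|a s k].
  by have := hE (e s); rewrite /= /g.
have hZ b x k' : (h (b *: x) : U) k' = b * (h x : U) k'.
  have -> : h (b *: x) = b *: h x by exact: linearZ.
  by rewrite ffunE.
rewrite -hZ.
have -> : a *: e s = \sum_t (ract M a t s)%:A *: e t.
  rewrite repmod_scaleE [LHS](vE _); apply: eq_bigr => t _.
  by rewrite -colE mxE.
rewrite raddf_sum sum_ffunE; apply: eq_bigr => t _.
by rewrite hZ -scalerAl mul1r.
Qed.
End DualBasis.

Lemma dual_basis_gen (F : fieldType) (A : algType F) (J : pred nat) (q : nat -> A) (M : rep A)
    (Phi : 'I_(rdim M) -> 'I_(rdim M) -> A) : hecke_algebra J q ->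
  (forall i, J i -> forall s k, \sum_t ract M (q i) t s *: Phi t k = q i * Phi s k) ->
  forall a s k, \sum_t ract M a t s *: Phi t k = a * Phi s k.
Proof.
move=> hA h; apply: (alg_gen hA) => // [s k|r x y hx hy s k|x y hx hy s k].
- rewrite mul1r rmorph1 (bigD1 s) //= mxE eqxx scale1r big1 ?addr0 // => t ts.
  by rewrite mxE (negPf ts) scale0r.
- rewrite mulrDl -scalerAl -hx -hy scaler_sumr -big_split; apply: eq_bigr => t _.
  by rewrite linearP !mxE scalerDl scalerA.
- rewrite -mulrA -hy mulr_sumr.
  under [RHS]eq_bigr do rewrite -scalerAr -hx scaler_sumr.
  rewrite exchange_big; apply: eq_bigr => t _ /=; rewrite rmorphM !mxE scaler_suml.
  by apply: eq_bigr => u _; rewrite scalerA mulrC.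
Qed.

(** * Modules induced from a subalgebra, and Frobenius reciprocity *)

Section Induction.
Variables (F : fieldType) (A : algType F) (S : set A).
Local Notation B := (subalg S).
Variables (d : nat) (iota : A -> 'rV[F]_d).
Hypothesis iotaL : forall k a b, iota (k *: a + b) = k *: iota a + iota b.
Hypothesis iota_inj : forall a, iota a = 0 -> a = 0.
Variables (R : rep B) (Phi : 'I_(rdim R) -> 'I_(rdim R) -> B).
Hypothesis hPhi : dual_basis Phi.
Local Notation r := (rdim R).
Local Notation T := (btensor (fun (a : A) (b : B) => a * val b)
                       (fun (b : B) (x : repmod R) => b *: x)).
Local Notation bp := (bpure (fun (a : A) (b : B) => a * val b)
                       (fun (b : B) (x : repmod R) => b *: x)).

Let e (k : 'I_r) : repmod R := (delta_mx k 0 : 'cV_r).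
Let phi (k : 'I_r) (x : repmod R) : B := \sum_s (x : 'cV_r) s 0 *: Phi s k.

Lemma bpDl a a' x : bp (a + a') x = bp a x + bp a' x.
Proof. by apply: presZ_relP; exact: btensor_relDl. Qed.
Lemma bpDr a x x' : bp a (x + x') = bp a x + bp a x'.
Proof. by apply: presZ_relP; exact: btensor_relDr. Qed.
Lemma bpM a b x : bp (a * val b) x = bp a (b *: x).
Proof.
apply/eqP; rewrite -subr_eq0; apply/eqP.
have -> : bp (a * val b) x - bp a (b *: x) =
    \pi_(Quotient.quot (zspan (btensor_rel (fun (a : A) (b : B) => a * val b)
      (fun (b : B) (x : repmod R) => b *: x))))
    (<< (a * val b, x) >> - << (a, b *: x) >>) :> T.
  by rewrite !raddfB.
have -> : 0 = \pi_(Quotient.quot (zspan (btensor_rel (fun (a : A) (b : B) => a * val b)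
      (fun (b : B) (x : repmod R) => b *: x)))) 0 :> T by rewrite raddf0.
by apply/eqP; rewrite -Quotient.idealrBE subr0; apply/zspan_gen/btensor_relM.
Qed.

Let phiD k : addm (phi k).
Proof.
by move=> x y; rewrite /phi -big_split; apply: eq_bigr => s _; rewrite mxE scalerDl.
Qed.

Let phiZ k b x : phi k (b *: x) = b * phi k x.
Proof.
rewrite /phi repmod_scaleE mulr_sumr.
under [RHS]eq_bigr do rewrite -scalerAr -(proj2 hPhi) scaler_sumr.
rewrite exchange_big; apply: eq_bigr => t _ /=; rewrite mxE scaler_suml.
by apply: eq_bigr => s _; rewrite scalerA mulrC.
Qed.

Let phi_recon x : \sum_k phi k x *: e k = x.
Proof.
have xE : x = \sum_s (x : 'cV_r) s 0 *: (delta_mx s 0 : 'cV[F]_r) :> 'cV_r.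
  rewrite [LHS]matrix_sum_delta; apply: eq_bigr => s _; exact: big_ord1.
rewrite [RHS]xE -[in RHS](eq_bigr _ (fun s _ => congr1 ( *:%R _) (proj1 hPhi s))).
under [RHS]eq_bigr do rewrite scaler_sumr.
rewrite [RHS]exchange_big; apply: eq_bigr => k _.
rewrite repmod_scaleE /phi linear_sum mulmx_suml; apply: eq_bigr => s _.
by rewrite linearZ -scalemxAl.
Qed.

Let U : lmodType A := {ffun 'I_r -> A^o}.

(** The coordinates of a (x) x in a free module of rank r: the dual basis embeds the induced module
    there, which will make it finite-dimensional. *)
Definition ind_fun (a : A) (x : repmod R) : U := [ffun k => a * val (phi k x)].

Lemma ind_funDl x : addm (ind_fun^~ x).
Proof. by move=> a a'; apply/ffunP => k; rewrite !ffunE mulrDl. Qed.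

Lemma ind_funDr a : addm (ind_fun a).
Proof. by move=> x y; apply/ffunP => k; rewrite !ffunE phiD raddfD mulrDr. Qed.

Let ind_rel t : btensor_rel (fun (a : A) (b : B) => a * val b)
    (fun (b : B) (x : repmod R) => b *: x) t ->
  fglift ((fun ax : A * repmod R => ind_fun ax.1 ax.2) : _ -> zmodule U) t = 0.
Proof.
case=> [a a' x|a x x'|a b x]; rewrite !lift_is_additive !liftU !scale1r /=.
- by rewrite ind_funDl -addrA -opprD subrr.
- by rewrite ind_funDr -addrA -opprD subrr.
- apply/eqP; rewrite subr_eq0; apply/eqP/ffunP => k.
  by rewrite !ffunE phiZ rmorphM mulrA.
Qed.

Definition ind_lift (t : T) : U := presZ_lift (fun ax : A * repmod R => ind_fun ax.1 ax.2) t.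

Lemma ind_liftE a x : ind_lift (bp a x) = ind_fun a x.
Proof. exact: (presZ_lift_gen ind_rel). Qed.

Lemma ind_liftD : addm ind_lift.
Proof. exact: (addm_morphB (presZ_lift_additive ind_rel)). Qed.

Lemma btensor_ind (Q : T -> Prop) : Q 0 -> (forall x y, Q x -> Q y -> Q (x - y)) ->
  (forall a x, Q (bp a x)) -> forall t, Q t.
Proof. by move=> Q0 QB Qp; apply: (presZ_ind (P := Q)) => // -[a x]; exact: Qp. Qed.

(** Writing x as the sum of the phi_k(x) e_k and moving the coefficients across the tensor sign
    recovers an element from its coordinates; injectivity follows. *)
Lemma ind_lift_recon t : \sum_k bp (ind_lift t k) (e k) = t.
Proof.
move: t; apply: btensor_ind => [|t u et eu|a x].
- rewrite (addm0 ind_liftD) big1 // => k _; rewrite ffunE.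
  by apply: (@addrI _ (bp 0 (e k))); rewrite -bpDl !addr0.
- rewrite (addmB ind_liftD) -{2}et -{2}eu -sumrB; apply: eq_bigr => k _.
  have bpl : addm (bp^~ (e k)) by move=> ? ?; exact: bpDl.
  by rewrite !ffunE (addmB bpl).
- rewrite ind_liftE -[x in RHS]phi_recon.
  have bpr : addm (bp a) by move=> ? ?; exact: bpDr.
  by rewrite (addm_sum bpr); apply: eq_bigr => k _; rewrite ffunE bpM.
Qed.

Lemma ind_lift_inj t u : ind_lift t = ind_lift u -> t = u.
Proof. by move=> tu; rewrite -(ind_lift_recon t) tu ind_lift_recon. Qed.

Lemma ind_liftZ a t : exists u, ind_lift u = a *: ind_lift t.
Proof.
move: t; apply: btensor_ind => [|t u [t' et] [u' eu]|a' x].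
- by exists 0; rewrite (addm0 ind_liftD) scaler0.
- by exists (t' - u'); rewrite !(addmB ind_liftD) et eu scalerBr.
- by exists (bp (a * a') x); rewrite !ind_liftE; apply/ffunP => k; rewrite !ffunE -mulrA.
Qed.

Lemma induced_exists : exists (P : rep A) (f : {linear repmod P -> U}) (psi : T -> repmod P),
  [/\ injective f, addm psi, bijective psi & forall t, f (psi t) = ind_lift t].
Proof.
have iota0 : iota 0 = 0 by have := iotaL (-1) 0 0; rewrite scaler0 addr0 scaleN1r addNr.
pose mx (u : U) : 'M[F]_(r, d) := \matrix_(k < r) iota (u k).
have [|x y [t <-] [u <-]|a x [t <-]|k x y|x _ /(congr1 vec_mx)|P [f [finj fS]]] :=
  @rep_of_sub F A U (fun u => exists t, ind_lift t = u) _ (fun u => mxvec (mx u)).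
- by exists 0; exact: addm0 ind_liftD.
- by exists (t + u); exact: ind_liftD.
- exact: ind_liftZ.
- rewrite -linearP; congr mxvec; apply/row_matrixP => i; rewrite linearP /= !rowK !ffunE.
  by rewrite -[_ *: _ in LHS]/(_ * _) -scalerAl mul1r iotaL.
- rewrite mxvecK linear0 => /row_matrixP x0; apply/ffunP => k; rewrite ffunE.
  by apply: iota_inj; have := x0 k; rewrite rowK row0.
have ft t : exists x, f x = ind_lift t by apply/fS; exists t.
pose psi t : repmod P := sval (cid (ft t)).
have psiE t : f (psi t) = ind_lift t := svalP (cid (ft t)).
exists P, f, psi; split=> //.
  move=> t u; apply: finj; have fD x y : f (x + y) = f x + f y by exact: raddfD.
  by rewrite fD !psiE ind_liftD.
have [g gE] : exists g, forall x, ind_lift (g x) = f x.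
  have ex x : exists t, ind_lift t = f x by apply/fS; exists x.
  by exists (fun x => sval (cid (ex x))) => x; exact: svalP (cid (ex x)).
exists g => [t|x]; last by apply: finj; rewrite psiE gE.
by apply: ind_lift_inj; rewrite gE psiE.
Qed.

Section Induced.
Variables (P : rep A) (f : {linear repmod P -> U}) (psi : T -> repmod P).
Hypothesis finj : injective f.
Hypothesis psiD : addm psi.
Hypothesis psi_bij : bijective psi.
Hypothesis psiE : forall t, f (psi t) = ind_lift t.

Lemma psiM a a' x : psi (bp (a' * a) x) = a' *: psi (bp a x).
Proof.
have fZ b y : f (b *: y) = b *: f y by exact: linearZ.
apply: finj; rewrite fZ !psiE !ind_liftE; apply/ffunP => k.
by rewrite !ffunE -mulrA.
Qed.

Lemma inducedP : induced R P.
Proof. by exists psi; split=> // a a' x; exact: psiM. Qed.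

Let psi1 a x : psi (bp a x) = a *: psi (bp 1 x).
Proof. by rewrite -psiM mulr1. Qed.

Let f_recon y : \sum_k (f y k : A) *: psi (bp 1 (e k)) = y.
Proof.
have [g _ gK] := psi_bij; rewrite -[y]gK psiE -[in RHS](ind_lift_recon (g y)).
by rewrite (addm_sum psiD); apply: eq_bigr => k _; rewrite [RHS]psi1.
Qed.

(** By [f_recon] the coordinates of [f] and the elements 1 (x) e_k form a dual basis over [A], so a
    lift may be chosen on these finitely many generators. *)
Lemma induced_projective : projective P.
Proof.
move=> V W g h gsurj; pose u k := sval (cid (gsurj (h (psi (bp 1 (e k)))))).
have gu k : g (u k) = h (psi (bp 1 (e k))) := svalP (cid (gsurj _)).
pose l (y : repmod P) : V := \sum_k (f y k : A) *: u k.
have lL : linear l.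
  move=> a x y; rewrite /l scaler_sumr -big_split; apply: eq_bigr => k _ /=.
  by rewrite linearP !ffunE scalerDl scalerA.
pose ll := GRing.isLinear.Build A (repmod P) V *:%R l lL.
pose l' : {linear repmod P -> V} := HB.pack l ll.
exists l' => y; rewrite /= /l raddf_sum -[in RHS](f_recon y) raddf_sum.
apply: eq_bigr => k _.
have gZ a v : g (a *: v) = a *: g v by exact: linearZ.
have hZ a v : h (a *: v) = a *: h v by exact: linearZ.
by rewrite [LHS]gZ [RHS]hZ gu.
Qed.

(** Frobenius reciprocity: composing with the map from x to 1 (x) x, whose matrix is [X], turns
    homomorphisms from the induced module into homomorphisms from [R]. The inverse evaluates the
    character on the coordinates of [f]. *)
Lemma hdim_induced (J K : pred nat) (p : nat -> A) (p' : nat -> B)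
    (hA : hecke_algebra J p) (hB : hecke_algebra K p') (L : pred nat) :
  (forall k, K k -> J k /\ val (p' k) = p k) ->
  hdim P (simple hA L) = hdim R (simple hB L).
Proof.
move=> KJ; have chE b : char hA L (val b) = char hB L b.
  have lin k x y : char hA L (val (k *: x + y : B)) =
      k * char hA L (val x) + char hA L (val y).
    by rewrite linearP charL.
  move: b; apply: (alg_eq hB (s := fun k (x : F) => k * x) (f := fun b => char hA L (val b))) => //.
  - by move=> k x y; exact: charL.
  - by move=> x y; rewrite rmorphM charM.
  - by move=> x y; exact: charM.
  - by rewrite rmorph1 !char1.
  - by move=> i Ki; have [Ji ->] := KJ i Ki; rewrite !charp Ji Ki.
pose X : 'M[F]_(rdim P, r) := \matrix_(i, j) (psi (bp 1 (e j)) : 'cV_(rdim P)) i 0.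
have XE x : X *m (x : 'cV_r) = psi (bp 1 x).
  have bpr : addm (fun x => psi (bp 1 x)) by move=> y z /=; rewrite bpDr psiD.
  have xE : x = \sum_s ((x : 'cV_r) s 0)%:A *: e s.
    rewrite [LHS]matrix_sum_delta; apply: eq_bigr => s _.
    by rewrite big_ord1 -(repmod_alg (M := R)).
  rewrite [in RHS]xE (addm_sum bpr) /=; apply/colP => i; rewrite mxE summxE.
  apply: eq_bigr => j _; rewrite -bpM mul1r psi1.
  have valZ k (b : B) : val (k *: b) = k *: val b by exact: linearZ.
  have -> : val (((x : 'cV_r) j 0)%:A : B) = (x j 0)%:A :> A by rewrite valZ rmorph1.
  by rewrite repmod_alg !mxE mulrC.
have hom_e (s : 'rV_(rdim P)) : hom_mx (N := simple hA L) s ->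
    forall y, s *m y = \sum_k char hA L (f y k) *: (s *m (X *m e k)).
  move=> /simple_hom hs y; rewrite -[y in LHS]f_recon mulmx_sumr; apply: eq_bigr => k _.
  by rewrite repmod_scaleE mulmxA hs -scalemxAl XE.
suff : hdim R (simple hB L) =
    (\dim (hom_space P (simple hA L)) + \dim (0%VS : {vspace 'rV[F]_r}))%N.
  by rewrite dimv0 addn0 => ->.
apply: (exact_dim (f := linfun (mulmxr X)) (g := 0%VF)).
- move=> s /(iffLR (@hom_spaceP _ _ P (simple hA L) _)) /simple_hom hs.
  rewrite lfunE zero_lfunE; split=> //.
  apply: (iffRL (@hom_spaceP _ _ R (simple hB L) _)); apply/simple_hom => b /=.
  apply: mx_eq_col => j; rewrite -!mulmxA -[ract R b *m _]/(b *: e j) XE -bpM mul1r.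
  by rewrite psi1 repmod_scaleE mulmxA hs -!scalemxAl chE -mulmxA XE.
- move=> s /(iffLR (@hom_spaceP _ _ P (simple hA L) _)) hs; rewrite lfunE /= => sX.
  apply: mx_eq_col => j; rewrite (hom_e s hs) mul0mx big1 // => k _.
  by rewrite mulmxA sX mul0mx scaler0.
- by move=> u _; rewrite zero_lfunE mem0v.
- by move=> w; rewrite memv0 => /eqP->; exists 0; rewrite ?mem0v ?linear0.
- move=> s /(iffLR (@hom_spaceP _ _ R (simple hB L) _)) /simple_hom hs _.
  pose h (y : repmod P) : repmod (simple hA L) :=
    \sum_k char hA L (f y k) *: (s *m (e k : 'cV_r) : 'cV_1).
  have hL : linear h.
    move=> a x y; rewrite [a *: h x]repmod_scaleE simple_act mul_scalar_mx scaler_sumr.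
    rewrite -big_split; apply: eq_bigr => k _ /=; rewrite linearP !ffunE.
    rewrite -[a *: (f x k : A^o)]/(a * (f x k : A)) -[a * _]scale1r charL mul1r charM.
    by rewrite scalerDl scalerA.
  pose hl := GRing.isLinear.Build A (repmod P) (repmod (simple hA L)) *:%R h hL.
  pose h' : {linear repmod P -> repmod (simple hA L)} := HB.pack h hl.
  have [s' hs' s'E] := lin_mx h'; exists s'.
    exact: (iffRL (@hom_spaceP _ _ P (simple hA L) _)).
  rewrite lfunE /=; apply: mx_eq_col => j.
  rewrite -mulmxA -[delta_mx j 0]/(e j) XE -s'E /= /h psiE ind_liftE.
  rewrite -[e j in RHS]phi_recon mulmx_sumr; apply: eq_bigr => k _.
  by rewrite ffunE mul1r chE repmod_scaleE mulmxA hs scalemxAl.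
Qed.

End Induced.
End Induction.

(** * Induction of outer tensor products *)

(** Signed permutations are used in rank greater than 1; adding 2 to the degree secures this in
    degrees 0 and 1 too. *)
Lemma vertex_bound2 c n i : vertex (cdiagram c n) i -> (i < n.+2)%N.
Proof. by move/vertex_bound => h; do 2!apply: ltnW. Qed.

Lemma par_letters_bound2 c m p i : par_letters c m p i -> (i < p.+2)%N.
Proof. by case/andP => /vertex_bound2. Qed.

Section OuterInduced.
Variables (F : fieldType) (c : family) (m n p : nat).
Hypothesis lo_m : (lo c <= m)%N.
Hypothesis mnp : (m + n)%N = p.
Local Notation Hm := (H0 F c m).
Local Notation Hn := (H0 F TypeA n).
Local Notation B := (subalg (@par_gens F c m p)).
Local Notation pB := (pfam F c m p).
Local Notation hB := (pfam_algebra F c m p).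
Local Notation hm := (hfam_algebra F c m).
Local Notation hn := (hfam_algebra F TypeA n).

Let cst (k : F) : B := k%:A.

Let cstD a b : cst (a + b) = cst a + cst b. Proof. exact: scalerDl. Qed.
Let cstM a b : cst (a * b) = cst a * cst b.
Proof. by rewrite /cst mulr_algl scalerA. Qed.
Let cst1 : cst 1 = 1. Proof. exact: scale1r. Qed.
Let cstC a x : cst a * x = x * cst a.
Proof. by rewrite /cst mulr_algl mulr_algr. Qed.

Lemma left_embedding : exists f : Hm -> B, [/\ forall x y, f (x + y) = f x + f y,
  forall x y, f (x * y) = f x * f y, forall a x, f (a *: x) = a%:A * f x,
  f 1 = 1 & forall i, f (hfam F c m i) = if vertex (cdiagram c m) i then pB i else 1].
Proof.
apply: hfam_univ => // [|i /negPf-> //].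
have h := pfam_family F c m p; split=> [i|i j e|i j e]; do !case: ifP => // _;
  rewrite ?mulr1 ?mul1r ?(fam_idem h) //.
- exact: (fam_braid h).
- exact: (fam_comm h).
Qed.

Lemma right_embedding : exists f : Hn -> B, [/\ forall x y, f (x + y) = f x + f y,
  forall x y, f (x * y) = f x * f y, forall a x, f (a *: x) = a%:A * f x,
  f 1 = 1 & forall i, f (hfam F TypeA n i) =
    if vertex (cdiagram TypeA n) i then pB (m + i)%N else 1].
Proof.
apply: hfam_univ => // [|i /negPf-> //].
have edge_shift i j : vertex (cdiagram TypeA n) i -> vertex (cdiagram TypeA n) j ->
  edgeD (m + i) (m + j) = edgeD i j.
  by case: i => [|i] //; case: j => [|j] //= _ _; rewrite !addnS /= -!addnS !eqn_add2l.
have h := pfam_family F c m p; split=> [i|i j e|i j e];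
  do !(case: ifP => ?); rewrite ?mulr1 ?mul1r ?(fam_idem h) //.
- by apply: (fam_braid h); rewrite edge_shift.
- by apply: (fam_comm h); rewrite edge_shift.
Qed.

(** The two algebras map to [B] with commuting images, and the products of the two dual bases form a
    dual basis of the outer tensor product. *)
Lemma outer_dual_basis (M : rep Hm) (N : rep Hn) : projective M -> projective N ->
  exists Phi, @dual_basis F B (outer_rep lo_m mnp M N) Phi.
Proof.
move=> /projective_dual_basis[Phi [Phi1 Phi2]] /projective_dual_basis[Psi [Psi1 Psi2]].
have [i1 [i1D i1M i1Z i11 i1p]] := left_embedding.
have [i2 [i2D i2M i2Z i21 i2p]] := right_embedding.
set R := outer_rep _ _ _ _.
have actP k x y : ract R (k *: x + y) = k *: ract R x + ract R y by exact: linearP.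
have i1L k x y : i1 (k *: x + y) = k *: i1 x + i1 y by rewrite i1D i1Z mulr_algl.
have i2L k x y : i2 (k *: x + y) = k *: i2 x + i2 y by rewrite i2D i2Z mulr_algl.
have acM x y : ract R (x * y) = ract R x *m ract R y by exact: rmorphM.
have R1 a : ract R (i1 a) = tprod (ract M a) 1%:M.
  move: a; apply: (alg_eq hm (s := fun k x => k *: x)
    (g := fun a => tprod (ract M a) 1%:M : 'M_(rdim M * rdim N))) => [k x y|k x y|x y|x y||i Vi].
  - by rewrite i1L actP.
  - by rewrite linearP tprodDl tprodZl.
  - by rewrite i1M acM.
  - by rewrite rmorphM -tprodMl.
  - by rewrite i11 rmorph1; have /= -> := rmorph1 (ract M); rewrite tprod1.
  - by rewrite i1p Vi outer_repE /outer_gen (vertex_bound Vi).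
have R2 a : ract R (i2 a) = tprod 1%:M (ract N a).
  move: a; apply: (alg_eq hn (s := fun k x => k *: x)
    (g := fun a => tprod 1%:M (ract N a) : 'M_(rdim M * rdim N))) => [k x y|k x y|x y|x y||i Vi].
  - by rewrite i2L actP.
  - by rewrite linearP tprodDr tprodZr.
  - by rewrite i2M acM.
  - by rewrite rmorphM -tprodMr.
  - by rewrite i21 rmorph1; have /= -> := rmorph1 (ract N); rewrite tprod1.
  - by rewrite i2p Vi outer_repE /outer_gen ltnNge leq_addr /= addKn.
have gen_comm i k : (m < k)%N -> vertex (cdiagram TypeA n) (k - m)%N ->
    vertex (cdiagram c m) i -> pB k * pB i = pB i * pB k.
  move=> km Vk Vi; apply: (fam_comm (pfam_family F c m p)).
  have im := vertex_bound Vi; move: lo_m km Vi im; case: (c) => /=;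
    case: i => [|i]; case: (k) => [|k'] //=; lia.
have pB_i1 k a : (m < k)%N -> vertex (cdiagram TypeA n) (k - m)%N ->
    pB k * i1 a = i1 a * pB k.
  move=> km Vk; move: a; apply: (alg_gen hm) => [|r x y hx hy|x y hx hy|i Vi].
  - by rewrite i11 mulr1 mul1r.
  - by rewrite i1L mulrDr mulrDl -scalerAr -scalerAl hx hy.
  - by rewrite i1M mulrA hx -mulrA hy mulrA.
  - by rewrite i1p Vi gen_comm.
pose fst_ (a : 'I_(rdim M * rdim N)) : 'I_(rdim M) := sval (cid (tidxP a)).
pose snd_ (a : 'I_(rdim M * rdim N)) : 'I_(rdim N) := sval (cid (svalP (cid (tidxP a)))).
have fsE a : a = tidx (fst_ a) (snd_ a) := svalP (cid (svalP (cid (tidxP a)))).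
have fsT i k : fst_ (tidx i k) = i /\ snd_ (tidx i k) = k.
  by have /eqP := fsE (tidx i k); rewrite tidx_eq => /andP[/eqP<- /eqP<-].
have fstT i k : fst_ (tidx i k) = i := proj1 (fsT i k).
have sndT i k : snd_ (tidx i k) = k := proj2 (fsT i k).
exists (fun a b => i1 (Phi (fst_ a) (fst_ b)) * i2 (Psi (snd_ a) (snd_ b))); split.
  move=> a; rewrite (fsE a); set s := fst_ a; set s' := snd_ a.
  rewrite sum_tidx; apply/colP => b; rewrite [b]fsE; set i := fst_ b; set i' := snd_ b.
  have E1 : \sum_k ract M (Phi s k) i k = (i == s)%:R.
    have /colP/(_ i) := Phi1 s; rewrite !mxE eqxx andbT summxE => <-.
    by apply: eq_bigr => k _; rewrite -colE mxE.
  have E2 : \sum_k ract N (Psi s' k) i' k = (i' == s')%:R.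
    have /colP/(_ i') := Psi1 s'; rewrite !mxE eqxx andbT summxE => <-.
    by apply: eq_bigr => k _; rewrite -colE mxE.
  rewrite summxE [RHS]mxE eqxx andbT tidx_eq -mulnb natrM -E1 -E2 mulr_suml.
  apply: eq_bigr => k _; rewrite summxE mulr_sumr; apply: eq_bigr => k' _.
  by rewrite !fstT !sndT acM R1 R2 -colE mxE -tprodE mulmx1 mul1mx tprod_tidx.
apply: (dual_basis_gen hB) => i Vi a b.
rewrite sum_tidx; rewrite (fsE a); set s := fst_ a; set s' := snd_ a.
rewrite !fstT !sndT.
have /(par_lettersP lo_m mnp)[[im Vim]|[im Vim]] := Vi.
  have -> : pB i = i1 (hfam F c m i) by rewrite i1p Vim.
  rewrite mulrA -i1M -Phi2.
  have -> : i1 (\sum_t ract M (hfam F c m i) t s *: Phi t (fst_ b)) =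
      \sum_t ract M (hfam F c m i) t s *: i1 (Phi t (fst_ b)).
    by rewrite (addm_sum i1D); apply: eq_bigr => t _; rewrite i1Z mulr_algl.
  rewrite mulr_suml; apply: eq_bigr => t _.
  rewrite (bigD1 s') //= big1 ?addr0 => [|t' ts].
    by rewrite !fstT !sndT R1 tprod_tidx mxE eqxx mulr1 scalerAl.
  by rewrite R1 tprod_tidx mxE (negPf ts) mulr0 scale0r.
rewrite mulrA pB_i1 // -mulrA.
have -> : pB i = i2 (hfam F TypeA n (i - m)%N) by rewrite i2p Vim subnKC // ltnW.
rewrite -i2M -Psi2.
have -> : i2 (\sum_t ract N (hfam F TypeA n (i - m)) t s' *: Psi t (snd_ b)) =
    \sum_t ract N (hfam F TypeA n (i - m)) t s' *: i2 (Psi t (snd_ b)).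
  by rewrite (addm_sum i2D); apply: eq_bigr => t _; rewrite i2Z mulr_algl.
rewrite (bigD1 s) //= [X in _ + X]big1 ?addr0 => [|t ts].
  rewrite mulr_sumr; apply: eq_bigr => t' _.
  by rewrite !fstT !sndT R2 tprod_tidx mxE eqxx mul1r scalerAr.
by rewrite big1 // => t' _; rewrite R2 tprod_tidx mxE (negPf ts) mul0r scale0r.
Qed.

Lemma outer_induced (M : prep Hm) (N : prep Hn) : exists P : prep (H0 F c p),
  induced (outer_rep lo_m mnp M N) P /\ forall L,
  hdim P (simple (hfam_algebra F c p) L) =
    (hdim M (simple hm (left_part m L)) * hdim N (simple hn (right_part m L)))%N.
Proof.
have [Phi hPhi] := outer_dual_basis (@prepP _ _ M) (@prepP _ _ N).
pose iota := @coords F _ _ _ (hfam_algebra F c p) p.+2 isT (@vertex_bound2 c p).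
have iota_inj a : iota a = 0 -> a = 0.
  by rewrite /iota -(coords0 (hfam_algebra F c p) (isT : (1 < p.+2)%N) (@vertex_bound2 c p)) => /coords_inj.
have [P [f [psi [finj psiD psib psiE]]]] := induced_exists
  (@coordsL F _ _ _ (hfam_algebra F c p) p.+2 isT (@vertex_bound2 c p)) iota_inj hPhi.
exists (PRep (induced_projective hPhi finj psiD psib psiE)); split.
  exact: (inducedP hPhi finj psiD psib psiE).
move=> L; rewrite -(hdim_outer lo_m mnp).
apply: (hdim_induced hPhi finj psiD psib psiE) => k Kk.
by case/andP: (Kk) => Vk /negPf km; rewrite val_pfam km.
Qed.
End OuterInduced.

(** * Induction and restriction on Grothendieck groups *)

Lemma G0_class_simple_ext (F : fieldType) (A : algType F) (J : pred nat) (q : nat -> A)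
    (hA : hecke_algebra J q) (I K : nat -> bool) : (forall i, J i -> I i = K i) ->
  G0_class (simple hA I) = G0_class (simple hA K).
Proof.
move=> IK; apply: (@G0_class_simple _ _ _ _ hA (simple hA I) K (1%:M : 'M_1)) => //.
  by apply: (hom_mx_gen hA) => i Ji; rewrite mulmx1 mul1mx !simple_act !charp Ji IK.
by apply/eqP => /matrixP/(_ 0 0)/eqP; rewrite !mxE oner_eq0.
Qed.

Section GrothendieckMaps.
Variables (F : fieldType) (c : family) (m n p : nat).
Hypothesis lo_m : (lo c <= m)%N.
Hypothesis mnp : (m + n)%N = p.
Local Notation Hm := (H0 F c m).
Local Notation Hn := (H0 F TypeA n).
Local Notation Hp := (H0 F c p).
Local Notation B := (subalg (@par_gens F c m p)).
Local Notation pB := (pfam F c m p).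
Local Notation hB := (pfam_algebra F c m p).
Local Notation hm := (hfam_algebra F c m).
Local Notation hn := (hfam_algebra F TypeA n).
Local Notation hp := (hfam_algebra F c p).
Local Notation Vm := (vertex (cdiagram c m)).
Local Notation Vn := (vertex (cdiagram TypeA n)).
Local Notation Vp := (vertex (cdiagram c p)).

(** The flag [b] decides whether m is a descent; the test [Vp k] disables it when m is no letter in
    degree p, that is for n = 0, or for m = 0 in type A. *)
Lemma glue_subproof (b : bool) (I : subset Vm) (K : subset Vn) :
  `[< forall k, [|| (k < m)%N && I k, (m < k)%N && K (k - m)%N |
    [&& b, k == m & Vp k]] -> Vp k >].
Proof.
apply/asboolP => k /or3P[/andP[km /subsetP Ik]|/andP[km /subsetP Kk]|/and3P[] //].
  by have /andP[] : par_letters c m p k by apply/(par_lettersP lo_m mnp); left.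
by have /andP[] : par_letters c m p k by apply/(par_lettersP lo_m mnp); right.
Qed.
Definition glue b I K : subset Vp := Subset (@glue_subproof b I K).

Lemma left_glue b I K : left_part m (glue b I K) = I.
Proof.
apply/funext => k; rewrite /left_part /=; case: ltngtP => km //=; rewrite ?andbT ?andbF ?orbF //.
  by apply/esym/negP => /subsetP/vertex_bound; rewrite ltnNge ltnW.
by apply/esym/negP => /subsetP/vertex_bound; rewrite km ltnn.
Qed.

Lemma right_glue b I K : right_part m (glue b I K) = K.
Proof.
apply/funext => k; rewrite /right_part /=; case: k => [|k] /=.
  by apply/esym/negP => /subsetP.
have h1 : (m < m + k.+1)%N by rewrite addnS ltnS leq_addr.
by rewrite addKn h1 ltnNge ltnW //= (gtn_eqF h1) !andbF !orbF.
Qed.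

Lemma left_subproof (L : nat -> bool) : (forall k, L k -> Vp k) ->
  `[< forall k, left_part m L k -> Vm k >].
Proof.
move=> LV; apply/asboolP => k /andP[/LV Vk km].
have /(par_lettersP lo_m mnp)[[]//|[]] : par_letters c m p k.
  by rewrite /par_letters Vk neq_ltn km.
by rewrite ltnNge ltnW.
Qed.
Definition left_sub (L : subset Vp) : subset Vm := Subset (left_subproof (@subsetP _ L)).

Lemma right_subproof (L : nat -> bool) : (forall k, L k -> Vp k) ->
  `[< forall k, right_part m L k -> Vn k >].
Proof.
move=> LV; apply/asboolP => k /andP[k0 /LV Vk].
have /(par_lettersP lo_m mnp)[[]|[_]] : par_letters c m p (m + k)%N.
- by rewrite /par_letters Vk; lia.
- by rewrite ltnNge leq_addr.
- by rewrite addKn.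
Qed.
Definition right_sub (L : subset Vp) : subset Vn := Subset (right_subproof (@subsetP _ L)).

Lemma glue_eq b (I : subset Vm) (K : subset Vn) (L : subset Vp) : left_sub L = I -> right_sub L = K ->
  L m = b && Vp m -> L = glue b I K.
Proof.
move=> <- <- Lm; apply: val_inj; apply/funext => k /=; rewrite /left_part /right_part.
case: (ltngtP k m) => [km|km|->] /=; rewrite ?andbT ?andbF ?orbF //.
by rewrite subn_gt0 km /= subnKC // ltnW.
Qed.

Definition outer_class (u : G0 Hm) (v : G0 Hn) : G0 B :=
  G0_lift (fun M => G0_lift (fun N => G0_class (outer_rep lo_m mnp M N)) v) u.

Let outer_class_r (M : rep Hm) : forall N' N N'' : rep Hn, short_exact N' N N'' ->
  G0_class (outer_rep lo_m mnp M N) =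
  G0_class (outer_rep lo_m mnp M N') + G0_class (outer_rep lo_m mnp M N'').
Proof. by move=> N' N N'' e; apply/G0_exact/outer_exact_r. Qed.

Let outer_class_l (v : G0 Hn) (M' M M'' : rep Hm) : short_exact M' M M'' ->
  G0_lift (fun N => G0_class (outer_rep lo_m mnp M N)) v =
  G0_lift (fun N => G0_class (outer_rep lo_m mnp M' N)) v +
  G0_lift (fun N => G0_class (outer_rep lo_m mnp M'' N)) v.
Proof.
move=> e; have LD M1 := G0_liftD (outer_class_r M1).
move: v; apply: G0_ind => [|x y ex ey|N].
- by rewrite !(addm0 (LD _)) addr0.
- by rewrite !(addmB (LD _)) ex ey opprD addrACA.
- by rewrite !(G0_liftE (outer_class_r _)); exact/G0_exact/outer_exact_l.
Qed.

Lemma outer_classE (M : rep Hm) (N : rep Hn) :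
  outer_class (G0_class M) (G0_class N) = G0_class (outer_rep lo_m mnp M N).
Proof.
rewrite /outer_class (G0_liftE (outer_class_l (G0_class N))).
exact: (G0_liftE (outer_class_r _)).
Qed.

Lemma outer_class_bi : biadditive outer_class.
Proof.
have LD v : addm (outer_class^~ v) := G0_liftD (outer_class_l v).
split=> [u|v]; last exact: (LD v).
move: u; apply: G0_ind => [v v'|x y ex ey v v'|M v v'].
- by rewrite !(addm0 (LD _)) addr0.
- by rewrite !(addmB (LD _)) ex ey opprD addrACA.
- rewrite /outer_class !(G0_liftE (outer_class_l _)).
  exact: (G0_liftD (outer_class_r M)).
Qed.

Definition join_class (t : tensor (G0 Hm) (G0 Hn)) : G0 B := tlift outer_class t.

Let zbm := G0_zbasis hm (isT : (1 < m.+2)%N) (@vertex_bound2 c m).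
Let zbn := G0_zbasis hn (isT : (1 < n.+2)%N) (@vertex_bound2 TypeA n).
Let zbB := G0_zbasis hB (isT : (1 < p.+2)%N) (@par_letters_bound2 c m p).

(** The inverse of [join_class], prescribed on the simples of the parabolic subalgebra, each of
    which has the class of an outer product by [outer_simple]. *)
Definition split_class (x : G0 B) : tensor (G0 Hm) (G0 Hn) :=
  zlift zbB (fun L : subset _ => pure (G0_class (simple hm (left_part m L)))
                            (G0_class (simple hn (right_part m L)))) x.

Lemma split_classD : addm split_class.
Proof. exact: zliftD. Qed.

Lemma join_classD : addm join_class.
Proof. exact: tliftD outer_class_bi. Qed.

Lemma split_class_simple (L : nat -> bool) : split_class (G0_class (simple hB L)) =
  pure (G0_class (simple hm (left_part m L))) (G0_class (simple hn (right_part m L))).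
Proof.
pose L' := subset_trim (par_letters c m p) L.
rewrite (@G0_class_simple_ext _ _ _ _ hB L L') => [|i Ji]; last by rewrite /= Ji.
rewrite /split_class (zliftE zbB _ L'); congr pure; apply: G0_class_simple_ext => i Vi.
  have im := vertex_bound Vi; rewrite /left_part im !andbT /=.
  suff -> : par_letters c m p i by [].
  by apply/(par_lettersP lo_m mnp); left.
rewrite /right_part /=; have i0 : (0 < i)%N by case/andP: Vi.
suff -> : par_letters c m p (m + i)%N by [].
by apply/(par_lettersP lo_m mnp); right; rewrite addKn; split=> //; lia.
Qed.

Lemma split_classK : cancel split_class join_class.
Proof.
move=> x; move: x; apply: (zb_eq zbB) => // [|L].
  exact: addm_comp join_classD split_classD.
by rewrite split_class_simple /join_class (tlift_pure outer_class_bi) outer_classE outer_simple.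
Qed.

Lemma join_classK : cancel join_class split_class.
Proof.
move=> t; move: t; apply: tensor_eq => // [|u v].
  exact: addm_comp split_classD join_classD.
rewrite /join_class (tlift_pure outer_class_bi); move: u v.
apply: (biadd_eq zbm zbn (g := @pure _ _) _ (@pure_bi _ _)) => [|I K].
  have [r l] := outer_class_bi.
  by split=> [u v v'|v u u']; rewrite ?r ?l split_classD.
rewrite outer_classE -(left_glue false I K) -(right_glue false I K) outer_simple.
by rewrite split_class_simple left_glue right_glue.
Qed.

Lemma join_class_identification : is_identification join_class.
Proof.
split; first exact: join_classD.
  by exists split_class; [exact: join_classK|exact: split_classK].
move=> M N; exists (outer_rep lo_m mnp M N); first exact: outerP.
by rewrite /join_class (tlift_pure outer_class_bi) outer_classE.
Qed.

Let restrict_rel (M' M M'' : rep Hp) : short_exact M' M M'' ->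
  G0_class (restrict (@par_gens F c m p) M) =
  G0_class (restrict (@par_gens F c m p) M') + G0_class (restrict (@par_gens F c m p) M'').
Proof.
move=> /short_exactP[X [Z [Y [W [hX hZ YX ZW e]]]]]; apply: G0_exact.
apply/short_exactP; exists X, Z, Y, W; split=> // b; [exact: hX|exact: hZ].
Qed.

Definition restrict_class (x : G0 Hp) : tensor (G0 Hm) (G0 Hn) :=
  split_class (G0_lift (fun Q => G0_class (restrict (@par_gens F c m p) Q)) x).

Lemma restrict_classD : addm restrict_class.
Proof. exact: addm_comp split_classD (G0_liftD restrict_rel). Qed.

Lemma restrict_classE (Q : rep Hp) :
  join_class (restrict_class (G0_class Q)) = G0_class (restrict (@par_gens F c m p) Q).
Proof. by rewrite /restrict_class split_classK (G0_liftE restrict_rel). Qed.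

Lemma restrict_class_simple (L : nat -> bool) : restrict_class (G0_class (simple hp L)) =
  pure (G0_class (simple hm (left_part m L))) (G0_class (simple hn (right_part m L))).
Proof.
rewrite /restrict_class (G0_liftE restrict_rel) -split_class_simple; congr split_class.
apply: (@G0_class_simple _ _ _ _ hB (restrict _ (simple hp L)) L (1%:M : 'M_1)) => //.
  apply: (hom_mx_gen hB) => i Ji; rewrite mulmx1 mul1mx.
  have rE (b : B) : ract (restrict (@par_gens F c m p) (simple hp L)) b =
    (char hp L (val b))%:M by exact: simple_act.
  rewrite rE simple_act val_pfam; have /andP[Vi /negPf->] := Ji.
  by rewrite !charp Vi Ji.
by apply/eqP => /matrixP/(_ 0 0)/eqP; rewrite !mxE oner_eq0.
Qed.

Definition ind_prep (M : prep Hm) (N : prep Hn) : prep Hp :=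
  sval (cid (outer_induced lo_m mnp M N)).

Lemma ind_prepP (M : prep Hm) (N : prep Hn) : induced (outer_rep lo_m mnp M N) (ind_prep M N).
Proof. by have [] := svalP (cid (outer_induced lo_m mnp M N)). Qed.

Lemma hdim_ind_prep (M : prep Hm) (N : prep Hn) L : hdim (ind_prep M N) (simple hp L) =
  (hdim M (simple hm (left_part m L)) * hdim N (simple hn (right_part m L)))%N.
Proof. by have [] := svalP (cid (outer_induced lo_m mnp M N)). Qed.

Let K0sepp := @K0_sep F Hp Vp (hfam F c p) hp p.+2 (isT : (1 < p.+2)%N) (@vertex_bound2 c p).

(** Multiplicativity of the Hom dimensions in [hdim_ind_prep] makes induction additive in each
    argument. *)
Let ind_r (M : prep Hm) : forall N' N N'' : prep Hn, short_exact N' N N'' ->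
  K0_class (ind_prep M N) = K0_class (ind_prep M N') + K0_class (ind_prep M N'').
Proof.
move=> N' N N'' e; apply: K0sepp => L; rewrite K0_pairD !K0_pairE !hdim_ind_prep.
by rewrite (hdim_exact_l _ (@prepP _ _ N'') e) mulnDr PoszD.
Qed.

Let ind_l (v : K0 Hn) (M' M M'' : prep Hm) : short_exact M' M M'' ->
  K0_lift (fun N => K0_class (ind_prep M N)) v =
  K0_lift (fun N => K0_class (ind_prep M' N)) v + K0_lift (fun N => K0_class (ind_prep M'' N)) v.
Proof.
move=> e; have LD M1 := K0_liftD (@ind_r M1).
move: v; apply: K0_ind => [|x y ex ey|N].
- by rewrite !(addm0 (LD _)) addr0.
- by rewrite !(addmB (LD _)) ex ey opprD addrACA.
- rewrite !(K0_liftE (@ind_r _)); apply: K0sepp => L.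
  rewrite K0_pairD !K0_pairE !hdim_ind_prep.
  by rewrite (hdim_exact_l _ (@prepP _ _ M'') e) mulnDl PoszD.
Qed.

Definition ind_class (u : K0 Hm) (v : K0 Hn) : K0 Hp :=
  K0_lift (fun M => K0_lift (fun N => K0_class (ind_prep M N)) v) u.

Lemma ind_classE (M : prep Hm) (N : prep Hn) : ind_class (K0_class M) (K0_class N) = K0_class (ind_prep M N).
Proof.
rewrite /ind_class (K0_liftE (@ind_l (K0_class N))).
exact: (K0_liftE (@ind_r _)).
Qed.

Lemma ind_class_bi : biadditive ind_class.
Proof.
have LD v : addm (ind_class^~ v) := K0_liftD (@ind_l v).
split=> [u|v]; last exact: (LD v).
move: u; apply: K0_ind => [v v'|x y ex ey v v'|M v v'].
- by rewrite !(addm0 (LD _)) addr0.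
- by rewrite !(addmB (LD _)) ex ey opprD addrACA.
- rewrite /ind_class !(K0_liftE (@ind_l _)).
  exact: (K0_liftD (@ind_r M)).
Qed.

Local Notation pimm := (pim hm (isT : (1 < m.+2)%N) (@vertex_bound2 c m)).
Local Notation pimn := (pim hn (isT : (1 < n.+2)%N) (@vertex_bound2 TypeA n)).
Local Notation pimp := (pim hp (isT : (1 < p.+2)%N) (@vertex_bound2 c p)).

(** Paired with the simple of [L], the left side gives 1 exactly if [L] induces [I] and [K] on the
    two sides of m. Such an [L] is determined by its value at m, which is free only if m is a
    letter. *)
Lemma ind_class_pim (I : subset Vm) (K : subset Vn) :
  ind_class (K0_class (pimm I)) (K0_class (pimn K)) =
  K0_class (pimp (glue false I K)) + (if Vp m then K0_class (pimp (glue true I K)) else 0).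
Proof.
rewrite ind_classE; apply: K0sepp => L; rewrite K0_pairD !K0_pairE hdim_ind_prep.
have -> : left_part m L = left_sub L by [].
have -> : right_part m L = right_sub L by [].
rewrite !hdim_delta.
have -> : K0_pair (if Vp m then K0_class (pimp (glue true I K)) else 0) (simple hp L) =
    (Vp m && (glue true I K == L))%:Z.
  by case: ifP => _; rewrite ?(addm0 (K0_pairD _)) // K0_pairE hdim_delta.
have glm b : (glue b I K == L) -> L m = b && Vp m.
  by move/eqP <-; rewrite /= ltnn eqxx.
have gll b : (glue b I K == L) -> left_sub L = I.
  by move/eqP <-; apply: val_inj; exact: left_glue.
have glr b : (glue b I K == L) -> right_sub L = K.
  by move/eqP <-; apply: val_inj; exact: right_glue.
have [IL|IL] := eqVneq I (left_sub L); last first.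
  rewrite mul0n; case: eqVneq => [/eqP/gll e|_]; first by rewrite e eqxx in IL.
  by case: (glue true I K =P L) => [/eqP/gll e|_]; [rewrite e eqxx in IL|rewrite andbF].
have [KL|KL] := eqVneq K (right_sub L); last first.
  rewrite muln0; case: eqVneq => [/eqP/glr e|_]; first by rewrite e eqxx in KL.
  by case: (glue true I K =P L) => [/eqP/glr e|_]; [rewrite e eqxx in KL|rewrite andbF].
case Lm : (L m).
  have Vm' : Vp m by exact: subsetP Lm.
  have e : glue true I K = L by apply/esym/glue_eq; rewrite ?Lm ?Vm'.
  have -> : (glue false I K == L) = false by apply/negP => /glm; rewrite Lm.
  by rewrite e eqxx Vm'.
have e : glue false I K = L by apply/esym/glue_eq; rewrite ?Lm.
rewrite e eqxx; case Vm' : (Vp m) => //=.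
have -> : (glue true I K == L) = false by apply/negP => /glm; rewrite Lm Vm'.
by [].
Qed.

End GrothendieckMaps.

(** * Words in the Coxeter generators *)

Section CoxeterWords.
Variables (c : family) (n : nat).
Local Notation G := (cdiagram c n).
Local Notation V := (vertex G).
Local Notation N1 := (isT : (1 < n.+2)%N).

(** The bridge between words in natural numbers, used for states, and words in the generator type,
    on which the Coxeter group is presented; letters that are no vertices are dropped. *)
Definition gen_word (u : seq nat) : seq (gen G) := pmap insub u.

Lemma gen_wordK u : all V u -> map val (gen_word u) = u.
Proof. by elim: u => //= i u IH /andP[Vi /IH e]; rewrite /gen_word /= insubT /= -/(gen_word u) e. Qed.

Lemma all_val_gen (w : seq (gen G)) : all V (map val w).
Proof. by elim: w => //= i w ->; rewrite (valP i). Qed.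

Lemma bounded_gen (w : seq (gen G)) : all (fun i => i < n.+2)%N (map val w).
Proof. by apply: sub_all (all_val_gen w) => i; exact: vertex_bound2. Qed.

Lemma coxeq_braid_eq u v : braid_eq u v -> all V u -> coxeq (gen_word u) (gen_word v).
Proof.
elim=> {u v} [u|u v uv IH|u v w uv IH1 vw IH2|u i j v e|u i j v e] a.
- exact: coxeq_refl.
- by apply/coxeq_sym/IH; rewrite (braid_all _ uv).
- by apply: coxeq_trans (IH1 a) (IH2 _); rewrite -(braid_all _ uv).
- move: a; rewrite !all_cat /= => /and3P[_ /and4P[Vi Vj _ _] _].
  rewrite /gen_word !pmap_cat /= !insubT /=; apply: coxeq_braid.
  by rewrite edge_edgeD /=.
- move: a; rewrite !all_cat /= => /and3P[_ /and3P[Vi Vj _] _].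
  rewrite /gen_word !pmap_cat /= !insubT /=; apply: coxeq_comm.
  by rewrite edge_edgeD /=.
Qed.

Lemma word_state_coxeq (u v : seq (gen G)) : coxeq u v ->
  word_state N1 (map val u) = word_state N1 (map val v).
Proof.
have gb (i : gen G) : (val i < n.+2)%N by exact/vertex_bound2/(valP i).
elim=> {u v} [//|u v _ -> //|u v w _ -> _ -> //|u i v|u i j v|u i j v].
- by rewrite /word_state !map_cat !foldl_cat /= (moveK N1) ?gb.
- rewrite edge_edgeD ?(valP i) ?(valP j) // => e.
  by rewrite /word_state !map_cat !foldl_cat /= (move_braid N1) ?gb.
- rewrite edge_edgeD ?(valP i) ?(valP j) // => e.
  by rewrite /word_state !map_cat !foldl_cat /= (move_comm N1 _ (gb i) (gb j) e).
Qed.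

(** Equal Coxeter elements have the same state, whose [len] is a lower bound for the size of any
    word leading to it. *)
Lemma reduced_gen_word u : all V u -> reduced N1 u -> reduced_word (gen_word u).
Proof.
move=> Vu /eqP ru v /word_state_coxeq; rewrite gen_wordK // => e.
by rewrite -[size (gen_word u)](size_map val) gen_wordK // -ru e -(size_map val v) len_word_le // bounded_gen.
Qed.

Lemma coxeq_cat (a b u v : seq (gen G)) : coxeq u v -> coxeq (a ++ u ++ b) (a ++ v ++ b).
Proof.
elim=> {u v} [u|u v _|u v w _ h _|u i v|u i j v e|u i j v e].
- exact: coxeq_refl.
- exact: coxeq_sym.
- exact: coxeq_trans.
- by rewrite -!catA !(catA a); exact: coxeq_invol.
- by rewrite -!catA !(catA a); exact: coxeq_braid.
- by rewrite -!catA !(catA a); exact: coxeq_comm.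
Qed.

(* Deletion: a word which is not reduced loses a letter by the exchange lemma. *)
Lemma reduce_word (I : pred nat) (u : seq (gen G)) : all (fun i => I (val i)) u ->
  exists v, [/\ all V v, all I v, reduced N1 v & coxeq u (gen_word v)].
Proof.
elim/last_ind: u => [_|u i IH].
  by exists [::]; split; rewrite ?/reduced ?len1 //; exact: coxeq_refl.
rewrite all_rcons => /andP[Ii /IH[v [Vv Iv rv uv]]].
have Vi := valP i; have iN : (val i < n.+2)%N := vertex_bound2 Vi.
have bv : all (fun i => i < n.+2)%N v by apply: sub_all Vv => j; exact: vertex_bound2.
have step : coxeq (rcons u i) (gen_word v ++ [:: i]).
  by rewrite -cats1; have := coxeq_cat [::] [:: i] uv.
have [h|h] := boolP (root (word_state N1 v) (val i) < 0); last first.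
  exists (rcons v (val i)); rewrite !all_rcons Vi Vv Ii Iv; split=> //.
    by rewrite reduced_rcons // rv; exact: (root_ltgt N1).
  apply: coxeq_trans step _; rewrite -cats1 /gen_word pmap_cat /= valK /=.
  exact: coxeq_refl.
have [t vt] := exchange iN bv rv h.
have := rv; rewrite (braid_reduced N1 bv vt) reduced_rcons //; last first.
  by move: bv; rewrite (braid_all _ vt) all_rcons => /andP[].
move=> /andP[rt _]; exists t.
move: (Vv) (Iv); rewrite !(braid_all _ vt) !all_rcons => /andP[_ Vt] /andP[_ It]; split=> //.
apply: coxeq_trans step _.
have := coxeq_cat [::] [:: i] (coxeq_braid_eq vt Vv) => /= /coxeq_trans; apply.
rewrite -cats1 /gen_word pmap_cat /= valK /= -catA /=.
by have := coxeq_invol (gen_word t) i [::]; rewrite !cats0.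
Qed.

(** A competitor of the longest word is first brought to reduced form by [reduce_word], where
    maximality among the words reduced in the sense of states applies. *)
Lemma longest_gen_word (I K : pred nat) u : (forall i, V i -> K i = I i) ->
  all (fun i => V i && I i) u -> reduced N1 u ->
  (forall v, all (fun i => V i && I i) v -> reduced N1 v -> (size v <= size u)%N) ->
  longest_word K (gen_word u).
Proof.
move=> KI au ru umax; have Vu : all V u by apply: sub_all au => i /andP[].
have KIg : all (fun i => K (val i)) =1 all (fun i : gen G => I (val i)).
  by apply: eq_all => i; exact/KI/(valP i).
split.
- exists (gen_word u); last exact: coxeq_refl.
  rewrite KIg -(all_map val I) gen_wordK //.
  by apply: sub_all au => i /andP[].
- exact: reduced_gen_word.
- move=> v [w]; rewrite KIg => /reduce_word[t [Vt It rt wt]] vw rv.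
  have /rv := coxeq_trans vw wt; rewrite -[size (gen_word t)](size_map val) gen_wordK // => /leq_trans.
  rewrite -[size (gen_word u)](size_map val) gen_wordK //; apply.
  by apply: umax rt; rewrite all_predI Vt.
Qed.

End CoxeterWords.

(** The scalar is a sign; knowing it to be nonzero is enough for comparing the left ideals
    generated. *)
Lemma prod_subr1 (F : fieldType) (A : algType F) (T : Type) (w : seq T) (x : T -> A) :
  exists2 k : F, k != 0 & \prod_(i <- w) (x i - 1) = k *: \prod_(i <- w) (1 - x i).
Proof.
elim: w => [|i w [k k0 e]]; first by exists 1; rewrite ?oner_eq0 // !big_nil scale1r.
exists (- k); rewrite ?oppr_eq0 // !big_cons e -opprB mulNr -scalerAr scaleNr.
by [].
Qed.

Lemma pim_is_PIM (F : fieldType) c n alpha (I : pred nat) :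
  (forall i, vertex (cdiagram c n) i -> I i = (i \in descents alpha)) ->
  is_PIM alpha (pim (hfam_algebra F c n) (isT : (1 < n.+2)%N) (@vertex_bound2 c n) I).
Proof.
move=> IE; set P := pim _ _ _ _.
pose w1 := word_in (isT : (1 < n.+2)%N) (@vertex_bound2 c n) I.
pose w2 := word_out (isT : (1 < n.+2)%N) (@vertex_bound2 c n) I.
have [a1 r1 m1 _] := longestP (isT : (1 < n.+2)%N) (@bound_in _ _ (@vertex_bound2 c n) I).
have [a2 r2 m2 _] := longestP (isT : (1 < n.+2)%N) (@bound_out _ _ (@vertex_bound2 c n) I).
have V1 : all (vertex (cdiagram c n)) w1 by apply: sub_all a1 => i /andP[].
have V2 : all (vertex (cdiagram c n)) w2 by apply: sub_all a2 => i /andP[].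
exists (gen_word c n w1), (gen_word c n w2); split.
- by apply: (longest_gen_word _ a1 r1 m1) => i /IE.
- by apply: (longest_gen_word _ a2 r2 m2) => i /IE ->.
set e := _ * _.
have [k k0 eE] : exists2 k : F, k != 0 &
    e = k *: pim_elt (hfam F c n) (isT : (1 < n.+2)%N) (@vertex_bound2 c n) I.
  have [k k0 kE] := prod_subr1 (gen_word c n w1) (hgen F); exists k => //.
  rewrite /e kE -scalerAl; congr (_ *: (_ * _)).
    rewrite /elt_in /pword -/w1 -[in RHS](gen_wordK V1) big_map.
    by apply: eq_bigr => g _; rewrite hfam_gen.
  rewrite /elt_out /pword -/w2 -[in RHS](gen_wordK V2) big_map.
  by apply: eq_bigr => g _; rewrite hfam_gen.
exists (pim_map (hfam_algebra F c n) (isT : (1 < n.+2)%N) (@vertex_bound2 c n) I).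
split; first exact: pim_map_inj.
move=> h; split=> [/pim_map_im[a ->]|[a ->]]; last first.
  by apply/pim_map_im; exists (k *: a); rewrite eE -scalerAr scalerAl.
by exists (k^-1 *: a); rewrite eE -scalerAr -scalerAl scalerA mulfV // scale1r.
Qed.

(** * Bases of NSym and QSym *)

Lemma spanZ_ind (V : zmodType) (S : set V) (P : spanZ S -> Prop) : P 0 ->
  (forall x y, P x -> P y -> P (x - y)) -> (forall x (Sx : S x), P (SpanZ (zspan_gen Sx))) ->
  forall x, P x.
Proof.
move=> P0 PB PS x; suff E v : zspan_ind S v -> exists2 y : spanZ S, val y = v & P y.
  have /asboolP/E[y /val_inj-> //] : val x \in zspan S by exact: valP.
elim=> {v} [|v Sv|u v _ [x1 <- Px] _ [x2 <- Py]].
- by exists 0; rewrite ?raddf0.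
- by exists (SpanZ (zspan_gen Sv)).
- by exists (x1 - x2); [rewrite raddfB|exact: PB].
Qed.

Lemma span_valD (V : zmodType) (S : set V) : addm (@span_val V S).
Proof. by move=> x y; exact: (raddfD (val : spanZ S -> V)). Qed.

Section Labels.
Local Open Scope nat_scope.

Let diff x t := pairmap (fun a b => b - a) x t.

Lemma scanl_diff x t : path leq x t -> scanl addn x (diff x t) = t.
Proof. by elim: t x => //= a t IH x /andP[xa /IH e]; rewrite subnKC // e. Qed.

Lemma sumn_diff x t : path leq x t -> x + sumn (diff x t) = last x t.
Proof. by elim: t x => [|a t IH] x /=; rewrite ?addn0 // => /andP[xa /IH<-]; rewrite addnA subnKC. Qed.

Lemma diff_gt0 x t : path ltn x t -> all (fun a => 0 < a) (diff x t).
Proof. by elim: t x => //= a t IH x /andP[xa /IH->]; rewrite subn_gt0 xa. Qed.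

Lemma mem_positions c n j : (j \in positions c n) = vertex (cdiagram c n) j.
Proof.
rewrite mem_filter mem_iota add0n; case h: (vertex _ j) => //=; exact: vertex_bound h.
Qed.

(* The parts of the composition are the differences of consecutive elements. *)
Lemma label_of c n (I : nat -> bool) : lo c <= n -> exists2 alpha, is_label c n alpha &
  forall j, vertex (cdiagram c n) j -> (j \in descents alpha) = I j.
Proof.
move=> cn; have [n0|n0] := posnP n.
  by exists [::]; move: cn; rewrite n0 //; case: c => //= _ j; rewrite ltn0 andbF.
pose s := [seq j <- positions c n | I j]; pose t := rcons s n.
have st : sorted ltn t.
  have : sorted ltn (rcons (positions c n) n).
    have V := @vertex_bound c n.
    have : sorted ltn (rcons (iota 0 n) n) by rewrite -cats1 -[n in [:: n]]add0n -(iotaD 0 n 1) iota_ltn_sorted.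
    have -> : rcons (positions c n) n = [seq j <- rcons (iota 0 n) n | vertex (cdiagram c n) j || (j == n)].
      rewrite filter_rcons eqxx orbT; congr rcons; apply: eq_in_filter => j.
      by rewrite mem_iota add0n => /= jn; rewrite ltn_eqF ?orbF.
    exact: sorted_filter ltn_trans _ _.
  have -> : t = [seq j <- rcons (positions c n) n | I j || (j == n)].
    rewrite filter_rcons eqxx orbT; congr rcons; apply: eq_in_filter => j.
    by rewrite mem_positions => /vertex_bound jn; rewrite ltn_eqF ?orbF.
  exact: sorted_filter ltn_trans _ _.
have p0 : path leq 0 t.
  by case: (t) st => //= a u h; apply: sub_path h => x y; exact: ltnW.
exists (diff 0 t).
  rewrite /is_label cn /=; apply/andP; split.
    by rewrite -[sumn _]add0n sumn_diff // last_rcons.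
  have tA : c = TypeA -> path ltn 0 t.
    move=> cA; suff : all (fun j => 0 < j) t by case: (t) st => //= a u -> /andP[->].
    rewrite all_rcons n0; apply/allP => j; rewrite mem_filter => /andP[_].
    by rewrite mem_positions cA => /andP[].
  case cE : c; first exact/diff_gt0/tA.
  by move: st; rewrite /t; case: (s) => [|a u] //= h; apply: diff_gt0.
move=> j Vj; rewrite /descents scanl_diff // size_pairmap /t size_rcons /= -cats1 take_size_cat //.
by rewrite mem_filter mem_positions Vj andbT.
Qed.
End Labels.

Section Ribbons.
Variable c : family.
Local Notation V n := (vertex (cdiagram c n)).

Definition has_pattern n (I : nat -> bool) (w : seq int) : bool :=
  (size w == n) && all (fun j => (letter w j.+1 < letter w j) == I j) (positions c n).

Lemma has_patternP n I w : reflect (size w = n /\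
  forall j, V n j -> (letter w j.+1 < letter w j) = I j) (has_pattern n I w).
Proof.
apply: (iffP andP) => [[/eqP-> /allP h]|[-> h]].
  by split=> // j Vj; apply/eqP/h; rewrite mem_positions.
by split=> //; apply/allP => j; rewrite mem_positions => /h->.
Qed.

Definition ribbon_set n I : ncseries := fun w => (has_pattern n I w)%:Z.

Lemma ribbon_set_ext n (I K : nat -> bool) : (forall j, V n j -> I j = K j) ->
  ribbon_set n I = ribbon_set n K.
Proof.
move=> IK; apply/funext => w; congr (nat_of_bool _)%:Z.
by apply/has_patternP/has_patternP => -[h1 h2]; split=> // j Vj; rewrite h2 // IK.
Qed.

Lemma ribbon_set_in k I : ribbon_set (lo c + k) I \in
  zspan [set f | exists n alpha, is_label c n alpha /\ f = ribbon c n alpha].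
Proof.
have [alpha la aE] := @label_of c (lo c + k) I (leq_addr _ _).
apply: zspan_gen; exists (lo c + k)%N, alpha; split=> //.
by rewrite -(@ribbon_set_ext _ (fun j => j \in descents alpha)).
Qed.

Definition ribbon_elt k I : NSym c := SpanZ (ribbon_set_in k I).

(* The first letter settles the descent at 0: in type D it has the sign of the sum
   of the first two letters. *)
Fixpoint pattern_letter (I : nat -> bool) (j : nat) : int :=
  if j is j'.+1 then pattern_letter I j' + (if I j then -1 else 1)
  else if I 0 then -1 else 1.
Definition pattern_word I n := mkseq (pattern_letter I) n.

Lemma letter_mkseq (f : nat -> int) n j : (j < n)%N -> letter (mkseq f n) j.+1 = f j.
Proof. exact: nth_mkseq. Qed.

Lemma pattern_wordE n I K : (lo c <= n)%N ->
  has_pattern n I (pattern_word K n) <-> forall j, V n j -> K j = I j.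
Proof.
move=> cn; have E j : V n j ->
    (letter (pattern_word K n) j.+1 < letter (pattern_word K n) j) = K j.
  move=> Vj; have jn := vertex_bound Vj; rewrite /pattern_word letter_mkseq //.
  case: j Vj jn => [|j] Vj jn.
    (* The letter 0 occurs in type D only, where the degree is at least 2 and w_2 exists. *)
    have n1 : (1 < n)%N by move: Vj cn; case: (c).
    by rewrite /= nth_mkseq //=; case: (K 0); case: (K 1).
  by rewrite letter_mkseq ?(ltnW jn) //=; case: (K _); lia.
split=> [/has_patternP[_ h] j Vj|h]; first by rewrite -E // h.
by apply/has_patternP; rewrite size_mkseq; split=> // j Vj; rewrite E // h.
Qed.

Lemma pattern_word_inj m n I K : (lo c <= n)%N -> has_pattern n I (pattern_word K m) ->
  m = n /\ forall j, V m j -> K j = I j.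
Proof.
move=> cn h; have /has_patternP[+ _] := h; rewrite size_mkseq => e; split=> //.
by move: h; rewrite e => /(pattern_wordE _ _ cn).
Qed.

End Ribbons.

(* The degree [lo c + k] and the descent set. *)
Definition lab (c : family) : choiceType := {k : nat & subset (vertex (cdiagram c (lo c + k)))}.

Lemma lab_eq c (l k : lab c) : tag l = tag k ->
  (forall j, vertex (cdiagram c (lo c + tag l)) j -> tagged l j = tagged k j) -> l = k.
Proof.
case: l k => [l I] [k K] /= lk; case: k / lk K => K h; congr existT.
by apply/eqP/negPn/negP => /subset_neq[j [Vj]]; rewrite h // eqxx.
Qed.

(** A word determines its descent pattern, so the coefficients of the ribbons at the pattern words
    form an identity matrix. *)
Lemma NSym_zbasis c : zbasis (fun l : lab c => ribbon_elt c (tag l) (tagged l)).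
Proof.
apply: (zbasis_crit (c := fun (l : lab c) f =>
  span_val f (pattern_word (tagged l) (lo c + tag l))) (ht := fun=> 0%N)).
- move=> P P0 PB Pb; apply: spanZ_ind => // x Sx.
  have [n [alpha [la xE]]] := Sx; have cn : (lo c <= n)%N by case/and3P: la.
  rewrite -(subnKC cn) in xE; move: (n - lo c)%N xE => k xE.
  pose l : lab c := existT _ k (subset_trim _ (fun j => j \in descents alpha)).
  suff -> : SpanZ (zspan_gen Sx) = ribbon_elt c (tag l) (tagged l) by [].
  apply: val_inj; rewrite /= xE.
  exact: (@ribbon_set_ext c _ (fun j => j \in descents alpha) _ (fun j Vj => esym (andb_idl (fun _ => Vj)))).
- by move=> l x y; rewrite span_valD.
- move=> l; rewrite /= /ribbon_set; set b := has_pattern _ _ _ _; suff -> : b by [].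
  by apply/pattern_wordE; rewrite ?leq_addr.
- move=> l k; rewrite /= /ribbon_set => h; left.
  have {h} : has_pattern c (lo c + tag k) (tagged k) (pattern_word (tagged l) (lo c + tag l)).
    by apply: contraNT h => /negPf->.
  by case/pattern_word_inj => [|/addnI e h]; [exact: leq_addr|apply/esym/lab_eq].
Qed.

(** * Fundamental quasisymmetric functions indexed by descent sets *)

Section Fundamentals.
Variable c : family.
Local Notation V n := (vertex (cdiagram c n)).
Local Notation srt mu := (sort <=%O (enum_mset mu)).

Definition has_steps n (I : nat -> bool) (w : seq int) : bool :=
  [&& size w == n,
      (if c is TypeA then all (fun i => 1 <= i) w else true) &
      all (fun j => if I j then letter w j < letter w j.+1 else letter w j <= letter w j.+1)
          (positions c n)].

Lemma has_stepsP n I w : reflect [/\ size w = n, c = TypeA -> all (fun i => 1 <= i) w &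
    forall j, V n j -> letter w j < letter w j.+1 ?<= if ~~ I j] (has_steps n I w).
Proof.
have E j : (letter w j < letter w j.+1 ?<= if ~~ I j) =
    (if I j then letter w j < letter w j.+1 else letter w j <= letter w j.+1).
  by case: (I j).
apply: (iffP and3P) => [[/eqP-> h1 /allP h2]|[-> h1 h2]].
  split=> // [cA|j Vj]; first by rewrite cA in h1.
  by rewrite E; apply: h2; rewrite mem_positions.
split=> //; first by case: c h1 => // ->.
by apply/allP => j; rewrite mem_positions => /h2; rewrite E.
Qed.

Lemma has_steps_sorted n I w : has_steps n I w -> sorted <=%O w.
Proof.
case/has_stepsP => e _ h; apply/(sortedP 0) => i iw.
have Vi : V n i.+1 by rewrite -e; case: (c).
by have /lteifW := h _ Vi.
Qed.

Lemma has_steps_ext n (I K : nat -> bool) w : (forall j, V n j -> I j = K j) ->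
  has_steps n I w = has_steps n K w.
Proof.
by move=> IK; apply/has_stepsP/has_stepsP => -[h1 h2 h3]; split=> // j Vj;
  have := h3 j Vj; rewrite IK.
Qed.

Definition fundamental_set n I : series := fun mu => (has_steps n I (srt mu))%:Z.

Lemma fundamental_set_ext n (I K : nat -> bool) : (forall j, V n j -> I j = K j) ->
  fundamental_set n I = fundamental_set n K.
Proof.
by move=> IK; apply/funext => mu; rewrite /fundamental_set (has_steps_ext _ IK).
Qed.

(** Index sequences are weakly increasing, so among the rearrangements of a monomial only the sorted
    one can qualify, and the count is 0 or 1. *)
Lemma fundamentalE n alpha :
  fundamental c n alpha = fundamental_set n (fun j => j \in descents alpha).
Proof.
apply/funext => mu; congr Posz; set s := enum_mset mu.
rewrite (@eq_in_count _ _ (fun w => (w == srt mu) && has_steps n (fun j => j \in descents alpha) (srt mu))).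
  case: (has_steps _ _ (srt mu)); last first.
    by rewrite (eq_count (a2 := pred0)) ?count_pred0 // => w; rewrite /= andbF.
  rewrite (eq_count (a2 := pred1 (srt mu))) => [|w]; last by rewrite /= andbT.
  by rewrite count_uniq_mem ?permutations_uniq // mem_permutations perm_sort perm_refl.
move=> w; rewrite mem_permutations => ws.
rewrite -[F_index _ _ _ _]/(has_steps n (fun j => j \in descents alpha) w).
have [-> //|ne] := eqVneq w (srt mu); apply/negP => /has_steps_sorted sw.
move/eqP: ne; apply; apply: (sorted_eq le_trans le_anti sw (sort_le_sorted _)).
by rewrite perm_sym perm_sort perm_sym.
Qed.

Lemma fundamental_set_in k I : fundamental_set (lo c + k) I \in
  zspan [set f | exists n alpha, is_label c n alpha /\ f = fundamental c n alpha].
Proof.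
have [alpha la aE] := @label_of c (lo c + k) I (leq_addr _ _).
apply: zspan_gen; exists (lo c + k)%N, alpha; split=> //.
by rewrite fundamentalE; exact/esym/fundamental_set_ext.
Qed.

Definition fundamental_elt k I : QSym c := SpanZ (fundamental_set_in k I).

(* In type D the first letter makes step 0, from minus the second letter to the
   first one, strict exactly when 0 is in [I]. *)
Fixpoint step_letter (I : nat -> bool) (j : nat) : int :=
  if j is j'.+1 then step_letter I j' + (if I j then 2 else 0)
  else if (if c is TypeA then true else I 0) then 1 else if I 1 then -1 else 0.
Definition step_word (I : nat -> bool) n := mkseq (step_letter I) n.

Lemma step_word_sorted I n : sorted <=%O (step_word I n).
Proof.
apply/(sortedP 0) => i; rewrite size_mkseq => iw; rewrite !nth_mkseq ?(ltnW iw) //=.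
by rewrite lerDl; case: ifP.
Qed.

Lemma step_letterA I j : c = TypeA -> 1 <= step_letter I j.
Proof.
move=> cA; elim: j => [|j IH] /=; first by rewrite cA.
by apply: le_trans IH _; rewrite lerDl; case: ifP.
Qed.

(** The step word is strict exactly at [K] and weak elsewhere, so it meets the conditions of every
    set contained in [K]: the coefficients will be triangular for inclusion. *)
Lemma step_wordE n I K : (lo c <= n)%N ->
  has_steps n I (step_word K n) <-> forall j, V n j -> I j -> K j.
Proof.
move=> cn; have E j : V n j -> (letter (step_word K n) j < letter (step_word K n) j.+1) = K j
    /\ letter (step_word K n) j <= letter (step_word K n) j.+1.
  move=> Vj; have jn := vertex_bound Vj; rewrite /step_word letter_mkseq //.
  case: j Vj jn => [|j] Vj jn.
    have cD : c = TypeD by move: Vj; case: (c).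
    have n1 : (1 < n)%N by move: cn; rewrite cD.
    (* For 0 outside [K] the letters satisfy w_1 = -w_2; this is why steps have size 2 and the first
       letter is then 0 or -1. *)
    by rewrite /= nth_mkseq //= cD; case: (K 0); case: (K 1).
  by rewrite letter_mkseq ?(ltnW jn) //=; case: (K _); lia.
split=> [/has_stepsP[_ _ h] j Vj Ij|h].
  by have := h j Vj; rewrite Ij /= (proj1 (E j Vj)).
apply/has_stepsP; rewrite size_mkseq; split=> // [cA|j Vj].
  by apply/allP => x /mapP[j _ ->]; exact: step_letterA.
have [E1 E2] := E j Vj; case Ij: (I j) => //=.
by rewrite E1; exact: h.
Qed.

Lemma sort_seq_mset (w : seq int) : sorted <=%O w -> srt (seq_mset w) = w.
Proof.
move=> sw; apply: (sorted_eq le_trans le_anti (sort_le_sorted _) sw).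
by rewrite perm_sort; exact: perm_eq_seq_mset.
Qed.

Lemma fundamental_set_step n m I K : (lo c <= n)%N ->
  fundamental_set n I (seq_mset (step_word K m)) != 0 ->
  m = n /\ forall j, V m j -> I j -> K j.
Proof.
move=> cn; rewrite /fundamental_set sort_seq_mset ?step_word_sorted // => h.
have {}h : has_steps n I (step_word K m) by apply: contraNT h => /negPf->.
have /has_stepsP[+ _ _] := h; rewrite size_mkseq => e; split=> //.
by move: h; rewrite e => /(step_wordE _ _ cn).
Qed.
End Fundamentals.

Lemma count_sub (T : eqType) (a b : pred T) (s : seq T) : {in s, forall x, a x -> b x} ->
  (count a s <= count b s)%N /\ ((count b s <= count a s)%N -> {in s, a =1 b}).
Proof.
elim: s => // x s IH h; have [|le eq] := IH; first by move=> y ys; apply: h; rewrite inE ys orbT.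
have := h x (mem_head _ _); rewrite /=; case ax: (a x); case bx: (b x) => // hx.
- split=> [|ba]; first by rewrite leq_add2l.
  by move=> y; rewrite inE => /predU1P[->|]; [rewrite ax bx|apply: eq; rewrite leq_add2l in ba].
- by have := hx isT.
- by split=> [|ba]; [exact: leqW|move: ba; rewrite add1n add0n ltnNge le].
- split=> // ba y; rewrite inE => /predU1P[->|]; [by rewrite ax bx|exact: eq].
Qed.

(** At the step word of a set only the functions of its subsets are nonzero, and a proper subset has
    fewer elements: the number of letters is the height in the triangularity criterion. *)
Lemma QSym_zbasis c : zbasis (fun l : lab c => fundamental_elt c (tag l) (tagged l)).
Proof.
apply: (zbasis_crit (c := fun (l : lab c) f =>
  span_val f (seq_mset (step_word c (tagged l) (lo c + tag l))))
  (ht := fun l => count (tagged l : pred nat) (positions c (lo c + tag l)))).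
- move=> P P0 PB Pb; apply: spanZ_ind => // x Sx.
  have [n [alpha [la xE]]] := Sx; have cn : (lo c <= n)%N by case/and3P: la.
  rewrite -(subnKC cn) in xE; move: (n - lo c)%N xE => k xE.
  pose l : lab c := existT _ k (subset_trim _ (fun j => j \in descents alpha)).
  suff -> : SpanZ (zspan_gen Sx) = fundamental_elt c (tag l) (tagged l) by [].
  apply: val_inj; rewrite /= xE fundamentalE.
  exact: (@fundamental_set_ext c _ (fun j => j \in descents alpha) _ (fun j Vj => esym (andb_idl (fun _ => Vj)))).
- by move=> l x y; rewrite span_valD.
- move=> l; rewrite /= /fundamental_set sort_seq_mset ?step_word_sorted //.
  set b := has_steps _ _ _ _; suff -> : b by [].
  by apply/step_wordE; rewrite ?leq_addr.
- move=> l k; rewrite /= => /fundamental_set_step[|/addnI e h]; first exact: leq_addr.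
  have le : {in positions c (lo c + tag l), forall j, tagged k j -> tagged l j}.
    by move=> j; rewrite mem_positions; exact: h.
  rewrite (congr1 (fun k => positions c (lo c + k)) (esym e)).
  have [_ eq] := count_sub le; case: ltnP => [|/eq kl]; [by right|left].
  by apply/esym/lab_eq => // j; rewrite -mem_positions => /kl.
Qed.

(** * Characteristic maps *)

Lemma dsum_zbasis (V : nat -> zmodType) (L : nat -> Type) (b : forall k, L k -> V k) :
  (forall k, zbasis (b k)) -> zbasis (fun l : {k & L k} => dsum_in (b _ (tagged l))).
Proof.
move=> hb; split=> [P P0 PB Pb|W f].
  apply: dsum_ind => // k; apply: (zb_gen (hb k)) => [|x y Px Py|l].
  - by rewrite (addm0 (@dsum_inD _ _)).
  - by rewrite (addmB (@dsum_inD _ _)); exact: PB.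
  - exact: (Pb (existT _ k l)).
exists (dsum_lift (fun k => zlift (hb k) (fun l => f (existT _ k l)))).
have D k : addm (zlift (hb k) (fun l => f (existT _ k l))) by exact: zliftD.
split; first exact: dsum_liftD.
by move=> [k l]; rewrite dsum_liftE // zliftE.
Qed.

Section Classes.
Variables (F : fieldType) (c : family).

Definition simple_class k (I : nat -> bool) : G0sum F c :=
  G0cl (simple (hfam_algebra F c (lo c + k)) I).

Definition pim_class k (I : nat -> bool) : K0sum F c :=
  K0cl (pim (hfam_algebra F c (lo c + k)) (isT : (1 < (lo c + k).+2)%N)
    (@vertex_bound2 c (lo c + k)) I).

Lemma simple_class_ext k (I K : nat -> bool) :
  (forall j, vertex (cdiagram c (lo c + k)) j -> I j = K j) ->
  simple_class k I = simple_class k K.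
Proof. by move=> IK; rewrite /simple_class /G0cl (G0_class_simple_ext _ IK). Qed.

Lemma G0sum_zbasis : zbasis (fun l : lab c => simple_class (tag l) (tagged l)).
Proof.
exact: (dsum_zbasis (fun k => G0_zbasis (hfam_algebra F c (lo c + k))
  (isT : (1 < (lo c + k).+2)%N) (@vertex_bound2 c (lo c + k)))).
Qed.

Lemma K0sum_zbasis : zbasis (fun l : lab c => pim_class (tag l) (tagged l)).
Proof.
exact: (dsum_zbasis (fun k => K0_zbasis (hfam_algebra F c (lo c + k))
  (isT : (1 < (lo c + k).+2)%N) (@vertex_bound2 c (lo c + k)))).
Qed.

End Classes.

(* An isomorphism matching bases of a direct sum and of a group of coefficient
   functions is graded: homogeneous projection of the source corresponds to
   truncation of the functions. *)
Section GradedIso.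
Variables (V : nat -> zmodType) (L : nat -> choiceType) (b : forall k, L k -> V k).
Hypothesis hb : forall k, zbasis (@b k).
Variables (X : nat -> Type) (cl : forall k, X k -> V k).
Hypothesis cl_gen : forall k (P : V k -> Prop), P 0 -> (forall x y, P x -> P y -> P (x - y)) ->
  (forall x, P (cl x)) -> forall x, P x.
Variables (E : zmodType) (W : Type) (ev : E -> W -> int) (wt : W -> nat).
Hypothesis evD : forall w, addm (ev^~ w).
Hypothesis ev_ext : forall f g, (forall w, ev f w = ev g w) -> f = g.
Variables (B : {k & L k} -> E) (d : nat).
Hypothesis hB : zbasis B.
Hypothesis B_deg : forall l w, ev (B l) w != 0 -> wt w = (d + tag l)%N.

Let bs (l : {k & L k}) : dsum V := dsum_in (b (tagged l)).
Let hbs : zbasis bs := dsum_zbasis hb.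

Definition basis_map : dsum V -> E := zlift hbs B.

Lemma basis_mapE l : basis_map (bs l) = B l.
Proof. exact: zliftE. Qed.

Lemma basis_map_bij : bijective basis_map.
Proof.
exists (zlift hB bs) => x; move: x.
  apply: (zb_eq hbs) => // [|l]; first by apply: addm_comp; exact: zliftD.
  by rewrite basis_mapE zliftE.
apply: (zb_eq hB) => // [|l]; first by apply: addm_comp; exact: zliftD.
by rewrite zliftE basis_mapE.
Qed.

Lemma basis_map_graded : graded_iso
  (fun n => [set x : dsum V | x \in zspan [set y | exists k (P : X k),
    (d + k)%N = n /\ y = dsum_in (cl P)]]%classic)
  (fun n => [set f : E | forall w, ev f w != 0 -> wt w = n]%classic) basis_map.
Proof.
have mD : addm basis_map by exact: zliftD.
have iD k : addm (dsum_in (V := V) (n := k)) by exact: dsum_inD.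
split; [exact: mD|exact: basis_map_bij|move=> n x; split].
  move=> /asboolP; elim=> {x} [|_ [k [P [kn ->]]]|x y _ hx _ hy] w.
  - by rewrite (addm0 mD) (addm0 (evD w)) eqxx.
  - move: (cl P) => v {P}; rewrite -kn; move: v; apply: (zb_gen (hb k)) => [|u v hu hv|l].
    + by rewrite (addm0 (iD k)) (addm0 mD) (addm0 (evD w)) eqxx.
    + rewrite (addmB (iD k)) (addmB mD) (addmB (evD w)).
      by have [->|/hu //] := eqVneq (ev (basis_map (dsum_in u)) w) 0; rewrite sub0r oppr_eq0.
    + by have := basis_mapE (existT _ k l); rewrite /bs /= => ->; exact: (B_deg (l := existT _ k l)).
  - rewrite (addmB mD) (addmB (evD w)).
    by have [->|/hx //] := eqVneq (ev (basis_map x) w) 0; rewrite sub0r oppr_eq0; exact: hy.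
move=> hx; pose pr := dsum_lift (fun k (v : V k) => if (d + k)%N == n then dsum_in v else 0 : dsum V).
have prk k : addm (fun v : V k => if (d + k)%N == n then dsum_in v else 0 : dsum V).
  by move=> u v; case: ifP => _; rewrite ?addr0 // iD.
have prD : addm pr by exact: dsum_liftD.
have prE k (v : V k) : pr (dsum_in v) = if (d + k)%N == n then dsum_in v else 0.
  exact: dsum_liftE.
have pr_deg y : pr y \in zspan [set y | exists k (P : X k), (d + k)%N = n /\ y = dsum_in (cl P)]%classic.
  move: y; apply: dsum_ind => [|u v hu hv|k v].
  - by rewrite (addm0 prD) rpred0.
  - by rewrite (addmB prD) rpredB.
  - rewrite prE; case: eqP => [kn|_]; last by rewrite rpred0.
    move: v; apply: cl_gen => [|u v hu hv|P].
    + by rewrite (addm0 (iD k)) rpred0.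
    + by rewrite (addmB (iD k)) rpredB.
    + by apply: zspan_gen; exists k, P.
have tr w y : ev (basis_map (pr y)) w = if wt w == n then ev (basis_map y) w else 0.
  move: y; apply: (zb_eq hbs) => [||l].
  - by apply: addm_comp (evD w) _; exact: addm_comp mD prD.
  - by move=> u v; rewrite mD evD; case: ifP; rewrite ?addr0.
  - rewrite /bs prE -/(bs l) basis_mapE.
    have [e|ne] := eqVneq (ev (B l) w) 0.
      case: ifP => _; first by rewrite basis_mapE e if_same.
      by rewrite (addm0 mD) (addm0 (evD w)) e if_same.
    rewrite (B_deg ne); case: ifP => _; first by rewrite basis_mapE.
    by rewrite (addm0 mD) (addm0 (evD w)).
have -> : x = pr x; last exact: pr_deg.
have [g mK _] := basis_map_bij; apply: (can_inj mK); apply: ev_ext => w.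
rewrite tr; have [//|ne] := eqVneq (wt w) n.
by have [//|/hx e] := eqVneq (ev (basis_map x) w) 0; rewrite e eqxx in ne.
Qed.

End GradedIso.

Section Characteristic.
Variables (F : fieldType) (c : family).

Definition ch : K0sum F c -> NSym c :=
  basis_map (fun k => K0_zbasis (hfam_algebra F c (lo c + k))
    (isT : (1 < (lo c + k).+2)%N) (@vertex_bound2 c (lo c + k)))
  (fun l : lab c => ribbon_elt c (tag l) (tagged l)).

Definition Ch : G0sum F c -> QSym c :=
  basis_map (fun k => G0_zbasis (hfam_algebra F c (lo c + k))
    (isT : (1 < (lo c + k).+2)%N) (@vertex_bound2 c (lo c + k)))
  (fun l : lab c => fundamental_elt c (tag l) (tagged l)).

Lemma chD : addm ch. Proof. exact: zliftD. Qed.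
Lemma ChD : addm Ch. Proof. exact: zliftD. Qed.

Lemma ch_bij : bijective ch.
Proof. exact: basis_map_bij (NSym_zbasis c). Qed.
Lemma Ch_bij : bijective Ch.
Proof. exact: basis_map_bij (QSym_zbasis c). Qed.

Lemma ch_pim (l : lab c) : ch (pim_class F c (tag l) (tagged l)) = ribbon_elt c (tag l) (tagged l).
Proof. exact: (basis_mapE _ _ l). Qed.

Lemma Ch_simple k I : Ch (simple_class F c k I) = fundamental_elt c k I.
Proof.
pose l : lab c := existT _ k (subset_trim _ I).
rewrite (@simple_class_ext F c k I (tagged l)) => [|j Vj]; last by rewrite /= Vj.
rewrite [LHS](basis_mapE _ _ l); apply: val_inj; apply: fundamental_set_ext => j Vj.
by rewrite /= Vj.
Qed.

Lemma ch_is_ch : is_ch ch.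
Proof.
split.
  apply: (basis_map_graded (cl := fun k => @K0_class _ (H0 F c (lo c + k)))
    (fun k => K0_zbasis (hfam_algebra F c (lo c + k)) (isT : (1 < (lo c + k).+2)%N) (@vertex_bound2 c (lo c + k)))
    _ (ev := fun (f : NSym c) w => span_val f w) (wt := size) _ _ (NSym_zbasis c)) => //.
  - by move=> k P; exact: K0_ind.
  - by move=> f g e; apply: val_inj; apply/funext.
  - move=> l w; rewrite /= /ribbon_set => h.
    by have /has_patternP[] : has_pattern c (lo c + tag l) (tagged l) w by apply: contraNT h => /negPf->.
move=> k alpha la; pose I := subset_trim (vertex (cdiagram c (lo c + k))) (fun j => j \in descents alpha).
exists (pim (hfam_algebra F c (lo c + k)) (isT : (1 < (lo c + k).+2)%N) (@vertex_bound2 c (lo c + k)) I).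
  by apply: pim_is_PIM => j Vj; rewrite /= Vj.
rewrite -/(pim_class F c k I) (ch_pim (existT _ k I)) /=.
by rewrite (@ribbon_set_ext c _ _ (fun j => j \in descents alpha)) // => j Vj; rewrite Vj.
Qed.

Lemma Ch_is_Ch : is_Ch Ch.
Proof.
split.
  apply: (basis_map_graded (cl := fun k => @G0_class _ (H0 F c (lo c + k)))
    (fun k => G0_zbasis (hfam_algebra F c (lo c + k)) (isT : (1 < (lo c + k).+2)%N) (@vertex_bound2 c (lo c + k)))
    _ (ev := fun (f : QSym c) mu => span_val f mu)
    (wt := fun mu => size (enum_mset mu)) _ _ (QSym_zbasis c)) => //.
  - by move=> k P; exact: G0_ind.
  - by move=> f g e; apply: val_inj; apply/funext.
  - move=> l mu; rewrite /= /fundamental_set => h.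
    rewrite -(size_sort <=%O).
    by have /has_stepsP[] : has_steps c (lo c + tag l) (tagged l)
      (sort <=%O (enum_mset mu)) by apply: contraNT h => /negPf->.
move=> k alpha la; exists (simple (hfam_algebra F c (lo c + k)) (fun j => j \in descents alpha)).
  split=> // i; rewrite simple_act charB char1 -hfam_gen charp (valP i) /=.
  by case: (_ \in _); rewrite ?subrr ?sub0r.
by rewrite -/(simple_class F c k _) Ch_simple /= fundamentalE.
Qed.

End Characteristic.

(** * The module structure on projectives *)

(** Both sides run over the pairs with sum at most n; this serves for cutting words and descent sets
    at two places. *)
Lemma triangle_sum (V : nmodType) n (f : nat -> nat -> V) :
  \sum_(i < n.+1) \sum_(j < i.+1) f j (i - j)%N = \sum_(j < n.+1) \sum_(l < (n - j).+1) f j l.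
Proof.
elim: n => [|n IH]; first by rewrite !big_ord1 /= ?big_ord1.
rewrite big_ord_recr IH /= [X in _ + X]big_ord_recr [RHS]big_ord_recr /= subnn big_ord1.
rewrite addrA -big_split /=; congr (_ + _).
by apply: eq_bigr => j _; rewrite subSn ?leq_ord // [RHS]big_ord_recr.
Qed.

(** * Noncommutative power series and products of ribbons *)

Section NCSeries.
Implicit Types (f g h : ncseries) (w : seq int).

Lemma ncseriesD f g w : (f + g) w = f w + g w.
Proof. by []. Qed.

Lemma ncmulDl g : addm (ncmul^~ g).
Proof.
move=> f1 f2; apply/funext => w; rewrite ncseriesD /ncmul -big_split.
by apply: eq_bigr => i _; rewrite ncseriesD mulrDl.
Qed.

Lemma ncmulDr f : addm (ncmul f).
Proof.
move=> g1 g2; apply/funext => w; rewrite ncseriesD /ncmul -big_split.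
by apply: eq_bigr => i _; rewrite ncseriesD mulrDr.
Qed.

Lemma ncmulA f g h : ncmul (ncmul f g) h = ncmul f (ncmul g h).
Proof.
apply/funext => w; rewrite /ncmul.
transitivity (\sum_(i < (size w).+1) \sum_(j < i.+1)
    f (take j w) * (g (take (i - j) (drop j w)) * h (drop (i - j) (drop j w)))).
  apply: eq_bigr => i _; have iw : (i <= size w)%N by rewrite leq_ord.
  rewrite size_takel // mulr_suml; apply: eq_bigr => j _.
  have ji : (j <= i)%N by rewrite leq_ord.
  by rewrite take_takel // take_drop subnK // drop_drop subnK // mulrA.
rewrite (triangle_sum _ (fun j l => f (take j w) * (g (take l (drop j w)) * h (drop l (drop j w))))).
by apply: eq_bigr => j _; rewrite size_drop mulr_sumr.
Qed.

Lemma ncmul1 f : ncmul f ncone = f.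
Proof.
apply/funext => w; rewrite /ncmul big_ord_recr /= take_size drop_size mulr1 big1 ?add0r // => i _.
by rewrite /ncone /nilp size_drop subn_eq0 leqNgt ltn_ord mulr0.
Qed.

Lemma nc1mul f : ncmul ncone f = f.
Proof.
apply/funext => w; rewrite /ncmul big_ord_recl take0 drop0 mul1r big1 ?addr0 // => i _.
by rewrite /ncone /nilp size_takel ?lift0 ?mul0r // lift0 ltn_ord.
Qed.

End NCSeries.

Section RibbonProduct.
Variables (c : family) (m n p : nat).
Hypothesis lo_m : (lo c <= m)%N.
Hypothesis mnp : (m + n)%N = p.

(** Only the cut after m letters contributes, and the conditions left and right of it leave the
    comparison at m open: the two terms on the right distinguish whether there is a descent. *)
Lemma ribbon_mul (I : subset (vertex (cdiagram c m))) (K : subset (vertex (cdiagram TypeA n))) :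
  ncmul (ribbon_set c m I) (ribbon_set TypeA n K) =
  ribbon_set c p (glue lo_m mnp false I K) +
    (if vertex (cdiagram c p) m then ribbon_set c p (glue lo_m mnp true I K) else 0).
Proof.
apply/funext => w; have [wp|wp] := eqVneq (size w) p; last first.
  have E b : has_pattern c p (glue lo_m mnp b I K) w = false by rewrite /has_pattern (negPf wp).
  rewrite ncseriesD /ribbon_set E; rewrite [LHS]big1 => [|i _].
    by case: ifP => _ //; rewrite E.
  apply/eqP; rewrite mulf_eq0; apply/orP.
  have [im|im] := eqVneq (size (take i w)) m; last by left; rewrite /has_pattern (negPf im).
  right; have [iN|iN] := eqVneq (size (drop i w)) n; last by rewrite /has_pattern (negPf iN).
  case/eqP: wp.
  by rewrite -mnp -im -iN -size_cat cat_take_drop.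
have mp : (m <= size w)%N by rewrite wp -mnp leq_addr.
rewrite [LHS](bigD1 (Ordinal (mp : (m < (size w).+1)%N))) //= [X in _ + X]big1 ?addr0; last first.
  move=> i im; rewrite /ribbon_set /has_pattern size_takel ?leq_ord //.
  by have /negPf-> : (i : nat) != m by [].
have letL j : vertex (cdiagram c m) j -> (letter (take m w) j.+1 = letter w j.+1) /\
    (letter (take m w) j = letter w j).
  move=> Vj; have jm := vertex_bound Vj; split; first exact: nth_take.
  case: j Vj jm => [|j] Vj jm; last by apply: nth_take; exact: ltnW.
  (* The letter at 0 is -w_2, and in type D the second letter survives the cut because m is at least
     2. *)
  rewrite /= nth_take //; by move: Vj lo_m; case: (c).
have letR j : vertex (cdiagram TypeA n) j -> (letter (drop m w) j.+1 = letter w (m + j).+1) /\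
    (letter (drop m w) j = letter w (m + j)%N).
  by case: j => [|j] //= Vj; rewrite !nth_drop addnS.
have E b : has_pattern c p (glue lo_m mnp b I K) w = has_pattern c m I (take m w) &&
    has_pattern TypeA n K (drop m w) &&
    (vertex (cdiagram c p) m ==> ((letter w m.+1 < letter w m) == b)).
  apply/has_patternP/andP => [[_ h]|[/andP[/has_patternP[_ h1] /has_patternP[_ h2]] h3]].
    split; [apply/andP; split|].
    - apply/has_patternP; split=> [|j Vj]; first by rewrite size_takel.
      have [-> ->] := letL j Vj; have jm := vertex_bound Vj.
      have /andP[Vp _] : par_letters c m p j by apply/(par_lettersP lo_m mnp); left.
      rewrite (h j Vp) /= jm ltnNge (ltnW jm) (ltn_eqF jm) /= ?andbF ?orbF //.
    - apply/has_patternP; split=> [|j Vj]; first by rewrite size_drop wp -mnp addKn.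
      have [-> ->] := letR j Vj; have j0 : (0 < j)%N by case/andP: Vj.
      have mj : (m < m + j)%N by rewrite -[X in (X < _)%N]addn0 ltn_add2l.
      have /andP[Vp _] : par_letters c m p (m + j)%N.
        by apply/(par_lettersP lo_m mnp); right; rewrite addKn.
      by rewrite (h _ Vp) /= mj ltnNge (ltnW mj) (gtn_eqF mj) addKn /= ?andbF ?orbF.
    - by apply/implyP => Vm; rewrite (h m Vm) /= ltnn eqxx Vm /= andbT; apply/eqP.
  split=> // j Vj /=; have [jm|jm|jm] := ltngtP j m.
  - have Vj' : vertex (cdiagram c m) j.
      have /(par_lettersP lo_m mnp)[[]//|[]] : par_letters c m p j.
        by rewrite /par_letters Vj neq_ltn jm.
      by rewrite ltnNge ltnW.
    by have := h1 j Vj'; have [-> ->] := letL j Vj'; rewrite /= ?andbF ?orbF.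
  - have Vj' : vertex (cdiagram TypeA n) (j - m)%N.
      have /(par_lettersP lo_m mnp)[[]|[]//] : par_letters c m p j.
        by rewrite /par_letters Vj neq_ltn jm orbT.
      by rewrite ltnNge ltnW.
    have := h2 _ Vj'; have [-> ->] := letR _ Vj'; rewrite subnKC ?(ltnW jm) // => ->.
    by rewrite /= ?andbF ?orbF.
  - have Vm : vertex (cdiagram c p) m by rewrite -jm.
    by rewrite Vj andbT /=; move: h3; rewrite Vm => /eqP <-; rewrite andbT jm.
rewrite ncseriesD /ribbon_set -PoszM mulnb.
set a := has_pattern c m I _ && _ in E *.
rewrite (E false) -/a; case: ifP => Vm; rewrite ?(E true) -/a ?Vm //= ?andbT ?addr0 //.
by case: (a) => //=; case: (_ < _).
Qed.
End RibbonProduct.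

Section Action.
Variables (F : fieldType) (c : family).

Lemma degree_sum k n : (lo c + k + (lo TypeA + n))%N = (lo c + (k + n))%N.
Proof. by rewrite -addnA. Qed.

Definition ind_deg k n (u : K0 (H0 F c (lo c + k))) (v : K0 (H0 F TypeA (lo TypeA + n))) :
    K0sum F c :=
  dsum_in (V := fun k => K0 (H0 F c (lo c + k))) (n := (k + n)%N)
    (ind_class (leq_addr k (lo c)) (degree_sum k n) u v).

Lemma ind_deg_bi k n : biadditive (@ind_deg k n).
Proof.
have [r l] := ind_class_bi F (leq_addr k (lo c)) (degree_sum k n).
by split=> [u v v'|v u u']; rewrite /ind_deg ?r ?l dsum_inD.
Qed.

Definition induction_act (x : K0sum F c) (a : K0sum F TypeA) : K0sum F c :=
  dsum_lift (fun k u => dsum_lift (fun n v => ind_deg u v) a) x.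

Let act_r k (u : K0 (H0 F c (lo c + k))) n : addm (@ind_deg k n u).
Proof. exact: biaddr (ind_deg_bi k n). Qed.

Let act_l (a : K0sum F TypeA) k :
  addm (fun u : K0 (H0 F c (lo c + k)) => dsum_lift (fun n v => ind_deg u v) a).
Proof.
move=> u u'; move: a; apply: dsum_ind => [|a b ha hb|n v].
- by rewrite !(addm0 (dsum_liftD (act_r _))) addr0.
- by rewrite !(addmB (dsum_liftD (act_r _))) ha hb opprD addrACA.
- by rewrite !(dsum_liftE (act_r _)) (proj2 (ind_deg_bi k n)).
Qed.

Lemma induction_actE k n (M : prep (H0 F c (lo c + k))) (N : prep (H0 F TypeA (lo TypeA + n))) :
  induction_act (K0cl M) (K0cl N) =
  K0cl (ind_prep (leq_addr k (lo c)) (degree_sum k n) M N).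
Proof.
rewrite /induction_act /K0cl (dsum_liftE (act_l _)) (dsum_liftE (act_r _)).
by rewrite /ind_deg ind_classE.
Qed.

Lemma induction_act_bi : biadditive induction_act.
Proof.
have LD a := dsum_liftD (act_l a); split=> [x a b|a]; last exact: (LD a).
move: x; apply: dsum_ind => [|x y hx hy|k u].
- by rewrite /induction_act !(addm0 (LD _)) addr0.
- by rewrite /induction_act !(addmB (LD _)) -!/(induction_act _ _) hx hy opprD addrACA.
- by rewrite /induction_act !(dsum_liftE (act_l _)) (dsum_liftD (act_r u)).
Qed.

Lemma induction_actP : is_induction induction_act.
Proof.
split; first exact: induction_act_bi.
move=> k n M N; exists (outer_rep (leq_addr k (lo c)) (degree_sum k n) M N).
exists (ind_prep (leq_addr k (lo c)) (degree_sum k n) M N); split.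
- exact: outerP.
- exact: ind_prepP.
- exact: induction_actE.
Qed.

Lemma induction_act_in k n (u : K0 (H0 F c (lo c + k))) (v : K0 (H0 F TypeA (lo TypeA + n))) :
  induction_act (dsum_in (V := fun k => K0 (H0 F c (lo c + k))) u)
    (dsum_in (V := fun k => K0 (H0 F TypeA (lo TypeA + k))) v) = ind_deg u v.
Proof. by rewrite /induction_act (dsum_liftE (act_l _)) (dsum_liftE (act_r _)). Qed.

Lemma induction_act_pim k n (I : subset (vertex (cdiagram c (lo c + k))))
    (K : subset (vertex (cdiagram TypeA (lo TypeA + n)))) :
  induction_act (pim_class F c k I) (pim_class F TypeA n K) =
  pim_class F c (k + n) (glue (leq_addr k (lo c)) (degree_sum k n) false I K) +
  (if vertex (cdiagram c (lo c + (k + n))) (lo c + k)%N then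
     pim_class F c (k + n) (glue (leq_addr k (lo c)) (degree_sum k n) true I K) else 0).
Proof.
rewrite [LHS]induction_act_in /ind_deg ind_class_pim dsum_inD; congr (_ + _).
by case: ifP => // _; rewrite (addm0 (@dsum_inD _ _)).
Qed.

(** On the bases this compares [ind_class_pim] with [ribbon_mul], whose right sides use the same
    [glue]. *)
Lemma ch_act x a : span_val (ch (induction_act x a)) =
  ncmul (span_val (ch x)) (span_val (ch a)).
Proof.
move: x a; apply: (biadd_eq (K0sum_zbasis F c) (K0sum_zbasis F TypeA)
  (f := fun x a => span_val (ch (induction_act x a)))
  (g := fun x a => ncmul (span_val (ch x)) (span_val (ch a)))).
- have [r l] := induction_act_bi.
  by split=> [x a b|a x y]; rewrite ?r ?l chD span_valD.
- by split=> [x a b|a x y]; rewrite !chD !span_valD ?ncmulDr ?ncmulDl.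
move=> [k I] [n K]; rewrite !ch_pim /=.
rewrite (ribbon_mul (leq_addr k (lo c)) (degree_sum k n)).
rewrite induction_act_pim chD span_valD.
set I0 := glue _ _ false _ _; set I1 := glue _ _ true _ _.
rewrite (ch_pim F (existT _ (k + n)%N I0 : lab c)) /=; congr (_ + _); case: ifP => _.
  by rewrite (ch_pim F (existT _ (k + n)%N I1 : lab c)).
by rewrite (addm0 (@chD F c)) (addm0 (@span_valD _ _)).
Qed.

End Action.

Lemma ch_sep (F : fieldType) c (x y : K0sum F c) : span_val (ch x) = span_val (ch y) -> x = y.
Proof. by have [g gK _] := ch_bij F c; move=> /val_inj/(can_inj gK). Qed.

Section Unit.
Variable F : fieldType.
Local Notation H := (H0 F TypeA (lo TypeA + 0)).
Local Notation hA := (hfam_algebra F TypeA (lo TypeA + 0)).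
Local Notation E := (fun _ : nat => false).

(** In degree 0 there are no generators, so the algebra consists of scalars and the character reads
    them off. *)
Lemma algebra0_scalar (a : H) : a = (char hA E a)%:A.
Proof.
move: a; apply: (alg_gen hA) => [|k x y hx hy|x y hx hy|[]//].
- by rewrite char1 scale1r.
- by rewrite charL scalerDl -scalerA -hx -hy.
- by rewrite charM -scalerA -hy -mulr_algl -hx.
Qed.

Lemma simple0_projective : projective (simple hA E).
Proof.
move=> U V g f gsurj; pose e : repmod (simple hA E) := (1%:M : 'M_1).
have [u gu] := gsurj (f e).
have vE (v : repmod (simple hA E)) : v = ((v : 'M_1) 0 0)%:A *: e.
  by rewrite repmod_alg scalemx1; exact: mx11_scalar.
pose h (v : repmod (simple hA E)) : U := ((v : 'M_1) 0 0)%:A *: u.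
have hL : linear h.
  move=> a v w; rewrite /h repmod_scaleE simple_act mul_scalar_mx !mxE.
  have -> k l : (char hA E a * k + l)%:A = a * k%:A + l%:A :> H.
    by rewrite scalerDl -scalerA -mulr_algl -algebra0_scalar.
  by rewrite scalerDl scalerA.
pose hl := GRing.isLinear.Build H (repmod (simple hA E)) U *:%R h hL.
pose h' : {linear repmod (simple hA E) -> U} := HB.pack h hl.
exists h' => v; rewrite /= /h.
have gZ b x : g (b *: x) = b *: g x by exact: linearZ.
have fZ b x : f (b *: x) = b *: f x by exact: linearZ.
by rewrite gZ gu -fZ -vE.
Qed.

Definition unit_prep : prep H := PRep simple0_projective.
Definition unit_class : K0sum F TypeA := K0cl unit_prep.

(** There is only one set of letters, and both classes pair to 1 with its simple. *)
Lemma unit_class_pim : unit_class = pim_class F TypeA 0 (subset_trim (vertex (cdiagram TypeA 0)) E).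
Proof.
rewrite /unit_class /pim_class /K0cl; congr dsum_in.
apply: (@K0_sep _ _ _ _ hA _ (isT : (1 < 2)%N) (@vertex_bound2 TypeA _)) => L.
rewrite !K0_pairE hdim_delta.
have LE : (L : nat -> bool) = E.
  by apply/funext => i; apply/negP => /subsetP; case: i.
have -> : subset_trim (vertex (cdiagram TypeA 0)) E = L by apply: val_inj; apply/funext => i; rewrite /= LE andbF.
rewrite eqxx LE (@dim_hom_line F H (simple hA E) (simple hA E) (1%:M : 'M_1)) //.
- by move=> a; rewrite mulmx1 mul1mx.
- by apply/eqP => /matrixP/(_ 0 0)/eqP; rewrite !mxE oner_eq0.
- by move=> s _; exists (s 0 0); rewrite scalemx1; exact: mx11_scalar.
Qed.

Lemma unit_classP : is_unit unit_class.
Proof. by exists unit_prep. Qed.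

Lemma ch_unit : span_val (ch unit_class) = ncone.
Proof.
rewrite unit_class_pim (ch_pim F (existT _ 0%N (subset_trim (vertex (cdiagram TypeA 0)) E) : lab TypeA)) /=.
by apply/funext => w; rewrite /ribbon_set /has_pattern /positions andbT.
Qed.

Lemma act_deg c m n (x : K0sum F c) a : K0deg m x -> K0deg n a ->
  K0deg (m + n)%N (induction_act x a).
Proof.
have [r l] := induction_act_bi F c; have D0 := fun x => addm0 (r x).
move=> /asboolP hx /asboolP ha; elim: hx => {x} [|_ [k [M [km ->]]]|x y _ hx _ hy].
- by rewrite (addm0 (l a)) /K0deg /= rpred0.
- elim: ha => {a} [|_ [k' [N [kn ->]]]|a b _ hx _ hy].
  + by rewrite (addm0 (r _)) /K0deg /= rpred0.
  + apply: zspan_gen; rewrite induction_actE; exists (k + k')%N; eexists; split=> //.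
    by rewrite -km -kn addnA.
  + by rewrite (addmB (r _)) /K0deg /= rpredB.
- by rewrite (addmB (l a)) /K0deg /= rpredB.
Qed.

Lemma induction_algebra :
  graded_algebra (@K0deg F TypeA) (@induction_act F TypeA) unit_class.
Proof.
split.
- exact: induction_act_bi.
- by move=> x y z; apply: ch_sep; rewrite !ch_act ncmulA.
- by split=> x; apply: ch_sep; rewrite ch_act ch_unit ?nc1mul ?ncmul1.
- by apply: zspan_gen; exists 0%N, unit_prep.
- by move=> m n x y; exact: act_deg.
Qed.

Lemma induction_module c :
  graded_right_module (@K0deg F TypeA) (@induction_act F TypeA) unit_class
    (@K0deg F c) (@induction_act F c).
Proof.
split.
- exact: induction_act_bi.
- by move=> x a b; apply: ch_sep; rewrite !ch_act ncmulA.
- by move=> x; apply: ch_sep; rewrite ch_act ch_unit ncmul1.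
- by move=> m n x y; exact: act_deg.
Qed.

End Unit.

(** * The comodule structure *)

Lemma left_left_part i j (I : nat -> bool) : (j <= i)%N -> left_part j (left_part i I) = left_part j I.
Proof.
move=> ji; apply/funext => k; rewrite /left_part; case: (I k) => //=.
by case kj: (k < j)%N; rewrite ?andbF ?andbT //; apply: leq_trans ji.
Qed.

Lemma right_left_part m l (I : nat -> bool) :
  right_part m (left_part (m + l) I) = left_part l (right_part m I).
Proof. by apply/funext => k; rewrite /right_part /left_part ltn_add2l andbA. Qed.

Lemma right_right_part m l (I : nat -> bool) :
  right_part l (right_part m I) = right_part (m + l) I.
Proof.
apply/funext => k; rewrite /right_part addnA.
by case: (posnP k) => [->//|k0]; rewrite addn_gt0 k0 orbT.
Qed.

Lemma mulz_bil (U V : zmodType) (f : V -> int) : addm f ->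
  biadditive (fun (u : U) v => u *~ f v).
Proof. by move=> fD; split=> [u v v'|v u u']; rewrite ?fD ?mulrzDr ?mulrzDl. Qed.

Lemma mulz_bir (U V : zmodType) (f : U -> int) : addm f ->
  biadditive (fun u (v : V) => v *~ f u).
Proof. by move=> fD; split=> [u v v'|v u u']; rewrite ?fD ?mulrzDr ?mulrzDl. Qed.

Section Coaction.
Variables (F : fieldType) (c : family).
Local Notation GS c := (fun k => G0 (H0 F c (lo c + k))).

Lemma degree_sub k (i : 'I_k.+1) : (lo c + i + (lo TypeA + (k - i)))%N = (lo c + k)%N.
Proof. by rewrite -addnA add0n subnKC // leq_ord. Qed.

Definition restrict_deg k (i : 'I_k.+1) (x : G0 (H0 F c (lo c + k))) :
    tensor (G0 (H0 F c (lo c + i))) (G0 (H0 F TypeA (lo TypeA + (k - i)))) :=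
  restrict_class _ _ x.

Let coact_deg k (x : G0 (H0 F c (lo c + k))) : tensor (G0sum F c) (G0sum F TypeA) :=
  \sum_(i < k.+1) tmap (dsum_in (V := GS c) (n := i))
    (dsum_in (V := GS TypeA) (n := (k - i)%N)) (restrict_deg i x).

Let coact_degD k : addm (@coact_deg k).
Proof.
have tD (i : 'I_k.+1) : addm (tmap (dsum_in (V := GS c) (n := i))
    (dsum_in (V := GS TypeA) (n := (k - i)%N))) := tmapD (@dsum_inD _ _) (@dsum_inD _ _).
have rD (i : 'I_k.+1) : addm (@restrict_deg k i).
  exact: (@restrict_classD F c (lo c + i) (lo TypeA + (k - i)) (lo c + k)).
exact (addm_bigsum _ (fun i => addm_comp (tD i) (rD i))).
Qed.

Definition coaction (x : G0sum F c) : tensor (G0sum F c) (G0sum F TypeA) := dsum_lift coact_deg x.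

Lemma coactionD : addm coaction.
Proof. exact: dsum_liftD. Qed.

Lemma coaction_in k (x : G0 (H0 F c (lo c + k))) :
  coaction (dsum_in (V := GS c) x) = \sum_(i < k.+1) tmap (dsum_in (V := GS c) (n := i))
    (dsum_in (V := GS TypeA) (n := (k - i)%N)) (restrict_deg i x).
Proof. exact: (dsum_liftE coact_degD). Qed.

Lemma coaction_simple k I : coaction (simple_class F c k I) =
  \sum_(i < k.+1) pure (simple_class F c i (left_part (lo c + i) I))
    (simple_class F TypeA (k - i) (right_part (lo c + i) I)).
Proof.
rewrite [LHS]coaction_in; apply: eq_bigr => i _.
rewrite /restrict_deg (restrict_class_simple F (leq_addr i (lo c)) (degree_sub i)).
by rewrite tmap_pure // => x y; exact: dsum_inD.
Qed.

Lemma coactionP : is_restriction coaction.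
Proof.
split; first exact: coactionD.
move=> k Q; exists (fun i => restrict_deg i (G0_class Q)); split; last exact: coaction_in.
move=> i; exists (join_class (leq_addr i (lo c)) (degree_sub i)).
  exact: join_class_identification.
exact: restrict_classE.
Qed.

Lemma simple_class_deg k I : G0deg (lo c + k) (simple_class F c k I).
Proof. by apply: zspan_gen; exists k; eexists. Qed.

End Coaction.

Section Comodule.
Variables (F : fieldType).

Lemma simple_class_eq c (W : zmodType) (f g : G0sum F c -> W) : addm f -> addm g ->
  (forall k I, f (simple_class F c k I) = g (simple_class F c k I)) -> forall x, f x = g x.
Proof. by move=> fD gD fg; apply: (zb_eq (G0sum_zbasis F c)). Qed.

(** On a simple both sides list the ways of cutting its descent set at two places; [f j l] is the
    term with parts of degrees [lo c + j], l and k - j - l. *)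
Lemma coaction_coassoc c (x : G0sum F c) :
  tassoc (tmap (@coaction F c) id (coaction x)) = tmap id (@coaction F TypeA) (coaction x).
Proof.
have D c' := @coactionD F c'; have iD c' := @addm_id (G0sum F c').
have lD := tmapD (D c) (iD TypeA); have rD := tmapD (iD c) (D TypeA).
move: x; apply: simple_class_eq => [||k I].
- by apply: addm_comp (@tassocD _ _ _) _; exact: addm_comp lD (D c).
- exact: addm_comp rD (D c).
rewrite coaction_simple (addm_sum lD) (addm_sum (@tassocD _ _ _)) (addm_sum rD).
pose f j l := pure (simple_class F c j (left_part (lo c + j) I))
  (pure (simple_class F TypeA l (left_part l (right_part (lo c + j) I)))
     (simple_class F TypeA (k - (j + l)) (right_part (lo c + j + l) I))).
transitivity (\sum_(i < k.+1) \sum_(j < i.+1) f j (i - j)%N).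
  apply: eq_bigr => i _; rewrite tmap_pure // coaction_simple.
  have pl v : addm (fun u => tassoc (@pure (tensor (G0sum F c) (G0sum F TypeA)) (G0sum F TypeA) u v)).
    by move=> x y; rewrite pureDl tassocD.
  rewrite (addm_sum (pl _)); apply: eq_bigr => j _; have ji : (j <= i)%N by rewrite leq_ord.
  rewrite tassoc_pure /f left_left_part ?leq_add2l // subnKC //.
  have -> : (lo c + j + (i - j) = lo c + i)%N by rewrite -addnA subnKC.
  congr (pure _ (pure (simple_class _ _ _ _) _)).
  by rewrite -right_left_part -addnA subnKC.
rewrite triangle_sum; apply: eq_bigr => j _; rewrite tmap_pure // coaction_simple.
have pr u : addm (@pure (G0sum F c) (tensor (G0sum F TypeA) (G0sum F TypeA)) u).
  by move=> x y; rewrite pureDr.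
rewrite (addm_sum (pr _)); apply: eq_bigr => l _.
by rewrite /f -(right_right_part (lo c + j) l) subnDA.
Qed.

Lemma coaction_deg c n (x : G0sum F c) : G0deg n x ->
  tensor_deg (@G0deg F c) (@G0deg F TypeA) n (coaction x).
Proof.
have D := @coactionD F c; have iD k := @dsum_inD (fun k => G0 (H0 F c (lo c + k))) k.
move=> /asboolP; elim=> {x} [|_ [k [M [<- ->]]]|x y _ hx _ hy].
- by rewrite (addm0 D) /tensor_deg /= rpred0.
- rewrite /G0cl; move: (G0_class M); apply: (zb_gen (G0_zbasis (hfam_algebra F c (lo c + k))
    (isT : (1 < (lo c + k).+2)%N) (@vertex_bound2 c (lo c + k)))) => [|x y hx hy|I].
  + by rewrite (addm0 (iD k)) (addm0 D) /tensor_deg /= rpred0.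
  + by rewrite (addmB (iD k)) (addmB D) /tensor_deg /= rpredB.
  + rewrite -[dsum_in _]/(simple_class F c k I) coaction_simple /tensor_deg /=.
    apply: rpred_sum => i _; apply: zspan_gen.
    exists (lo c + i)%N, (lo TypeA + (k - i))%N; do 2!eexists; split; last by [].
    * exact: degree_sub.
    * exact: simple_class_deg.
    * exact: simple_class_deg.
- by rewrite (addmB D) /tensor_deg /= rpredB.
Qed.

Let dimG0 k (x : G0 (H0 F TypeA (lo TypeA + k))) : int :=
  if k == 0%N then G0_lift (fun M => (rdim M)%:Z) x else 0.

Let dim_exact k (M' M M'' : rep (H0 F TypeA (lo TypeA + k))) : short_exact M' M M'' ->
  (rdim M)%:Z = (rdim M')%:Z + (rdim M'')%:Z.
Proof. by move/short_exact_dim->; rewrite PoszD. Qed.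

Let dimG0D k : addm (@dimG0 k).
Proof.
by move=> x y; rewrite /dimG0; case: ifP => _; rewrite ?addr0 ?(G0_liftD (@dim_exact k)).
Qed.

Definition counit (x : G0sum F TypeA) : int := dsum_lift dimG0 x.

Lemma counitD : addm counit.
Proof. exact: dsum_liftD. Qed.

Lemma counitE k (M : rep (H0 F TypeA (lo TypeA + k))) :
  counit (G0cl M) = if k == 0%N then (rdim M)%:Z else 0.
Proof.
rewrite /counit /G0cl (dsum_liftE dimG0D) /dimG0; case: ifP => // _.
exact: (G0_liftE (@dim_exact k)).
Qed.

Lemma counitP : is_counit counit.
Proof. by split; [exact: counitD|exact: counitE]. Qed.

Lemma counit_simple k I : counit (simple_class F TypeA k I) = (k == 0%N)%:Z.
Proof. by rewrite counitE; case: ifP. Qed.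

Lemma coaction_counit_r c (x : G0sum F c) :
  tlift (fun u v => u *~ counit v) (coaction x) = x.
Proof.
have bD := tliftD (mulz_bil (G0sum F c) counitD).
move: x; apply: simple_class_eq => // [|k I].
  exact: addm_comp bD (@coactionD F c).
(* Only the last cut leaves degree 0 on the right, and its left part is the whole descent set. *)
rewrite coaction_simple (addm_sum bD) big_ord_recr /= big1 ?add0r => [|i _].
  rewrite tlift_pure ?counit_simple ?subnn; last exact: mulz_bil counitD.
  apply: simple_class_ext => j Vj.
  by rewrite /left_part (vertex_bound Vj) andbT.
rewrite tlift_pure ?counit_simple; last exact: mulz_bil counitD.
by rewrite subn_eq0 leqNgt ltn_ord mulr0z.
Qed.

Lemma coaction_counit_l (x : G0sum F TypeA) :
  tlift (fun u v => v *~ counit u) (coaction x) = x.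
Proof.
have bD := tliftD (mulz_bir (G0sum F TypeA) counitD).
move: x; apply: simple_class_eq => // [|k I].
  exact: addm_comp bD (@coactionD F TypeA).
rewrite coaction_simple (addm_sum bD) big_ord_recl big1 ?addr0 => [|i _].
  rewrite tlift_pure ?counit_simple /= ?subn0; last exact: mulz_bir counitD.
  apply: simple_class_ext => j Vj.
  by rewrite /right_part !add0n; case/andP: Vj => -> _.
by rewrite tlift_pure ?counit_simple ?mulr0z //; exact: mulz_bir counitD.
Qed.

Lemma counit_deg n (x : G0sum F TypeA) : n != 0%N -> G0deg n x -> counit x = 0.
Proof.
move=> n0 /asboolP; elim=> {x} [|_ [k [M [kn ->]]]|x y _ hx _ hy].
- exact: addm0 counitD.
- by rewrite counitE; case: eqP => // k0; rewrite -kn k0 in n0.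
- by rewrite (addmB counitD) hx hy subr0.
Qed.

Lemma restriction_coalgebra :
  graded_coalgebra (@G0deg F TypeA) (@coaction F TypeA) counit.
Proof.
split.
- by split; [exact: coactionD|exact: counitD].
- exact: coaction_coassoc.
- by split; [exact: coaction_counit_l|exact: coaction_counit_r].
- exact: counit_deg.
- exact: coaction_deg.
Qed.

Lemma restriction_comodule c :
  graded_right_comodule (@G0deg F TypeA) (@coaction F TypeA) counit
    (@G0deg F c) (@coaction F c).
Proof.
split.
- exact: coactionD.
- exact: coaction_coassoc.
- exact: coaction_counit_r.
- exact: coaction_deg.
Qed.

End Comodule.

(** * Splitting fundamental functions over two alphabets *)

Section StepsCat.
Variables (c : family) (m n p : nat).
Hypothesis lo_m : (lo c <= m)%N.
Hypothesis mnp : (m + n)%N = p.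

(* The letters of the second alphabet are larger than those of the first one, so
   that the condition at position [m] always holds. *)
Lemma has_steps_cat (I : nat -> bool) (u v : seq int) (N : nat) :
  size u = m -> size v = n -> all (fun x => x <= N%:Z) u -> all (fun x => 1 <= x) v ->
  has_steps c p I (u ++ [seq N%:Z + x | x <- v]) =
  has_steps c m (left_part m I) u && has_steps TypeA n (right_part m I) v.
Proof.
move=> um vn /allP uN /allP v1; set w := u ++ _.
have wE j : nth 0 w j = if (j < m)%N then nth 0 u j else nth 0 [seq N%:Z + x | x <- v] (j - m)%N.
  by rewrite nth_cat um.
have letL j : vertex (cdiagram c m) j -> (letter w j.+1 = letter u j.+1) /\ (letter w j = letter u j).
  move=> Vj; have jm := vertex_bound Vj; rewrite /= wE jm; split=> //.
  case: j Vj jm => [|j] Vj jm; last by rewrite /= wE (ltnW jm).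
  (* The letter at 0 is minus the second letter, which still belongs to the first alphabet. *)
  have m1 : (1 < m)%N by move: Vj lo_m; case: (c).
  by rewrite /= wE m1.
have letR j : vertex (cdiagram TypeA n) j -> (letter w (m + j).+1 = N%:Z + letter v j.+1) /\
    (letter w (m + j)%N = N%:Z + letter v j).
  move=> Vj; have jn := vertex_bound Vj.
  have E i : (i < n)%N -> nth 0 w (m + i)%N = N%:Z + nth 0 v i.
    by move=> lin; rewrite wE ltnNge leq_addr /= addKn (nth_map 0) ?vn.
  case: j Vj jn => [|j] // Vj jn; split; first exact: E.
  by rewrite addnS /= E // ltnW.
apply/has_stepsP/andP => [[_ hA h]|[/has_stepsP[_ hA h1] /has_stepsP[_ _ h2]]].
  split; apply/has_stepsP; split=> //.
  - by move=> /hA; rewrite all_cat => /andP[].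
  - move=> j Vj; have [<- <-] := letL j Vj; have jm := vertex_bound Vj.
    rewrite /left_part jm andbT; apply: h.
    by have /andP[] : par_letters c m p j by apply/(par_lettersP lo_m mnp); left.
  - by move=> _; apply/allP.
  - move=> j Vj; have j0 : (0 < j)%N by case/andP: Vj.
    have Vp : vertex (cdiagram c p) (m + j)%N.
      have /andP[//] : par_letters c m p (m + j)%N.
      apply/(par_lettersP lo_m mnp); right; rewrite addKn; split=> //.
      by rewrite -[X in (X < _)%N]addn0 ltn_add2l.
    have := h _ Vp; have [-> ->] := letR j Vj.
    by rewrite lteifD2l /right_part j0.
split.
- by rewrite size_cat size_map um vn.
- move=> cA; rewrite all_cat hA //; apply/allP => _ /mapP[x /v1 x1 ->].
  by apply: le_trans x1 _; rewrite lerDr.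
move=> j Vj; have [jm|jm|jm] := ltngtP j m.
- have Vj' : vertex (cdiagram c m) j.
    have /(par_lettersP lo_m mnp)[[]//|[]] : par_letters c m p j.
      by rewrite /par_letters Vj neq_ltn jm.
    by rewrite ltnNge ltnW.
  by have [-> ->] := letL j Vj'; have := h1 j Vj'; rewrite /left_part jm andbT.
- have Vj' : vertex (cdiagram TypeA n) (j - m)%N.
    have /(par_lettersP lo_m mnp)[[]|[]//] : par_letters c m p j.
      by rewrite /par_letters Vj neq_ltn jm orbT.
    by rewrite ltnNge ltnW.
  have := letR _ Vj'; rewrite subnKC ?(ltnW jm) // => -[-> ->].
  rewrite lteifD2l; have := h2 _ Vj'.
  by rewrite /right_part subn_gt0 jm subnKC // ltnW.
- rewrite jm in Vj *.
  have m0 : (0 < m)%N by move: Vj lo_m; case: (c) => /=; [case/andP|case: (m)].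
  have n0 : (0 < n)%N by have := vertex_bound Vj; rewrite -mnp -[X in (X < _)%N]addn0 ltn_add2l.
  have E1 : letter w m <= N%:Z.
    rewrite -(prednK m0) /= wE prednK // leqnn; apply: uN.
    by apply: mem_nth; rewrite um prednK.
  have E2 : N%:Z < letter w m.+1.
    rewrite /= wE ltnn subnn (nth_map 0) ?vn //.
    have : 1 <= nth 0 v 0 by apply: v1; apply: mem_nth; rewrite vn.
    by lia.
  by apply: lteifS; exact: le_lt_trans E2.
Qed.
End StepsCat.

Section TwoAlphabets.
Variable c : family.
Local Notation srt mu := (sort <=%O (enum_mset mu)).

(** As [N] bounds the first alphabet from above, sorting leaves the shifted second one behind it. *)
Lemma srt_shift (mu nu : {mset int}%mset) (N : nat) :
  all (fun x => x <= N%:Z) (enum_mset mu) -> all (fun x => 1 <= x) (enum_mset nu) ->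
  srt (mu `+` seq_mset [seq N%:Z + j | j <- enum_mset nu])%mset =
  srt mu ++ [seq N%:Z + x | x <- srt nu].
Proof.
move=> /allP muN /allP nu1; apply: (sorted_eq le_trans le_anti (sort_le_sorted _)).
  rewrite (sorted_pairwise le_trans) pairwise_cat -!(sorted_pairwise le_trans).
  rewrite sort_le_sorted /= sorted_map; apply/andP; split; last first.
    by rewrite (eq_sorted (e' := <=%O)) ?sort_le_sorted // => x y; rewrite /= lerD2l.
  apply/allrelP => x z; rewrite mem_sort => /muN xN /mapP[y].
  by rewrite mem_sort => /nu1 y1 ->; lia.
rewrite perm_sort; apply/allP => a _ /=.
by rewrite count_mem_mset msetE2 mset_seqE count_cat !count_map !count_sort -(count_mem_mset a mu).
Qed.

(** The degree of mu dictates where the sorted sequence is cut, so at most one term survives, with i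
    the size of mu minus [lo c]. *)
Lemma two_alphabetsE (k : nat) I p :
  two_alphabets c (fundamental_set c (lo c + k)%N I) p =
  \sum_(i < k.+1) outer_series (fundamental_set c (lo c + i)%N (left_part (lo c + i) I))
     (fundamental_set TypeA (lo TypeA + (k - i))%N (right_part (lo c + i) I)) p.
Proof.
case: p => mu nu; rewrite /two_alphabets /outer_series /fundamental_set /=.
set N := \max_(i <- _) _.
case: (leqP (lo c) (size (enum_mset mu))) => [cm|cm] /=; last first.
  rewrite big1 // => i _; rewrite (_ : has_steps c _ _ _ = false) ?mul0r //.
  apply/negP => /has_stepsP[+ _ _]; rewrite size_sort => e.
  by move: cm; rewrite e ltnNge leq_addr.
case nu1: (all _ (enum_mset nu)); last first.
  rewrite big1 // => i _; rewrite [X in _ * X](_ : _ = 0) ?mulr0 //.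
  rewrite (_ : has_steps TypeA _ _ _ = false) //.
  apply/negP => /has_stepsP[_ /(_ erefl) + _].
  by rewrite (eq_all_r (mem_sort _ _)) nu1.
have muN : all (fun x => x <= N%:Z) (enum_mset mu).
  apply/allP => x xmu; apply: le_trans (ler_norm x) _; rewrite -abszE lez_nat.
  exact: (leq_bigmax_seq (F := fun x : int => `|x|%N) x xmu).
rewrite srt_shift //.
have [e|ne] := eqVneq (size (enum_mset mu) + size (enum_mset nu))%N (lo c + k)%N; last first.
  rewrite (_ : has_steps c _ _ _ = false); last first.
    apply/negP => /has_stepsP[+ _ _]; rewrite size_cat size_map !size_sort.
    by move/eqP; rewrite (negPf ne).
  rewrite big1 // => i _; apply/eqP; rewrite mulf_eq0; apply/orP.
  have [/has_stepsP[e1 _ _]|_] := boolP (has_steps c _ _ _); last by left.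
  have [/has_stepsP[e2 _ _]|_] := boolP (has_steps TypeA _ _ _); last by right.
  case/eqP: ne; move: e1 e2; rewrite !size_sort => -> ->.
  exact: degree_sub.
set m := size (enum_mset mu) in e cm *; have mk : (m - lo c < k.+1)%N by lia.
rewrite (bigD1 (Ordinal mk)) //= [X in _ + X]big1 ?addr0 => [|i im]; last first.
  rewrite (_ : has_steps c _ _ _ = false) ?mul0r //.
  apply/negP => /has_stepsP[+ _ _]; rewrite size_sort => e1.
  by case/eqP: im; apply: val_inj; rewrite /= /m e1 addKn.
rewrite subnKC // -PoszM mulnb; congr (nat_of_bool _)%:Z.
have -> : (lo TypeA + (k - (m - lo c)) = size (enum_mset nu))%N.
  have h : forall a b v l : nat, (l <= a)%N -> (a + v = l + b)%N -> (b - (a - l))%N = v.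
    by move=> a b v l; lia.
  exact: h cm e.
apply: (has_steps_cat cm e); rewrite ?size_sort //.
  by rewrite (eq_all_r (mem_sort _ _)).
by rewrite (eq_all_r (mem_sort _ _)).
Qed.

Lemma two_alphabetsD : addm (two_alphabets c).
Proof.
move=> f g; apply/funext => -[mu nu]; rewrite [RHS]/(two_alphabets _ _ _ + two_alphabets _ _ _) /=.
by case: ifP => _; rewrite ?addr0.
Qed.

Lemma outer_series_bi : biadditive outer_series.
Proof.
split=> [f g h|f g h]; apply/funext => p.
  exact: mulrDr.
exact: mulrDl.
Qed.

End TwoAlphabets.

Section QuasisymmetricCoaction.
Variables (F : fieldType) (c : family).

Lemma Ch_inv_subproof : exists g, cancel (@Ch F c) g /\ cancel g (@Ch F c).
Proof. by have [g gK Kg] := Ch_bij F c; exists g. Qed.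

Definition Ch_inv : QSym c -> G0sum F c := sval (cid Ch_inv_subproof).

Lemma ChK : cancel (@Ch F c) Ch_inv.
Proof. by have [] := svalP (cid Ch_inv_subproof). Qed.

Lemma Ch_invK : cancel Ch_inv (@Ch F c).
Proof. by have [] := svalP (cid Ch_inv_subproof). Qed.

(** Transport of the restriction along [Ch] makes compatibility immediate; what remains to be proved
    is that the result is the substitution of two alphabets. *)
Definition alphabet_coaction (f : QSym c) : tensor (QSym c) (QSym TypeA) :=
  tmap (@Ch F c) (@Ch F TypeA) (coaction (Ch_inv f)).

Lemma alphabet_coaction_Ch x :
  alphabet_coaction (Ch x) = tmap (@Ch F c) (@Ch F TypeA) (coaction x).
Proof. by rewrite /alphabet_coaction ChK. Qed.

Lemma alphabet_coactionP : is_alphabet_coaction alphabet_coaction.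
Proof.
have tD : addm (tmap (@Ch F c) (@Ch F TypeA)) := tmapD (@ChD F c) (@ChD F TypeA).
have sbi : biadditive (fun (g : QSym c) (h : QSym TypeA) => outer_series (span_val g) (span_val h)).
  have [r l] := outer_series_bi.
  by split=> [f g h|f g h]; rewrite span_valD ?r ?l.
have sD := tliftD sbi.
split=> [f g|f].
  have invD : Ch_inv (f + g) = Ch_inv f + Ch_inv g.
    by apply: (can_inj ChK); rewrite ChD !Ch_invK.
  by rewrite /alphabet_coaction invD coactionD tD.
rewrite -(Ch_invK f); move: (Ch_inv f) => {f} x; rewrite alphabet_coaction_Ch.
move: x; apply: simple_class_eq => [||k I].
- exact: addm_comp sD (addm_comp tD (@coactionD F c)).
- by move=> x y; rewrite ChD span_valD two_alphabetsD.
rewrite coaction_simple (addm_sum tD) (addm_sum sD) Ch_simple.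
apply/funext => p; rewrite two_alphabetsE.
rewrite [LHS](big_morph (fun f : series2 => f p) (id1 := 0) (op1 := +%R)) //.
apply: eq_bigr => i _; rewrite tmap_pure; [|exact: ChD|exact: ChD].
by rewrite (tlift_pure sbi) !Ch_simple.
Qed.
End QuasisymmetricCoaction.

(** * The pairing *)

Section Pairing.
Variables (F : fieldType) (c : family).
Local Notation hk k := (hfam_algebra F c (lo c + k)).

(** Declaring the two bases dual makes biadditivity immediate; [pairing_cl] then identifies the
    values with dimensions of Hom. *)
Definition pairing (x : K0sum F c) (z : G0sum F c) : int :=
  zlift2 (K0sum_zbasis F c) (G0sum_zbasis F c) (fun l l' => (l == l')%:Z) x z.

Lemma pairing_bi : biadditive pairing.
Proof. exact: zlift2_bi. Qed.

Lemma pairing_basis (l l' : lab c) :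
  pairing (pim_class F c (tag l) (tagged l)) (simple_class F c (tag l') (tagged l')) = (l == l')%:Z.
Proof. exact: (zlift2E (K0sum_zbasis F c) (G0sum_zbasis F c)). Qed.

Let zG k := G0_zbasis (hk k) (isT : (1 < (lo c + k).+2)%N) (@vertex_bound2 c (lo c + k)).
Let zK k := K0_zbasis (hk k) (isT : (1 < (lo c + k).+2)%N) (@vertex_bound2 c (lo c + k)).

Lemma pairing_cl k (P : prep (H0 F c (lo c + k))) (M : rep (H0 F c (lo c + k))) :
  pairing (K0cl P) (G0cl M) = (hdim P M)%:Z.
Proof.
have [pr pl] := pairing_bi.
have iG := @dsum_inD (fun k => G0 (H0 F c (lo c + k))) k.
have iK := @dsum_inD (fun k => K0 (H0 F c (lo c + k))) k.
have stepM (I : subset (vertex (cdiagram c (lo c + k)))) (v : G0 (H0 F c (lo c + k))) :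
    pairing (pim_class F c k I) (dsum_in (V := fun k => G0 (H0 F c (lo c + k))) v) =
    G0_pair (pim (hk k) (isT : (1 < (lo c + k).+2)%N) (@vertex_bound2 c (lo c + k)) I) v.
  move: v; apply: (zb_eq (zG k)) => [||J]; [exact: addm_comp (pr _) iG|exact: G0_pairD|].
  rewrite G0_pairE hdim_delta.
  have := pairing_basis (existT _ k I) (existT _ k J); rewrite -tag_eqE /tag_eq eqxx /= tagged_asE.
  by [].
have stepK (u : K0 (H0 F c (lo c + k))) :
    pairing (dsum_in (V := fun k => K0 (H0 F c (lo c + k))) u) (G0cl M) = K0_pair u M.
  move: u; apply: (zb_eq (zK k)) => [||I]; [exact: addm_comp (pl _) iK|exact: K0_pairD|].
  by rewrite [LHS]stepM G0_pairE K0_pairE.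
by rewrite [LHS]stepK K0_pairE.
Qed.

Lemma pairing_degree k l (P : prep (H0 F c (lo c + k))) (M : rep (H0 F c (lo c + l))) :
  k != l -> pairing (K0cl P) (G0cl M) = 0.
Proof.
move=> kl; have [pr pl] := pairing_bi.
have iG := @dsum_inD (fun k => G0 (H0 F c (lo c + k))) l.
have iK := @dsum_inD (fun k => K0 (H0 F c (lo c + k))) k.
rewrite /K0cl /G0cl; move: (K0_class P) (G0_class M) => u v; move: u.
apply: (zb_gen (zK k)) => [|u u' hu hu'|I].
- by rewrite (addm0 iK) (addm0 (pl _)).
- by rewrite (addmB iK) (addmB (pl _)) hu hu' subr0.
move: v; apply: (zb_gen (zG l)) => [|v v' hv hv'|J].
- by rewrite (addm0 iG) (addm0 (pr _)).
- by rewrite (addmB iG) (addmB (pr _)) hv hv' subr0.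
have := pairing_basis (existT _ k I) (existT _ l J).
by rewrite -tag_eqE /tag_eq /= (negPf kl).
Qed.

Lemma pairingP : is_pairing pairing.
Proof.
split; first exact: pairing_bi.
  by move=> k P M; exists (hdim P M); [exact: hdimP|exact: pairing_cl].
exact: pairing_degree.
Qed.

Lemma pairing_simple k l (P : prep (H0 F c (lo c + k))) L :
  pairing (K0cl P) (simple_class F c l L) = if l == k then (hdim P (simple (hk k) L))%:Z else 0.
Proof.
have [->|lk] := eqVneq l k; first exact: pairing_cl.
by rewrite pairing_degree // eq_sym.
Qed.
End Pairing.

(** On basis elements the left side is the Hom formula for induced modules; on the right the degrees
    leave only the cut i = k, which gives the same product of dimensions. *)
Lemma pairing_dual (F : fieldType) c (x : K0sum F c) a (z : G0sum F c) :
  pairing (induction_act x a) z = tlift (fun u v => pairing x u * pairing a v) (coaction z).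
Proof.
have [pr pl] := @pairing_bi F c; have [pAr pAl] := @pairing_bi F TypeA.
have bi (y : K0sum F c) (b : K0sum F TypeA) :
    biadditive (fun (u : G0sum F c) (v : G0sum F TypeA) => pairing y u * pairing b v).
  by split=> [u v v'|v u u']; rewrite ?pAr ?pr ?mulrDr ?mulrDl.
have tD := fun y b => tliftD (bi y b).
move: z; apply: simple_class_eq => [|| d L]; first exact: pr.
  exact: addm_comp (tD _ _) (@coactionD F c).
rewrite coaction_simple (addm_sum (tD _ _)).
under eq_bigr => i _ do rewrite (tlift_pure (bi _ _)).
move: x a; apply: (biadd_eq (K0sum_zbasis F c) (K0sum_zbasis F TypeA)
  (f := fun x a => pairing (induction_act x a) (simple_class F c d L))
  (g := fun x a => \sum_(i < d.+1) pairing x (simple_class F c i (left_part (lo c + i) L)) *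
     pairing a (simple_class F TypeA (d - i) (right_part (lo c + i) L)))).
- have [r l] := induction_act_bi F c.
  by split=> [x a b|a x y]; rewrite ?r ?l pl.
- split=> [x a b|a x y]; rewrite -big_split; apply: eq_bigr => i _ /=.
    by rewrite pAl mulrDr.
  by rewrite pl mulrDl.
move=> [k I] [n K]; rewrite [in LHS]induction_actE pairing_simple hdim_ind_prep.
have [->|ne] := eqVneq d (k + n)%N; last first.
  rewrite big1 // => i _; rewrite !pairing_simple; case: eqP => [ik|_]; last by rewrite mul0r.
  case: eqP => [e|_]; last by rewrite mulr0.
  by case/eqP: ne; move: ik e => /= <- <-; rewrite subnKC // leq_ord.
have kn : (k < (k + n).+1)%N by rewrite ltnS leq_addr.
rewrite (bigD1 (Ordinal kn)) //= [X in _ + X]big1 ?addr0 => [|i ik]; last first.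
  by rewrite pairing_simple (negPf (ik : (i : nat) != k)) mul0r.
by rewrite !pairing_simple eqxx addKn eqxx PoszM.
Qed.

Theorem proposition4p10 (F : fieldType) :
  exists (mulA : K0sum F TypeA -> K0sum F TypeA -> K0sum F TypeA)
         (one : K0sum F TypeA)
         (actD : K0sum F TypeD -> K0sum F TypeA -> K0sum F TypeD)
         (coA : G0sum F TypeA -> tensor (G0sum F TypeA) (G0sum F TypeA))
         (eps : G0sum F TypeA -> int)
         (coD : G0sum F TypeD -> tensor (G0sum F TypeD) (G0sum F TypeA)),
  [/\ is_induction mulA, is_unit one & is_induction actD] /\
  [/\ is_restriction coA, is_counit eps & is_restriction coD] /\
  [/\ (* (i) *)
      [/\ graded_algebra (@K0deg F TypeA) mulA one,
          graded_right_module (@K0deg F TypeA) mulA one (@K0deg F TypeD) actD &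
          exists (ch : K0sum F TypeA -> NSym TypeA)
                 (chD : K0sum F TypeD -> NSym TypeD),
          [/\ is_ch ch, is_ch chD,
              span_val (ch one) = ncone,
              forall a b, span_val (ch (mulA a b))
                          = ncmul (span_val (ch a)) (span_val (ch b)) &
              forall x a, span_val (chD (actD x a))
                          = ncmul (span_val (chD x)) (span_val (ch a))]],
      (* (ii) *)
      [/\ graded_coalgebra (@G0deg F TypeA) coA eps,
          graded_right_comodule (@G0deg F TypeA) coA eps (@G0deg F TypeD) coD &
          exists (deltaA : QSym TypeA -> tensor (QSym TypeA) (QSym TypeA))
                 (deltaD : QSym TypeD -> tensor (QSym TypeD) (QSym TypeA))
                 (Ch : G0sum F TypeA -> QSym TypeA)
                 (ChD : G0sum F TypeD -> QSym TypeD),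
          [/\ is_alphabet_coaction deltaA, is_alphabet_coaction deltaD,
              is_Ch Ch, is_Ch ChD &
              (forall x, deltaA (Ch x) = tmap Ch Ch (coA x)) /\
              (forall x, deltaD (ChD x) = tmap ChD Ch (coD x))]] &
      (* (iii) *)
      exists (prA : K0sum F TypeA -> G0sum F TypeA -> int)
             (prD : K0sum F TypeD -> G0sum F TypeD -> int),
      [/\ is_pairing prA, is_pairing prD &
          forall x a z, prD (actD x a) z
                        = tlift (fun u v => prD x u * prA a v) (coD z)]].
Proof.
exists (@induction_act F TypeA), (unit_class F), (@induction_act F TypeD).
exists (@coaction F TypeA), (@counit F), (@coaction F TypeD).
split; [|split]; [split|split|split; [split|split|]].
- exact: induction_actP.
- exact: unit_classP.
- exact: induction_actP.
- exact: coactionP.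
- exact: counitP.
- exact: coactionP.
- exact: induction_algebra.
- exact: induction_module.
- exists (@ch F TypeA), (@ch F TypeD); split.
  + exact: ch_is_ch.
  + exact: ch_is_ch.
  + exact: ch_unit.
  + exact: ch_act.
  + exact: ch_act.
- exact: restriction_coalgebra.
- exact: restriction_comodule.
- exists (@alphabet_coaction F TypeA), (@alphabet_coaction F TypeD), (@Ch F TypeA), (@Ch F TypeD).
  split.
  + exact: alphabet_coactionP.
  + exact: alphabet_coactionP.
  + exact: Ch_is_Ch.
  + exact: Ch_is_Ch.
  + by split=> x; exact: alphabet_coaction_Ch.
- exists (@pairing F TypeA), (@pairing F TypeD); split.
  + exact: pairingP.
  + exact: pairingP.
  + exact: pairing_dual.
Qed.
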